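(* Let $L\in\mathbb{K}[T]$ be a separable $\bar q$-linearized polynomial of degree $q$ which is not $\bar q^k$-linearized for any $k\ge 2$, and let $\mathcal{X}_{(L,L)}$ be the nonsingular model of the plane curve with affine equation $L(X)\cdot L(Y)=1$. The full automorphism group of $\mathcal{X}_{(L,L)}$ over $\mathbb{K}$ is the semidirect product $\Sigma\rtimes\Delta$, where (a) $\Sigma=\{\tau_{\alpha,\beta}:(X,Y)\mapsto(X+\alpha,Y+\beta)\mid L(\alpha)=L(\beta)=0\}$ is an elementary abelian $p$-group of order $q^2$; (b) $\Delta=\langle\theta,\xi\rangle$ is a dihedral group of order $2(\bar q-1)$, where $\theta:(X,Y)\mapsto(\lambda X,\lambda^{-1}Y)$ with $\lambda$ a primitive $(\bar q-1)$-th root of unity, and $\xi:(X,Y)\mapsto(Y,X)$.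
   Context: $p$ is an odd prime, $\bar q=p^n$ and $q=\bar q^m$ are powers of $p$ ($n,m\ge1$), and $\mathbb{K}$ is the algebraic closure of $\mathbb{F}_p$. For a power $r$ of $p$, a polynomial is $r$-linearized if it has the form $\sum_i a_iT^{r^i}$. Automorphisms of a curve are automorphisms of its function field fixing $\mathbb{K}$ elementwise; the maps written on $(X,Y)$ denote the automorphisms they induce on the curve. *)

(* Defs.v *)
From mathcomp Require Import all_boot all_algebra all_fingroup all_solvable.
From mathcomp Require Import all_field.

Set Implicit Arguments.
Unset Strict Implicit.
Unset Printing Implicit Defensive.

Import GRing.Theory.
Local Open Scope ring_scope.

Definition linearized (K : nzRingType) (r : nat) (L : {poly K}) : Prop :=
  exists (d : nat) (a : nat -> K), L = \sum_(i < d) a i *: 'X^(r ^ i).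

(* L(X) * L(Y) - 1, with X the outer and Y the inner variable of              *)
(* {poly {poly K}}, as in polyXY.                                             *)
Definition LL_poly (K : nzRingType) (L : {poly K}) : {poly {poly K}} :=
  L^:P * L%:P - 1.

Definition eval2 (K R : nzRingType) (C : K -> R) (x y : R)
    (g : {poly {poly K}}) : R :=
  (map_poly (map_poly C) g).[x, y].

(* A function field of the plane curve f(X, Y) = 0: the fraction field of     *)
(* K[X, Y] / (f). ffX and ffY are the coordinate functions; the kernel of the *)
(* evaluation g |-> g(ffX, ffY) is the ideal (f), and every element is a      *)
(* quotient of two values. These conditions determine the field, with its     *)
(* coordinate functions, up to a unique isomorphism over K. They force (f) to *)
(* be prime; LL_function_field below proves that such a field exists for      *)
(* L(X) * L(Y) = 1 when L is separable and L(0) = 0.                          *)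
Record function_field (K : fieldType) (f : {poly {poly K}}) := FunctionField {
  ff_sort :> fieldType;
  ffC : {rmorphism K -> ff_sort};
  ffX : ff_sort;
  ffY : ff_sort;
  ff_ker : forall g, eval2 ffC ffX ffY g = 0 <-> exists h, g = h * f;
  ff_frac : forall z, exists g h,
    eval2 ffC ffX ffY h != 0 /\ z = eval2 ffC ffX ffY g / eval2 ffC ffX ffY h
}.

Section Automorphisms.

Variables (K : fieldType) (f : {poly {poly K}}) (F : function_field f).

Definition curve_aut (s : {rmorphism F -> F}) : Prop :=
  bijective s /\ forall c : K, s (ffC F c) = ffC F c.

(* s is the automorphism induced by the map (X, Y) |-> (u, v). *)
Definition induced_by (s : {rmorphism F -> F}) (u v : F) : Prop :=
  s (ffX F) = u /\ s (ffY F) = v.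

(* phi is a group isomorphism from gT onto the group of all automorphisms of  *)
(* the curve, under composition.                                              *)
Definition full_aut_group (gT : finGroupType)
    (phi : gT -> {rmorphism F -> F}) : Prop :=
  [/\ forall g, curve_aut (phi g),
      forall g h, phi (g * h)%g =1 phi g \o phi h,
      forall g h, phi g =1 phi h -> g = h
    & forall s, curve_aut s -> exists g, phi g =1 s].

End Automorphisms.

Section Existence.

Variable K : closedFieldType.
Local Notation PK := {poly K}.
Local Notation E := {fraction PK}.
Local Notation toE := (@FracField.tofrac PK).
Local Notation toEP := (map_poly toE).

Lemma tofrac_inj : injective toE.
Proof. by move=> a b /eqP; rewrite tofrac_eq => /eqP. Qed.

Lemma size_toEP (A : {poly PK}) : size (toEP A) = size A.
Proof. by rewrite size_map_inj_poly ?rmorph0 //; apply: tofrac_inj. Qed.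

Lemma frac_repr (e : E) : exists (a b : PK), b != 0 /\ e = toE a / toE b.
Proof.
elim/quotW: e => x; exists (frac x).1, (frac x).2.
have d0 : (frac x).2 != 0 by apply: denom_ratioP.
split=> //; apply: (canRL (mulfK _)); first by rewrite tofrac_eq0.
unlock FracField.tofrac; rewrite -[LHS]FracField.pi_mul; apply/eqmodP.
rewrite /= /FracField.equivf /FracField.mulf /=.
by rewrite !numden_Ratio ?mulf_neq0 ?oner_neq0 //= !mulr1 mulrC.
Qed.

Lemma common_den (r : {poly E}) :
  exists (c : PK) (A : {poly PK}), c != 0 /\ toE c *: r = toEP A.
Proof.
elim/poly_ind: r => [|r e [c [A [c0 cA]]]].
  by exists 1, 0; rewrite oner_neq0 scaler0 rmorph0.
have [a [b [b0 ->]]] := frac_repr e.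
exists (c * b), (b *: A * 'X + (c * a)%:P); rewrite mulf_neq0 //; split=> //.
rewrite rmorphD /= (rmorphM toEP) /= map_polyX map_polyC /= map_polyZ /= -cA.
rewrite scalerDr scalerAl scalerA [in LHS]tofracM.
congr (_ + _); first by rewrite [toE b * _]mulrC.
rewrite -mul_polyC -polyCM; congr (_%:P).
rewrite tofracM -mulrA; congr (_ * _); rewrite mulrCA divff ?mulr1 //.
by rewrite tofrac_eq0.
Qed.

Lemma scalep_inj (a : PK) :
  a != 0 -> injective ( *:%R a : {poly PK} -> {poly PK}).
Proof.
by move=> a0 A B; rewrite -!mul_polyC; apply: mulfI; rewrite polyC_eq0.
Qed.

Lemma gauss (f : {poly PK}) d (c : PK) (A B : {poly PK}) :
  (size c <= d)%N -> c != 0 -> c *: f = A * B ->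
  exists A' B', [/\ f = A' * B', size A' = size A & size B' = size B].
Proof.
elim: d c A B => [|d IH] c A B sc c0 fE.
  by case/negP: c0; rewrite -size_poly_leq0.
have [/size_poly1P[k k0 cE]|sc1] := boolP (size c == 1).
  exists (k^-1%:P *: A), B; split=> //; last first.
    by rewrite size_scale // polyC_eq0 invr_eq0.
  by rewrite -scalerAl -fE cE scalerA -polyCM mulVf // scale1r.
have [r /factor_theorem[c' cE]] := closed_rootP c sc1.
have Xr0 : 'X - r%:P != 0 :> PK by rewrite polyXsubC_eq0.
have c'0 : c' != 0 by apply: contraNneq c0 => c'0; rewrite cE c'0 mul0r.
have sc' : (size c' <= d)%N.
  by move: sc; rewrite cE size_mul // size_XsubC addn2 ltnS.
have divr (D : {poly PK}) : map_poly (horner_eval r) D = 0 ->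
    exists2 D', D = ('X - r%:P) *: D' & size D' = size D.
  move=> Dr; have DE :
      D = ('X - r%:P) *: map_poly (fun a : {poly K} => (a %/ ('X - r%:P))) D.
    apply/polyP=> i; rewrite coefZ coef_map_id0 ?div0p // mulrC divpK //.
    rewrite dvdp_XsubCl; apply/rootP.
    by have /polyP/(_ i) := Dr; rewrite coef_map coef0.
  by eexists; [exact: DE | rewrite [in RHS]DE size_scale].
have : map_poly (horner_eval r) A * map_poly (horner_eval r) B = 0.
  rewrite -rmorphM -fE /= map_polyZ /= [horner_eval r c]/horner_eval cE.
  by rewrite !hornerE subrr mulr0 scale0r.
have cancelX (D D' : {poly PK}) :
    c *: f = (('X - r%:P) *: D) * D' -> c' *: f = D * D'.
  move=> eqD; apply: (scalep_inj Xr0).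
  by rewrite scalerA [_ * c']mulrC -cE eqD scalerAl.
move/eqP; rewrite mulf_eq0 => /orP[] /eqP /divr [D DE sD].
  have [|A' [B' [-> sA sB]]] := IH c' D B sc' c'0.
    by apply: cancelX; rewrite -DE.
  by exists A', B'; rewrite sA sB sD.
have [|B' [A' [-> sB sA]]] := IH c' D A sc' c'0.
  by apply: cancelX; rewrite -DE mulrC.
by exists A', B'; rewrite mulrC sA sB sD.
Qed.

Lemma eval2_frac (R : comNzRingType) (u : {rmorphism {poly E} -> R}) g :
  eval2 ((u \o polyC) \o (toE \o polyC)) (u 'X) (u (toE 'X)%:P) g
  = u (toEP g).
Proof.
pose C : {rmorphism K -> R} := (u \o polyC) \o (toE \o polyC).
have evC (c : PK) : (map_poly C c).[u (toE 'X)%:P] = u (toE c)%:P.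
  elim/poly_ind: c => [|c a IH]; first by rewrite rmorph0 horner0 !rmorph0.
  rewrite (rmorphD (map_poly C)) (rmorphM (map_poly C)) /= map_polyX map_polyC.
  by rewrite hornerD hornerMX hornerC IH !rmorphD !rmorphM.
rewrite /eval2 -/C; elim/poly_ind: g => [|g c IH].
  by rewrite (rmorph0 (map_poly (map_poly C))) !horner0 (rmorph0 toEP) rmorph0.
rewrite (rmorphD (map_poly (map_poly C))) (rmorphM (map_poly (map_poly C))) /=.
rewrite map_polyX map_polyC /= hornerD hornerMX !hornerC.
rewrite hornerD hornerM hornerC.
rewrite IH evC -rmorphM -rmorphD /= (rmorphD toEP) (rmorphM toEP) /=.
by rewrite map_polyX map_polyC.
Qed.

Variable L : {poly K}.
Hypotheses (L_sep : separable_poly L) (L0 : root L 0).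
Local Notation f := (LL_poly L).

Let L_neq0 : L != 0. Proof. exact: separable_poly_neq0. Qed.

Let L_size : (1 < size L)%N. Proof. exact: root_size_gt1 L_neq0 L0. Qed.

Let coef_f i : f`_i = L`_i *: L - (i == 0%N)%:R.
Proof. by rewrite coefB coefMC coef_map mul_polyC coef1. Qed.

Let coef0_f : f`_0 = -1.
Proof. by rewrite coef_f -horner_coef0 (rootP L0) scale0r sub0r. Qed.

Let size_f : size f = size L.
Proof.
have szL : size (L^:P * L%:P) = size L.
  by rewrite mulrC mul_polyC size_scale // size_map_polyC.
by rewrite size_polyDl szL // size_polyN size_poly1.
Qed.

Let f_neq0 : f != 0. Proof. by rewrite -size_poly_gt0 size_f ltnW. Qed.

Let lead_f : lead_coef f = lead_coef L *: L.
Proof.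
rewrite lead_coefE size_f coef_f -lead_coefE -subn1 subn_eq0 leqNgt L_size.
by rewrite subr0.
Qed.

Let f0 : map_poly (horner_eval (0 : K)) f = -1.
Proof.
apply/polyP=> i; rewrite coef_map coef_f /= /horner_eval !hornerE (rootP L0).
rewrite mulr0 sub0r coefN coef1; congr (- _).
by case: (i == 0%N); rewrite !hornerE.
Qed.

Let f_split (A B : {poly PK}) :
  f = A * B -> (size A <= 1)%N \/ (size B <= 1)%N.
Proof.
move=> fE; pose ev0 (D : {poly PK}) := map_poly (horner_eval (0 : K)) D.
have [A1|A1] := leqP (size A) 1; first by left.
have [B1|B1] := leqP (size B) 1; first by right.
have evAB : ev0 A * ev0 B = -1 by rewrite /ev0 -[LHS]rmorphM /= -fE f0.
have szAB : (size (ev0 A) <= 1)%N && (size (ev0 B) <= 1)%N.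
  have : ev0 A * ev0 B \is a GRing.unit by rewrite evAB unitrN1.
  rewrite unitrM => /andP[].
  by rewrite !poly_unitE => /andP[/eqP -> _] /andP[/eqP -> _].
have dvX (D : {poly PK}) :
    (1 < size D)%N -> (size (ev0 D) <= 1)%N -> 'X %| lead_coef D.
  move=> D1 D0; rewrite -['X]subr0 -polyC0 dvdp_XsubCl; apply/rootP.
  have : (ev0 D)`_(size D).-1 = 0.
    by rewrite nth_default // (leq_trans D0) // -ltnS prednK // ltnW.
  by rewrite coef_map -lead_coefE.
have /andP[/(dvX _ A1) XA /(dvX _ B1) XB] := szAB.
have : 'X ^+ 2 %| L.
  rewrite -(@dvdpZr _ (lead_coef L)) ?lead_coef_eq0 // -lead_f fE lead_coefM.
  by rewrite expr2 dvdp_mul.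
by rewrite (separable_nosquare L_sep) ?size_polyX.
Qed.

Let fE_irr : irreducible_poly (toEP f).
Proof.
split=> [|q q1 qf]; first by rewrite size_toEP size_f.
have /dvdpP[s fE] := qf.
have s0 : s != 0.
  apply: contraTneq f_neq0 => s0.
  by rewrite -size_poly_eq0 -size_toEP fE s0 mul0r size_poly0.
have q0 : q != 0.
  apply: contraTneq f_neq0 => q0.
  by rewrite -size_poly_eq0 -size_toEP fE q0 mulr0 size_poly0.
have [c [A [c0 cA]]] := common_den s.
have [d [B [d0 dB]]] := common_den q.
have szA : size A = size s by rewrite -size_toEP -cA size_scale // tofrac_eq0.
have szB : size B = size q by rewrite -size_toEP -dB size_scale // tofrac_eq0.
have cdf : (c * d) *: f = A * B.
  apply: (map_inj_poly tofrac_inj (rmorph0 _)).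
  rewrite rmorphM /= -cA -dB map_polyZ /= fE tofracM.
  by rewrite -scalerAl -scalerAr scalerA.
have [A' [B' [fE' sA sB]]] := gauss (leqnn _) (mulf_neq0 c0 d0) cdf.
have [|] := f_split fE'; rewrite ?sA ?sB ?szA ?szB => sz1; last first.
  by case/negP: q1; rewrite eqn_leq sz1 size_poly_gt0.
have /eqP s1 : size s == 1%N by rewrite eqn_leq sz1 size_poly_gt0.
by rewrite -dvdp_size_eqp // fE size_mul // s1.
Qed.

Let f_dvd (g : {poly PK}) : toEP f %| toEP g -> exists u, g = u * f.
Proof.
move=> /dvdpP[s gE]; have [c [S [c0 cS]]] := common_den s.
have cg : c *: g = S * f.
  apply: (map_inj_poly tofrac_inj (rmorph0 _)).
  by rewrite rmorphM /= -cS map_polyZ /= gE scalerAl.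
have dvS i : c %| S`_i.
  elim/ltn_ind: i => i IH; have /(congr1 (fun P : {poly PK} => P`_i)) := cg.
  rewrite coefZ coefM big_ord_recr /= subnn coef0_f mulrN1.
  move/eqP; rewrite eq_sym subr_eq addrC -subr_eq => /eqP <-.
  rewrite dvdp_sub ?dvdp_mulIl //.
  apply: (big_ind (fun u : PK => c %| u)) => [|u v|j _].
  - exact: dvdp0.
  - exact: dvdp_add.
  - by rewrite dvdp_mulr ?IH.
exists (map_poly (fun a : {poly K} => (a %/ c)) S).
apply: (scalep_inj c0); rewrite cg scalerAl; congr (_ * _).
apply/polyP=> i; rewrite coefZ coef_map_id0 ?div0p //.
by rewrite mulrC divpK.
Qed.

Let h : {poly E} := (lead_coef (toEP f))^-1 *: toEP f.

Let lc_neq0 : lead_coef (toEP f) != 0.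
Proof. by rewrite lead_coef_eq0 -size_poly_gt0 size_toEP size_f ltnW. Qed.

Let h_eqp : h %= toEP f. Proof. by rewrite eqp_scale ?invr_eq0. Qed.

Let h_mi : monic_irreducible_poly h.
Proof.
split; last by rewrite monicE lead_coefZ mulVf.
case: fE_irr => f1 firr; split=> [|q q1 qh].
  by rewrite size_scale ?invr_eq0.
rewrite (eqp_rtrans h_eqp); apply: firr => //.
by rewrite -(eqp_dvdr _ h_eqp).
Qed.

Local Notation FF := {poly %/ h with h_mi}.

Let in_FF : {rmorphism {poly E} -> FF} := in_qpoly h.
Let C : {rmorphism K -> FF} := (in_FF \o polyC) \o (toE \o polyC).

Let in_FF_eq0 G : in_FF G = 0 <-> h %| G.
Proof.
have hM : h \is monic by case: h_mi.
rewrite /dvdp Pdiv.IdomainMonic.modpE //; split=> [/(congr1 val) /=|/eqP G0].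
  by rewrite mk_monicE // => ->.
by apply: val_inj; rewrite /= mk_monicE.
Qed.

Lemma LL_function_field : inhabited (function_field f).
Proof.
split; apply: (@FunctionField K f FF C (in_FF 'X) (in_FF (toE 'X)%:P)) => [g|z].
  rewrite eval2_frac; split=> [/in_FF_eq0|[u ->]].
    by rewrite (eqp_dvdl _ h_eqp); apply: f_dvd.
  by apply/in_FF_eq0; rewrite (eqp_dvdl _ h_eqp) (rmorphM toEP) dvdp_mulIr.
have [c [A [c0 cA]]] := common_den (val z).
have zE : z = in_FF (val z).
  by apply: val_inj; apply/esym/in_qpoly_small/size_mk_monic.
have C0 : in_FF (toE c)%:P != 0.
  by rewrite (fmorph_eq0 (in_FF \o polyC)) tofrac_eq0.
exists A, c%:P; rewrite !eval2_frac map_polyC /= -cA; split=> //.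
by rewrite -mul_polyC rmorphM mulrAC divff // mul1r -zE.
Qed.

End Existence.

(* Main.v *)
(* The curve is a smooth curve of bidegree (q, q) in P^1 x P^1, and its two
   projections are its only maps of degree q to P^1. Let V be the set of roots
   of L. The extension F / K(y) is Galois with group the translations
   x |-> x + a, a in V. If s is an automorphism, u = s x and v = s y, the
   differentials u^i v^j du / L(u), i, j <= q - 2, are holomorphic, so their
   traces to K(y) are holomorphic differentials on P^1 and vanish. This gives
   sum_a w_a G(u_a) H(v_a) = 0 for G, H of degree at most q - 2, where
   (u_a, v_a), a in V, are the distinct conjugates of (u, v) and the weights w_a
   are nonzero. If neither u nor v were invariant, one of the q points
   (u_a, v_a) could be separated from the other q - 1 by q - 2 vertical and
   q - 2 horizontal lines, a contradiction. Hence u or v lies in K(y); applying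
   this to s and its inverse, s is up to the swap a pair of Moebius
   transformations, which L(u) L(v) = 1 forces to be affine of the form
   (A x + a, A^-1 y + b) with a, b in V and L(A T) = A L(T). *)
Require Import Defs.
From HB Require Import structures.
From mathcomp Require Import all_boot all_algebra all_fingroup all_solvable.
From mathcomp Require Import all_field.
From mathcomp Require Import ring.

Set Implicit Arguments.
Unset Strict Implicit.
Unset Printing Implicit Defensive.

Import GRing.Theory.
Local Open Scope ring_scope.

(** * Evaluation of bivariate polynomials *)

(** Differentials are handled as functions. With [D] = d/dy, a differential w dy is represented by
    w, and its regularity at a place [O] by w / [e] in [O], where [e] has the order of [D t] for a
    uniformizer [t]: [e] is 1 at affine points, y^-2 at y = oo and x^(2(q-1)) at x = oo. The points
    x = oo are totally ramified over K(y); there w may have a pole of order 2(q - 1), and only the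
    trace is shown to be regular. The bound q - 2 is the bidegree of the canonical class of a smooth
    curve of bidegree (q, q).

    The separation of one point from q - 1 others works because each of the two families of lines
    may miss one of them: it suffices that neither family has to do the whole work.

    That [L] is not qbar^k-linearized for k >= 2 means that the exponents j for which T^(qbar^j)
    occurs in [L] have greatest common divisor 1. This reduces the factors A with L(A T) = A L(T) to
    the solutions of A^(qbar-1) = 1. *)

Section Eval2.

Variables (K : fieldType) (R : comNzRingType) (C : {rmorphism K -> R}) (x y :
  R).
Local Notation ev := (eval2 C x y).

Fact eval2_is_zmod_morphism : zmod_morphism ev.
Proof. by move=> g h; rewrite /eval2 rmorphB !hornerE. Qed.

Fact eval2_is_monoid_morphism : monoid_morphism ev.
Proof.
by split=> [|g h]; rewrite /eval2 ?rmorph1 ?rmorphM !hornerE.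
Qed.

HB.instance Definition _ :=
  GRing.isZmodMorphism.Build {poly {poly K}} R ev eval2_is_zmod_morphism.
HB.instance Definition _ :=
  GRing.isMonoidMorphism.Build {poly {poly K}} R ev eval2_is_monoid_morphism.

Lemma eval2X : ev 'X = x.
Proof. by rewrite /eval2 map_polyX hornerX hornerC. Qed.

Lemma eval2C (r : {poly K}) : ev r%:P = (map_poly C r).[y].
Proof. by rewrite /eval2 map_polyC hornerC. Qed.

Lemma eval2Y : ev 'X%:P = y.
Proof. by rewrite eval2C map_polyX hornerX. Qed.

Lemma eval2CC (c : K) : ev c%:P%:P = C c.
Proof. by rewrite eval2C map_polyC hornerC. Qed.

Lemma eval2D g h : ev (g + h) = ev g + ev h. Proof. exact: (rmorphD ev). Qed.
Lemma eval2B g h : ev (g - h) = ev g - ev h. Proof. exact: (rmorphB ev). Qed.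
Lemma eval2M g h : ev (g * h) = ev g * ev h. Proof. exact: (rmorphM ev). Qed.
Lemma eval2N g : ev (- g) = - ev g. Proof. exact: (rmorphN ev). Qed.
Lemma eval2_1 : ev 1 = 1. Proof. exact: (rmorph1 ev). Qed.
Lemma eval2_0 : ev 0 = 0. Proof. exact: (rmorph0 ev). Qed.

Lemma eval2P (r : {poly K}) : ev r^:P = (map_poly C r).[x].
Proof.
elim/poly_ind: r => [|r c IH]; first by rewrite !rmorph0 horner0.
rewrite (rmorphD (map_poly polyC)) (rmorphM (map_poly polyC)) /=.
rewrite map_polyX map_polyC eval2D eval2M IH eval2X eval2CC.
by rewrite rmorphD rmorphM /= map_polyX map_polyC !hornerE.
Qed.

Definition eval2E := (eval2D, eval2B, eval2M, eval2N, eval2_1, eval2_0, eval2CC,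
  eval2Y, eval2X, eval2P, eval2C).

End Eval2.

Lemma poly2_ind (K : fieldType) (P : {poly {poly K}} -> Prop) :
  (forall c, P c%:P%:P) -> P 'X -> P 'X%:P ->
  (forall g h, P g -> P h -> P (g + h)) ->
  (forall g h, P g -> P h -> P (g * h)) -> forall g, P g.
Proof.
move=> PC PX PY PD PM; elim/poly_ind => [|g c Pg].
  by rewrite -!polyC0.
apply: (PD) (PM _ _ Pg PX) _.
elim/poly_ind: c => [|c a Pc]; first by rewrite -[0]polyC0.
by rewrite polyCD polyCM; apply: (PD) (PM _ _ Pc PY) _.
Qed.

Lemma eval2_rmorph (K : fieldType) (R S : comNzRingType) (C : {rmorphism K ->
  R})
    (C' : {rmorphism K -> S}) (s : {rmorphism R -> S}) (x y : R) g :
  (forall c, s (C c) = C' c) -> s (eval2 C x y g) = eval2 C' (s x) (s y) g.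
Proof.
move=> sC; elim/poly2_ind: g => [c|||g h IHg IHh|g h IHg IHh].
- by rewrite !eval2CC sC.
- by rewrite !eval2X.
- by rewrite !eval2Y.
- by rewrite !eval2D rmorphD IHg IHh.
- by rewrite !eval2M rmorphM IHg IHh.
Qed.

Lemma eval2_swap (K : fieldType) (R : comNzRingType) (C : {rmorphism K -> R})
    (x y : R) g : eval2 C y x g = eval2 C x y (swapXY g).
Proof.
elim/poly2_ind: g => [c|||g h IHg IHh|g h IHg IHh].
- by rewrite swapXY_polyC map_polyC !eval2CC.
- by rewrite swapXY_X eval2X eval2Y.
- by rewrite swapXY_Y eval2X eval2Y.
- by rewrite (rmorphD swapXY) !eval2D IHg IHh.
- by rewrite (rmorphM swapXY) !eval2M IHg IHh.
Qed.

Lemma swapXY_LL (K : fieldType) (L : {poly K}) : swapXY (LL_poly L) = LL_poly L.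
Proof.
rewrite /LL_poly (rmorphB swapXY) (rmorph1 swapXY) (rmorphM swapXY) /=
  swapXY_polyC swapXY_map_polyC.
by rewrite mulrC.
Qed.

Lemma eval2_LL (K : fieldType) (R : comNzRingType) (C : {rmorphism K -> R})
  (L : {poly K}) (x y : R) :
  eval2 C x y (LL_poly L) = (map_poly C L).[x] * (map_poly C L).[y] - 1.
Proof. by rewrite /LL_poly !eval2E. Qed.

Lemma ff_ext (K : fieldType) (f : {poly {poly K}}) (F : function_field f)
    (R : fieldType) (B : {rmorphism K -> R}) (s t : {rmorphism F -> R}) :
  (forall c, s (ffC F c) = B c) -> (forall c, t (ffC F c) = B c) ->
  s (ffX F) = t (ffX F) -> s (ffY F) = t (ffY F) -> s =1 t.
Proof.
move=> sC tC sx sy z; have [g [h [h0 ->]]] := ff_frac z.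
by rewrite !fmorph_div !(eval2_rmorph _ _ _ sC) !(eval2_rmorph _ _ _ tC) sx sy.
Qed.

(** The equation is symmetric, so every result about [y] yields one about [x]. The underlying field
    is unchanged and the definition is transparent: morphisms of [F] are morphisms of [ffswap F] by
    conversion. *)
Definition ffswap (K : fieldType) (L : {poly K}) (F : function_field (LL_poly
  L)) :
  function_field (LL_poly L).
Proof.
apply: (@FunctionField K _ F (ffC F) (ffY F) (ffX F)) => [g|z].
  rewrite eval2_swap; split=> [/(@ff_ker _ _ F)[h gE]|[h ->]].
    exists (swapXY h); apply: (can_inj (@swapXYK _)).
    by rewrite gE (rmorphM swapXY) /= swapXYK swapXY_LL.
  by apply: (iffRL (@ff_ker _ _ F _)); exists (swapXY h);
    rewrite (rmorphM swapXY) /= swapXY_LL.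
have [g [h [h0 zE]]] := ff_frac z.
have sw k : eval2 (ffC F) (ffY F) (ffX F) (swapXY k) = eval2 (ffC F) (ffX F)
  (ffY F) k.
  by rewrite eval2_swap swapXYK.
by exists (swapXY g), (swapXY h); rewrite !sw.
Defined.

(** * The function field *)

(** What the geometry uses of [L]. Additivity is required in every commutative K-algebra because [L]
    is evaluated at constants, at functions and at polynomials over the function field. *)
Record additive_separable (K : fieldType) (L : {poly K}) (q : nat) (a0 : K)
    (rs : seq K) : Prop := AdditiveSeparable {
  as_add : forall (R : comNzRingType) (C : {rmorphism K -> R}) (a b : R),
    (map_poly C L).[a + b] = (map_poly C L).[a] + (map_poly C L).[b];
  as_deriv : L^`() = a0%:P;
  as_a0 : a0 != 0;
  as_size : size L = q.+1;
  as_q : (2 < q)%N;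
  as_uniq : uniq rs;
  as_card : size rs = q;
  as_root : forall r, (r \in rs) = (L.[r] == 0)
}.

(** The twist [t] covers two maps built from a derivation [D] and a morphism [s]: the composite of
    [D] after [s], and the commutator of [D] with [s]. Both satisfy the Leibniz rule twisted by
    [s]. *)
Definition twisted_derivation (K F : fieldType) (C : K -> F) (t d : F -> F) :=
  [/\ forall a b, d (a + b) = d a + d b,
      forall a b, d (a * b) = d a * t b + t a * d b
    & forall c, d (C c) = 0].

Section FunctionField.

Variables (K : closedFieldType) (L : {poly K}) (q : nat) (a0 : K) (rs : seq K).
Hypothesis (HL : additive_separable L q a0 rs).
Variable F : function_field (LL_poly L).

Local Notation C := (ffC F).
Local Notation x := (ffX F).
Local Notation y := (ffY F).
Local Notation ev := (eval2 C x y).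
Local Notation f := (LL_poly L).
Local Notation "p ^F" := (map_poly C p) (at level 1, format "p ^F") :
  ring_scope.

Let L_neq0 : L != 0. Proof. by rewrite -size_poly_eq0 (as_size HL). Qed.

Lemma ff_eq : L^F.[x] * L^F.[y] = 1.
Proof.
apply/eqP; rewrite -subr_eq0 -eval2_LL; apply/eqP.
by apply: (iffRL (ff_ker F _)); exists 1; rewrite mul1r.
Qed.

Lemma size_LL : size f = q.+1.
Proof.
have szL : size (L^:P * L%:P) = q.+1.
  by rewrite mulrC mul_polyC size_scale // size_map_polyC (as_size HL).
rewrite size_polyDl szL // size_polyN size_poly1 ltnS.
by have := as_q HL; case: (q).
Qed.

Let f_neq0 : f != 0. Proof. by rewrite -size_poly_gt0 size_LL. Qed.

(** The kernel is generated by [f], whose degree in the outer variable is q, so a nonzero element of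
    the kernel has outer degree at least q. *)
Lemma ff_small (g : {poly {poly K}}) : (size g <= q)%N -> ev g = 0 -> g = 0.
Proof.
move=> sg /(ff_ker F)[h gE]; have [h0|h0] := eqVneq h 0.
  by rewrite gE h0 mul0r.
move: sg; rewrite gE size_mul // size_LL addnS /= leqNgt.
by rewrite -[X in (X < _)%N]add0n ltn_add2r size_poly_gt0 h0.
Qed.

Lemma ff_transY (r : {poly K}) : r^F.[y] = 0 -> r = 0.
Proof.
rewrite -(eval2C C x y) => /ff_small r0; apply: polyC_inj; rewrite polyC0 r0 //.
by rewrite (leq_trans (size_polyC_leq1 _)) // ltnW // ltnW // (as_q HL).
Qed.

(** If [g] involves the outer variable, [r] is its resultant with [f]: it lies in the ideal
    generated by [f] and [g], and [f] vanishes in the field. *)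
Lemma ff_elim (g : {poly {poly K}}) : ev g != 0 ->
  exists g' r, r != 0 /\ ev g' * ev g = r^F.[y].
Proof.
move=> g0; have [sg|sg] := leqP (size g) 1.
  have [r gE] : exists r : {poly K}, g = r%:P.
    by exists g`_0; apply: size1_polyC.
  exists 1, r; rewrite eval2_1 mul1r gE eval2C; split=> //.
  by apply: contraNneq g0 => r0; rewrite gE r0 polyC0 eval2_0.
have sf : (1 < size f)%N.
  by rewrite size_LL ltnS ltnW // ltnW // (as_q HL).
have [res0|res0] := eqVneq (resultant f g) 0; last first.
  have [[u v] /= _ resE] := resultant_in_ideal sf sg.
  exists v, (resultant f g); split=> //; rewrite -(eval2C C x y) resE.
  by rewrite eval2D !eval2M eval2_LL ff_eq subrr mulr0 add0r.
move/eqP: res0; rewrite resultant_eq0 => sd.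
set d := gcdp f g in sd.
have /Pdiv.Idomain.dvdpP[[c f'] /= c0 fE] : d %| f by apply:
  Pdiv.Idomain.dvdp_gcdl.
have /Pdiv.Idomain.dvdpP[[c' g'] /= c'0 gE] : d %| g by apply:
  Pdiv.Idomain.dvdp_gcdr.
(* A zero resultant gives a common factor [d] of positive outer degree. It cannot vanish in the
   field, or [g] would; its cofactor [f'] has outer degree below q and cannot vanish either. *)
have : ev f' * ev d = 0.
  by rewrite -eval2M -fE -mul_polyC eval2M eval2_LL ff_eq subrr mulr0.
move/eqP; rewrite mulf_eq0 => /orP[/eqP f'0|/eqP d0]; last first.
  have : ev (c' *: g) = 0 by rewrite gE eval2M d0 mulr0.
  rewrite -mul_polyC eval2M eval2C => /eqP; rewrite mulf_eq0 (negPf g0) orbF.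
  by move/eqP/ff_transY=> c'E; rewrite c'E eqxx in c'0.
have f'n0 : f' != 0.
  apply: contraNneq f_neq0 => f'E.
  have /eqP : c%:P * f = 0 by rewrite mul_polyC fE f'E mul0r.
  by rewrite mulf_eq0 polyC_eq0 (negPf c0).
have d0 : d != 0 by rewrite -size_poly_gt0 ltnW.
have szf : size f = (size f' + size d).-1.
  by rewrite -size_mul // -fE size_scale.
case/negP: f'n0; apply/eqP/ff_small => //.
move: szf; rewrite size_LL; case: (size d) sd => [|[|k]] // _.
by rewrite !addnS /= => -[->]; rewrite leq_addr.
Qed.

(** Over the algebraically closed [K], [r] is a product of linear factors, and none of them vanishes
    at a nonconstant element. *)
Lemma nonconst_trans (R : fieldType) (B : {rmorphism K -> R}) (v : R)
    (r : {poly K}) :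
  (forall c, v != B c) -> r != 0 -> (map_poly B r).[v] != 0.
Proof.
move=> vc r0; have [s ->] := closed_field_poly_normal r.
rewrite map_polyZ rmorph_prod /= hornerZ mulf_neq0 //.
  by rewrite fmorph_eq0 lead_coef_eq0.
rewrite horner_prod prodf_seq_neq0; apply/allP=> c _ /=.
by rewrite map_polyXsubC hornerXsubC subr_eq0.
Qed.

Lemma ffY_nonconst c : y != C c.
Proof.
apply/eqP=> yc; have := @ff_transY ('X - c%:P).
rewrite map_polyXsubC hornerXsubC yc subrr => /(_ erefl)/eqP.
by rewrite polyXsubC_eq0.
Qed.

(** Evaluation at (u, v) kills [f]. It preserves nonzero denominators: by [ff_elim] a nonzero
    element has a multiple r(y) with r nonzero, and r(v) is nonzero because [v] is not constant. *)
Lemma ff_lift (u v : F) : L^F.[u] * L^F.[v] = 1 -> (forall c, v != C c) ->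
  exists s : {rmorphism F -> F},
    [/\ forall c, s (C c) = C c, s x = u & s y = v].
Proof.
move=> uv vc; pose e := eval2 C u v.
have e0 g : ev g = 0 -> e g = 0.
  by case/(ff_ker F)=> h ->; rewrite /e eval2M eval2_LL uv subrr mulr0.
have en0 g : ev g != 0 -> e g != 0.
  move=> /ff_elim[g' [r [r0 rE]]];
    apply: contraNneq (nonconst_trans vc r0) => eg.
  rewrite -(eval2C C u v) -/(e _); have : e (g' * g - r%:P) = 0.
    by apply: e0; rewrite eval2B eval2M rE eval2C subrr.
  rewrite {1}/e eval2B eval2M -!/(e _) eg mulr0 sub0r => /eqP.
  by rewrite oppr_eq0.
have ex z : exists gh, (ev gh.2 != 0) && (z == ev gh.1 / ev gh.2).
  by have [g [h [h0 ->]]] := ff_frac z; exists (g, h); rewrite /= h0 eqxx.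
pose s z := let gh := xchoose (ex z) in e gh.1 / e gh.2.
have sE g h : ev h != 0 -> s (ev g / ev h) = e g / e h.
  move=> h0; rewrite /s; case/andP: (xchooseP (ex (ev g / ev h))).
  set gh := xchoose _; rewrite /= => h'0 E; apply/eqP.
  move: E; rewrite !eqr_div ?en0 // -!eval2M -subr_eq0 -eval2B => /eqP/e0.
  by rewrite /e eval2B !eval2M => /eqP; rewrite subr_eq0 eq_sym.
have sev g : s (ev g) = e g.
  by have := sE g 1; rewrite /e !eval2_1 !divr1; apply; rewrite oner_neq0.
have sB : zmod_morphism s.
  move=> a b; have [g [h [h0 ->]]] := ff_frac a.
  have [g' [h' [h'0 ->]]] := ff_frac b.
  rewrite !sE // -!mulNr !addf_div ?en0 // -!eval2M -!eval2N -!eval2M -eval2D.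
  rewrite sE ?eval2M ?mulf_neq0 // /e.
  by rewrite eval2D !eval2M !eval2N.
have sM : monoid_morphism s.
  split=> [|a b]; first by have := sev 1; rewrite /e !eval2_1.
  have [g [h [h0 ->]]] := ff_frac a; have [g' [h' [h'0 ->]]] := ff_frac b.
  by rewrite mulf_div -!eval2M !sE ?eval2M ?mulf_neq0 // mulf_div /e !eval2M.
pose s' : {rmorphism F -> F} := HB.pack s
  (GRing.isZmodMorphism.Build F F s sB) (GRing.isMonoidMorphism.Build F F s sM).
exists s'; split=> [c||] /=.
- by have := sev c%:P%:P; rewrite /e !eval2CC.
- by have := sev 'X; rewrite /e !eval2X.
- by have := sev 'X%:P; rewrite /e !eval2Y.
Qed.

End FunctionField.

(** * The derivation d/dy *)

Section Derivation.

Variables (K : closedFieldType) (L : {poly K}) (q : nat) (a0 : K) (rs : seq K).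
Hypothesis (HL : additive_separable L q a0 rs).
Variable F : function_field (LL_poly L).

Local Notation C := (ffC F).
Local Notation x := (ffX F).
Local Notation y := (ffY F).
Local Notation ev := (eval2 C x y).
Local Notation f := (LL_poly L).
Local Notation "p ^F" := (map_poly C p) (at level 1, format "p ^F") :
  ring_scope.

Lemma deriv_LF : (L^F)^`() = (C a0)%:P.
Proof. by rewrite deriv_map (as_deriv HL) map_polyC. Qed.

Lemma ffLY_neq0 : L^F.[y] != 0.
Proof.
by apply/eqP=> X0; have /eqP := ff_eq F; rewrite X0 mulr0 eq_sym oner_eq0.
Qed.

Lemma ff_derivation : exists D : F -> F,
  [/\ twisted_derivation C id D, D x = - (L^F.[x] / L^F.[y]) & D y = 1].
Proof.
set xi := - (L^F.[x] / L^F.[y]).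
pose C' : {rmorphism K -> {poly F}} := polyC \o C.
(* The point (x, y) is moved along the tangent vector ([xi], 1) with parameter 'X; the linear
   coefficient of the result is the derivative. *)
pose G := eval2 C' (x%:P + xi *: 'X) (y%:P + 'X).
have G0 g : (G g).[0] = ev g.
  rewrite -[LHS]/(horner_eval (0 : F) (G g)) /G.
  rewrite (@eval2_rmorph _ _ _ C' C (horner_eval (0 : F))) => [|c].
    by rewrite /= /horner_eval !hornerE.
  by rewrite /C' /= /horner_eval hornerC.
pose d g := (G g)^`().[0].
have dM g h : d (g * h) = d g * ev h + ev g * d h.
  by rewrite /d /G eval2M derivM hornerD !hornerM -!/(G _) !G0.
have dB g h : d (g - h) = d g - d h.
  by rewrite /d /G eval2B derivB hornerD hornerN.
have dD g h : d (g + h) = d g + d h.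
  by rewrite /d /G eval2D derivD hornerD.
have dC c : d c%:P%:P = 0 by rewrite /d /G eval2CC derivC horner0.
have dL P : ((map_poly C' L).[P])^`().[0] = C a0 * P^`().[0].
  have -> : (map_poly C' L).[P] = L^F \Po P.
    by rewrite /comp_poly -map_poly_comp.
  by rewrite deriv_comp deriv_LF comp_polyC hornerM hornerC.
(* Since L' is the constant [a0], the derivative of L(x) L(y) in this direction is a0 (xi L(y) +
   L(x)), which the choice of [xi] annihilates. Thus [d] descends to the function field. *)
have df : d f = 0.
  have GxE : (map_poly C' L).[x%:P + xi *: 'X].[0] = L^F.[x].
    by rewrite -(eval2P C' _ (y%:P + 'X)) G0 eval2P.
  have GyE : (map_poly C' L).[y%:P + 'X].[0] = L^F.[y].
    by rewrite -(eval2C C' (x%:P + xi *: 'X)) G0 eval2C.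
  rewrite /d /G eval2_LL derivB derivM -[1]polyC1 derivC subr0 hornerD !hornerM.
  rewrite !dL GxE GyE !derivD !derivC !add0r derivZ derivX !hornerE /xi.
  by rewrite /=; field; rewrite ffLY_neq0.
have d0 g : ev g = 0 -> d g = 0.
  by case/(ff_ker F)=> h ->; rewrite dM df eval2_LL ff_eq subrr !mulr0 addr0.
have ex z : exists gh, (ev gh.2 != 0) && (z == ev gh.1 / ev gh.2).
  by have [g [h [h0 ->]]] := ff_frac z; exists (g, h); rewrite /= h0 eqxx.
pose D z := let gh := xchoose (ex z) in
  (d gh.1 * ev gh.2 - ev gh.1 * d gh.2) / ev gh.2 ^+ 2.
have DE g h : ev h != 0 ->
    D (ev g / ev h) = (d g * ev h - ev g * d h) / ev h ^+ 2.
  move=> h0; rewrite /D; case/andP: (xchooseP (ex (ev g / ev h))).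
  move: (xchoose _) => [g' h'] /= h'0; rewrite eqr_div // => /eqP E.
  have : d (g * h' - g' * h) = 0 by apply: d0; rewrite eval2B !eval2M E subrr.
  rewrite dB !dM => E'; apply/eqP; rewrite eqr_div ?expf_neq0 //; apply/eqP.
  transitivity ((d g' * ev h) * (ev h' * ev h) - (ev g' * ev h) * d h' * ev h).
    by ring.
  have -> : d g' * ev h = d g * ev h' + ev g * d h' - ev g' * d h.
    by apply/eqP; rewrite eq_sym subr_eq -subr_eq0 E'.
  transitivity (d g * ev h' * ev h' * ev h + (ev g * ev h' - ev g' * ev h) * ev
    h * d h'
     - (ev g' * ev h) * d h * ev h'); first by ring.
  by rewrite -E; ring.
have Dev g : D (ev g) = d g.
  have := DE g 1; rewrite !eval2_1 oner_neq0 => /(_ isT).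
  have := dC 1; rewrite !polyC1 => ->.
  by rewrite mulr0 subr0 expr1n !divr1 mulr1.
exists D; split; last 2 first.
- by rewrite -(eval2X C x y) Dev /d /G eval2X derivD derivC derivZ derivX
  !hornerE.
- by rewrite -(eval2Y C x y) Dev /d /G eval2Y derivD derivC derivX !hornerE.
split=> [a b|a b|c].
- have [g [h [h0 ->]]] := ff_frac a; have [g' [h' [h'0 ->]]] := ff_frac b.
  rewrite addf_div // -!eval2M -eval2D !DE ?eval2M ?mulf_neq0 // eval2D dD !dM
    !eval2M.
  by field; apply/andP.
- have [g [h [h0 ->]]] := ff_frac a; have [g' [h' [h'0 ->]]] := ff_frac b.
  rewrite mulf_div -!eval2M !DE ?eval2M ?mulf_neq0 // !dM.
  by field; apply/andP.
- by rewrite -(eval2CC C x y) Dev dC.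
Qed.

Lemma tder_uniq (t : {rmorphism F -> F}) (d : F -> F) :
  twisted_derivation C t d -> d x = 0 -> d y = 0 -> forall z, d z = 0.
Proof.
case=> dD dM dC dx dy z.
have dev g : d (ev g) = 0.
  elim/poly2_ind: g => [c|||g h IHg IHh|g h IHg IHh].
  - by rewrite eval2CC.
  - by rewrite eval2X.
  - by rewrite eval2Y.
  - by rewrite eval2D dD IHg IHh addr0.
  - by rewrite eval2M dM IHg IHh mulr0 mul0r addr0.
have [g [h [h0 ->]]] := ff_frac z; apply/eqP.
have /eqP : d (ev g / ev h * ev h) = 0 by rewrite divfK.
rewrite dM dev mulr0 addr0.
by rewrite mulf_eq0 fmorph_eq0 (negPf h0) orbF.
Qed.

End Derivation.

(** * Places *)

(* O is a discrete valuation ring of F over K with uniformizer t and residue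
   field K. *)
Record place (K F : fieldType) (C : K -> F) (t : F) (O : F -> Prop) : Prop :=
 Place {
  pl_C : forall c, O (C c);
  pl_D : forall a b, O a -> O b -> O (a + b);
  pl_M : forall a b, O a -> O b -> O (a * b);
  pl_t : O t;
  pl_tV : ~ O t^-1;
  pl_val : forall z, O z \/ O z^-1;
  pl_unit : forall z, O z -> O (z / t) \/ O z^-1;
  pl_res : forall z, O z -> exists c, O ((z - C c) / t)
}.

Section Place.

Variables (K F : fieldType) (C : {rmorphism K -> F}) (t : F) (O : F -> Prop).
Hypothesis P : place C t O.

Lemma pl0 : O 0. Proof. by rewrite -(rmorph0 C); apply: pl_C P _. Qed.

Lemma pl1 : O 1. Proof. by rewrite -(rmorph1 C); apply: pl_C P _. Qed.

Lemma plN a : O a -> O (- a).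
Proof.
rewrite -mulN1r => Oa; apply: (pl_M P) Oa.
by rewrite -(rmorph1 C) -rmorphN; apply: pl_C P _.
Qed.

Lemma plB a b : O a -> O b -> O (a - b).
Proof. by move=> Oa Ob; apply: (pl_D P) Oa _; apply: plN. Qed.

Lemma plX a n : O a -> O (a ^+ n).
Proof.
move=> Oa; elim: n => [|n IH]; first exact: pl1.
by rewrite exprS; apply: (pl_M P).
Qed.

Lemma pl_sum (I : eqType) (s : seq I) (h : I -> F) :
  (forall i, i \in s -> O (h i)) -> O (\sum_(i <- s) h i).
Proof.
elim: s => [|i s IH] Oh; first by rewrite big_nil; apply: pl0.
rewrite big_cons; apply: (pl_D P); first by apply: Oh; rewrite mem_head.
by apply: IH => j js; apply: Oh; rewrite in_cons js orbT.
Qed.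

Lemma pl_horner (r : {poly K}) a : O a -> O (map_poly C r).[a].
Proof.
move=> Oa; elim/poly_ind: r => [|r c IH].
  by rewrite rmorph0 horner0; apply: pl0.
rewrite rmorphD rmorphM /= map_polyX map_polyC !hornerE.
by apply: (pl_D P); [apply: (pl_M P) | apply: pl_C P _].
Qed.

Lemma pl_t_neq0 : t != 0.
Proof.
by apply/eqP=> t0; apply: (pl_tV P); rewrite t0 invr0; apply: pl0.
Qed.

Lemma pl_unitC c z : c != 0 -> O z -> O (C c + t * z)^-1.
Proof.
move=> c0 Oz; have OCz : O (C c + t * z).
  by apply: (pl_D P) (pl_C P _) _; apply: (pl_M P) (pl_t P) Oz.
have [Ot|//] := pl_unit P OCz; case: (pl_tV P).
have -> : t^-1 = C c^-1 * ((C c + t * z) / t - z).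
  by rewrite fmorphV; field; rewrite pl_t_neq0 fmorph_eq0 c0.
by apply: (pl_M P) (pl_C P _) _; apply: plB.
Qed.

Lemma pl_nonunit z : O z -> ~ O z^-1 -> O (z / t).
Proof. by move=> Oz nOz; case: (pl_unit P Oz). Qed.

Lemma pl_em u : O u \/ ~ O u.
Proof.
have [|OuV] := pl_val P u; first by left.
have [Out|] := pl_unit P OuV; last by rewrite invrK; left.
have [->|u0] := eqVneq u 0; first by left; apply: pl0.
right=> Ou; apply: (pl_tV P).
have -> : t^-1 = u^-1 / t * u by field; rewrite u0 pl_t_neq0.
exact: (pl_M P).
Qed.

End Place.

(** * The discrete valuation ring at a smooth point *)

Section LocalRing.

Variables (K F : fieldType) (C : {rmorphism K -> F}) (a b : F) (a0 b0 : K).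
Local Notation ev := (eval2 C a b).
Local Notation pt := (eval2 (idfun : {rmorphism K -> K}) a0 b0).
Local Notation t := (b - C b0).

(** The generators [a], [b] are left arbitrary so that one development serves the charts (x, y), (x,
    1/y) and (y, 1/x). *)
Definition local_ring (z : F) := exists g h, pt h != 0 /\ z = ev g / ev h.

(** [sp_smooth] puts a - a0 into the ideal generated by b - b0, which makes b - b0 a uniformizer.
    [sp_elim] bounds the order of vanishing of an element by the multiplicity of b0 as a root of
    [r]. *)
Record smooth_point : Prop := SmoothPoint {
  sp_ev0 : forall g, ev g = 0 -> pt g = 0;
  sp_frac : forall z, exists g h, ev h != 0 /\ z = ev g / ev h;
  sp_smooth : exists A B, pt B != 0 /\ ev B * (a - C a0) = t * ev A;
  sp_elim : forall g, ev g != 0 -> exists g' (r : {poly K}),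
    r != 0 /\ ev g' * ev g = (map_poly C r).[b];
  sp_t : t != 0
}.

Hypothesis S : smooth_point.
Let t_neq0 := sp_t S.

Local Notation O := local_ring.

Let evn0 h : pt h != 0 -> ev h != 0.
Proof. by apply: contra_neq; apply: (sp_ev0 S). Qed.

Lemma local_ev g : O (ev g).
Proof. by exists g, 1; rewrite !eval2_1 oner_neq0 divr1. Qed.

Let O_C c : O (C c). Proof. by rewrite -(eval2CC C a b); apply: local_ev. Qed.

Let O_t : O t.
Proof.
have -> : t = ev ('X - b0%:P)%:P by rewrite polyCB !eval2E.
exact: local_ev.
Qed.

Let O_D u v : O u -> O v -> O (u + v).
Proof.
case=> g [h [h0 ->]] [g' [h' [h'0 ->]]].
exists (g * h' + g' * h), (h * h'); rewrite eval2M mulf_neq0 //; split=> //.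
by rewrite addf_div ?evn0 // eval2D !eval2M.
Qed.

Let O_M u v : O u -> O v -> O (u * v).
Proof.
case=> g [h [h0 ->]] [g' [h' [h'0 ->]]].
exists (g * g'), (h * h'); rewrite eval2M mulf_neq0 //; split=> //.
by rewrite mulf_div !eval2M.
Qed.

Let pt_ev_unit g : pt g != 0 -> O (ev g)^-1.
Proof. by move=> g0; exists 1, g; rewrite eval2_1 div1r. Qed.

Lemma pt_decomp g : exists A B,
  g = (pt g)%:P%:P + ('X - a0%:P%:P) * A + ('X - b0%:P)%:P * B.
Proof.
elim/poly2_ind: g => [c|||g h [A [B gE]] [A' [B' hE]]|g h [A [B gE]] [A' [B'
  hE]]].
- by exists 0, 0; rewrite !mulr0 !addr0 eval2CC.
- by exists 1, 0; rewrite eval2X mulr0 mulr1 addr0 addrC subrK.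
- by exists 0, 1; rewrite eval2Y mulr0 mulr1 addr0 polyCB addrC subrK.
- exists (A + A'), (B + B'); rewrite eval2D !polyCD.
  by move: (pt g) (pt h) gE hE => p p' -> ->; ring.
- exists (A * h + (pt g)%:P%:P * A'), (B * h + (pt g)%:P%:P * B').
  rewrite eval2M !polyCM.
  by move: (pt g) (pt h) gE hE => p p' -> ->; ring.
Qed.

Let O_tdiv g : pt g = 0 -> O (ev g / t).
Proof.
move=> g0; have [A [B gE]] := pt_decomp g.
have [P [Q [Q0 QP]]] := sp_smooth S.
have aE : (a - C a0) / t = ev P / ev Q.
  by apply/eqP; rewrite eqr_div ?evn0 // [X in X == _]mulrC QP mulrC.
have -> : ev g / t = ((a - C a0) / t) * ev A + ev B.
  rewrite gE g0 polyC0 polyCB add0r eval2D !eval2M !eval2B eval2X !eval2CC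
    eval2Y.
  by field.
apply: O_D; last exact: local_ev.
by apply: O_M; [rewrite aE; exists P, Q | apply: local_ev].
Qed.

Let O_tV : ~ O t^-1.
Proof.
case=> g [h [h0 gh]]; have : pt (('X - b0%:P)%:P * g - h) = 0.
  apply: (sp_ev0 S); rewrite eval2B eval2M polyCB eval2B eval2Y eval2CC.
  have -> : ev h = t * (ev g / ev h) * ev h by rewrite -gh mulfV ?mul1r.
  by rewrite mulrA divfK ?subrr ?evn0.
rewrite eval2B eval2M polyCB eval2B eval2Y eval2CC subrr mul0r sub0r.
by move/eqP; rewrite oppr_eq0 (negPf h0).
Qed.

Let O_unit z : O z -> O (z / t) \/ O z^-1.
Proof.
case=> g [h [h0 ->]]; have [g0|g0] := eqVneq (pt g) 0.
  left; rewrite mulrAC; apply: O_M (O_tdiv g0) _; exact: pt_ev_unit.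
by right; exists h, g; rewrite invf_div.
Qed.

Let O_res z : O z -> exists c, O ((z - C c) / t).
Proof.
case=> g [h [h0 ->]]; exists (pt g / pt h).
have -> : (ev g / ev h - C (pt g / pt h)) / t =
    (ev (g - (pt g / pt h)%:P%:P * h) / t) / ev h.
  rewrite eval2B eval2M eval2CC; by field;
    rewrite ?t_neq0 ?evn0 ?fmorph_eq0 ?h0.
apply: O_M; last exact: pt_ev_unit.
by apply: O_tdiv; rewrite eval2B eval2M eval2CC divfK ?subrr.
Qed.

(* An element of the maximal ideal loses a factor t at each step, and at most
   e steps are possible. *)
Let O_factor e u v w : O u -> O v -> O w -> O w^-1 -> w != 0 ->
  u * v = t ^+ e * w -> exists n w', [/\ O w', O w'^-1 & u = t ^+ n * w'].
Proof.
elim: e u => [|e IH] u Ou Ov Ow OwV w0 uv.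
  exists 0%N, u; rewrite expr0 mul1r in uv; split=> //; last by rewrite mul1r.
  have := w0; rewrite -uv mulf_eq0 negb_or => /andP[u0 v0].
  have -> : u^-1 = v * (u * v)^-1 by field; rewrite u0 v0.
  by apply: O_M; rewrite ?uv.
have [Out|OuV] := O_unit Ou; last by exists 0%N, u; rewrite mul1r.
have [|n [w' [Ow' OwV' uE]]] := IH _ Out Ov Ow OwV w0.
  by rewrite mulrAC uv exprS; field.
by exists n.+1, w'; split=> //; rewrite exprS -mulrA -uE mulrC divfK.
Qed.

Let O_ev_factor g : ev g != 0 ->
  exists n w, [/\ O w, O w^-1 & ev g = t ^+ n * w].
Proof.
move=> g0; have [g' [r [r0 rE]]] := sp_elim S g0.
have [e [r1 /implyP/(_ r0) r1b rE1]] := multiplicity_XsubC r b0.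
have rt : r1.[b0] != 0 by [].
apply: (@O_factor e _ (ev g') (ev r1%:P)).
- exact: local_ev.
- exact: local_ev.
- exact: local_ev.
- by apply: pt_ev_unit; rewrite eval2C map_poly_id.
- by apply: evn0; rewrite eval2C map_poly_id.
rewrite mulrC rE rE1 eval2C rmorphM rmorphXn /= map_polyXsubC.
by rewrite hornerM horner_exp hornerXsubC mulrC.
Qed.

Lemma local_place : place C t O.
Proof.
split=> // z; have [g [h [h0 ->]]] := sp_frac S z.
have [g0|g0] := eqVneq (ev g) 0; first by left; rewrite g0 mul0r -(rmorph0 C).
have [n [w [Ow OwV ->]]] := O_ev_factor g0.
have [m [w' [Ow' OwV' ->]]] := O_ev_factor h0.
have tX k u : O u -> O (t ^+ k * u).
  by move=> Ou; elim: k => [|k IH]; rewrite ?mul1r // exprS -mulrA; apply: O_M.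
have quot i j u v : (i <= j)%N -> t ^+ j * u / (t ^+ i * v) = t ^+ (j - i) * (u
  * v^-1).
  move=> ij; rewrite -[in t ^+ j](subnK ij) exprD -[X in X / _]mulrA
    -[LHS]mulrA -mulf_div.
  by rewrite divff ?expf_neq0 // mul1r.
have [nm|mn] := leqP m n.
  left; have -> : t ^+ n * w / (t ^+ m * w') = t ^+ (n - m) * (w * w'^-1).
    by apply: quot.
  exact/tX/O_M.
right; have -> : (t ^+ n * w / (t ^+ m * w'))^-1 = t ^+ (m - n) * (w' * w^-1).
  by rewrite invf_div; apply/quot/ltnW.
exact/tX/O_M.
Qed.

Lemma local_tdiv g : pt g = 0 -> O (ev g / t).
Proof. exact: O_tdiv. Qed.

(** By the Leibniz and quotient rules the bound only has to be checked on the two generators. The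
    factor [e] absorbs the ramification or the pole of dy at the point. *)
Lemma local_deriv (D : F -> F) (e : F) : twisted_derivation C id D ->
  O (D a / e) -> O (D b / e) -> forall z, O z -> O (D z / e).
Proof.
case=> dD dM dC Oa Ob.
have dev g : O (D (ev g) / e).
  elim/poly2_ind: g => [c|||g h IHg IHh|g h IHg IHh].
  - by rewrite eval2CC dC mul0r -(rmorph0 C); apply: O_C.
  - by rewrite eval2X.
  - by rewrite eval2Y.
  - by rewrite eval2D dD mulrDl; apply: O_D.
  - rewrite eval2M dM mulrDl mulrAC -[X in _ + X]mulrA.
    by apply: O_D; apply: O_M => //; apply: local_ev.
move=> z [g [h [h0 zE]]]; have hn0 := evn0 h0.
have -> : D z / e = (D (ev g) / e - z * (D (ev h) / e)) / ev h.
  have -> : ev g = z * ev h by rewrite zE divfK.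
  by rewrite dM /= mulrA -mulrBl addrK mulrAC mulfK.
apply: O_M (pt_ev_unit h0); apply: (plB local_place) => //.
by apply: O_M; first by exists g, h.
Qed.

Lemma local_rmorph (s : {rmorphism F -> F}) : (forall c, s (C c) = C c) ->
  O ((s a - C a0) / t) -> O ((s b - C b0) / t) -> forall z, O z -> O (s z).
Proof.
move=> sC Oa Ob.
have subK u c : O ((u - C c) / t) -> O u.
  move=> Ou; have -> : u = (u - C c) / t * t + C c by rewrite divfK ?subrK.
  by apply: O_D (O_C _); apply: O_M.
have sev g : O (s (ev g)).
  elim/poly2_ind: g => [c|||g h IHg IHh|g h IHg IHh].
  - by rewrite eval2CC sC; apply: O_C.
  - by rewrite eval2X; apply: subK Oa.
  - by rewrite eval2Y; apply: subK Ob.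
  - by rewrite eval2D rmorphD; apply: O_D.
  - by rewrite eval2M rmorphM; apply: O_M.
move=> z [g [h [h0 ->]]]; rewrite fmorph_div; apply: O_M (sev g) _.
have [A [B hE]] := pt_decomp h.
(* The image of a denominator differs from the nonzero constant [pt h] by a multiple of the
   uniformizer, so it is still a unit. *)
have -> : s (ev h) = C (pt h)
    + t * ((s a - C a0) / t * s (ev A) + (s b - C b0) / t * s (ev B)).
  rewrite {1}hE polyCB !eval2D !eval2M !eval2B !eval2CC eval2X eval2Y.
  by rewrite !(rmorphD s) !(rmorphM s) !(rmorphB s) !sC; field.
by apply: (pl_unitC local_place) h0 _; apply: O_D; apply: O_M.
Qed.

End LocalRing.

Lemma eval2_map (K : fieldType) (R : comNzRingType) (C : {rmorphism K -> R})
    (u v : R) g :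
  eval2 C u v g = (map_poly (horner_eval v \o map_poly C) g).[u].
Proof.
elim/poly_ind: g => [|g c IH]; first by rewrite eval2_0 rmorph0 horner0.
rewrite eval2D eval2M eval2X eval2C IH rmorphD rmorphM /= map_polyX map_polyC.
by rewrite !hornerE.
Qed.

(** The reciprocal polynomial T^n r(1/T) for a formal degree [n], which may exceed the degree of
    [r]. *)
Definition rev_poly (R : nzRingType) n (r : {poly R}) :=
  \poly_(i < n.+1) r`_(n - i).

Lemma horner_rev (F : fieldType) n (r : {poly F}) (b : F) :
  b != 0 -> (size r <= n.+1)%N -> (rev_poly n r).[b^-1] = b^-1 ^+ n * r.[b].
Proof.
move=> b0 sr;
  rewrite (horner_coef_wide _ sr) (horner_coef_wide _ (size_poly _ _)).
rewrite mulr_sumr [RHS](reindex_inj rev_ord_inj) /=; apply: eq_bigr => i _.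
rewrite coef_poly ltn_ord subSS mulrCA; congr (_ * _).
have iE : (n = i + (n - i))%N by rewrite subnKC // -ltnS.
rewrite {2}iE exprD -mulrA -exprMn mulVf // expr1n mulr1 //.
Qed.

Lemma map_rev_poly (R S : nzRingType) (h : {additive R -> S}) n (r : {poly R}) :
  map_poly h (rev_poly n r) = rev_poly n (map_poly h r).
Proof.
apply/polyP=> i; rewrite coef_map [in LHS]coef_poly [in RHS]coef_poly.
by case: ifP => _; rewrite ?coef_map ?raddf0.
Qed.

(** * The affine points and the points at infinity *)

Section Places.

Variables (K : closedFieldType) (L : {poly K}) (q : nat) (a0 : K) (rs : seq K).
Hypothesis (HL : additive_separable L q a0 rs).

Lemma as_add0 : L.[0] = 0.
Proof.
have := as_add HL (idfun : {rmorphism K -> K}) 0 0.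
by rewrite !map_poly_id // addr0 => /esym/eqP; rewrite -subr_eq0 addrK => /eqP.
Qed.

Lemma as_addR (R : comNzRingType) (B : {rmorphism K -> R}) u c :
  (map_poly B L).[u + B c] = (map_poly B L).[u] + B L.[c].
Proof. by rewrite (as_add HL) horner_map. Qed.

(** [M] is L(T)/T. Its value at 0 is L'(0) = [a0], which is nonzero; together with additivity this
    makes L(u) - L(c) a local unit times u - c wherever u takes the value c. *)
Lemma as_factor : exists M, M.[0] = a0 /\
  forall (R : comNzRingType) (B : {rmorphism K -> R}) u,
    (map_poly B L).[u] = (map_poly B M).[u] * u.
Proof.
have /factor_theorem[M LE] : root L 0 by apply/rootP/as_add0.
exists M; rewrite subr0 in LE; split=> [|R B u].
  have := as_deriv HL; rewrite LE derivM derivX mulr1 => /(congr1 (horner^~ 0)).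
  by rewrite !hornerE.
by rewrite LE rmorphM /= map_polyX hornerMX.
Qed.

Let q_gt0 : (0 < q)%N. Proof. by have := as_q HL; case: (q). Qed.

Variable F : function_field (LL_poly L).
Local Notation C := (ffC F).
Local Notation x := (ffX F).
Local Notation y := (ffY F).
Local Notation ev := (eval2 C x y).
Local Notation f := (LL_poly L).
Local Notation "p ^F" := (map_poly C p) (at level 1, format "p ^F") :
  ring_scope.

Lemma LFB (R : comNzRingType) (B : {rmorphism K -> R}) u v :
  (map_poly B L).[u - v] = (map_poly B L).[u] - (map_poly B L).[v].
Proof. by apply/eqP; rewrite eq_sym subr_eq -(as_add HL) subrK. Qed.

Lemma affine_smooth c d : L.[c] * L.[d] = 1 -> smooth_point C x y c d.
Proof.
move=> cd; have [M [M0 LME]] := as_factor; have LM := LME _ C.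
split.
- by move=> g /(ff_ker F)[h ->];
  rewrite eval2M eval2_LL !map_poly_id // cd subrr mulr0.
- by move=> z; have [g [h [h0 zE]]] := ff_frac z; exists g, h.
(* From L(x) L(y) = L(c) L(d) = 1 one gets L(d) L(y) (L(x) - L(c)) = L(d) - L(y). The two
   differences are M(x - c) (x - c) and -M(y - d) (y - d). *)
- exists (- (M \Po ('X - d%:P))%:P), ((L.[d] *: L)%:P * (M \Po ('X - c%:P))^:P).
  split.
    rewrite eval2M eval2C eval2P !map_poly_id // hornerZ.
    rewrite horner_comp !hornerE subrr M0 !mulf_neq0 ?(as_a0 HL) //;
    by apply: contra_eqN cd => /eqP ->; rewrite mulr0 eq_sym oner_eq0.
  rewrite eval2M eval2N !eval2C eval2P map_polyZ /= hornerZ.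
  have mapc r e u : (r \Po ('X - e%:P))^F.[u] = r^F.[u - C e].
    by rewrite map_comp_poly horner_comp map_polyXsubC hornerXsubC.
  rewrite !mapc [RHS]mulrC.
  rewrite -mulrA -LM.
  rewrite LFB horner_map.
  have : C L.[c] * C L.[d] = 1 by rewrite -rmorphM cd rmorph1.
  have := ff_eq F.
  have -> : - M^F.[y - C d] * (y - C d) = C L.[d] - L^F.[y].
    by rewrite mulNr -LM LFB horner_map opprB.
  move: (C L.[c]) (C L.[d]) L^F.[x] L^F.[y] => a b a' b' E1 E2.
  rewrite mulrBr;
    have -> : b * b' * a' = b by rewrite -mulrA [b' * _]mulrC E1 mulr1.
  by have -> : b * b' * a = b' by rewrite [b * _]mulrC -mulrA [b * _]mulrC E2
    mulr1.
- by move=> g /(ff_elim HL).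
- by rewrite subr_eq0; apply: ffY_nonconst HL _ _.
Qed.

Lemma affine_deriv D c d : twisted_derivation C id D ->
  D x = - (L^F.[x] / L^F.[y]) -> D y = 1 -> L.[c] * L.[d] = 1 ->
  forall z, local_ring C x y c d z -> local_ring C x y c d (D z).
Proof.
move=> dD Dx Dy cd z Oz; have S := affine_smooth cd.
rewrite -[D z]divr1; apply: local_deriv Oz => //; rewrite divr1 ?Dx ?Dy.
  apply: plN (local_place S) _ _; exists L^:P, L%:P.
  rewrite eval2C !eval2P eval2C map_poly_id //; split=> //.
  by apply: contra_eqN cd => /eqP ->; rewrite mulr0 eq_sym oner_eq0.
exact: pl1 (local_place S).
Qed.

Lemma ffY_neq0 : y != 0.
Proof. by have := ffY_nonconst HL F 0; rewrite rmorph0. Qed.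

Let sL : size L = q.+1. Proof. exact: as_size HL. Qed.

Definition revL := rev_poly q L.

Lemma revL0 : revL.[0] = lead_coef L.
Proof. by rewrite horner_coef0 coef_poly /= subn0 lead_coefE sL. Qed.

Lemma revL_neq0 : revL.[0] != 0.
Proof. by rewrite revL0 lead_coef_eq0 -size_poly_eq0 sL. Qed.

Lemma horner_revL (u : F) : u != 0 -> L^F.[u] = u ^+ q * revL^F.[u^-1].
Proof.
move=> u0; rewrite map_rev_poly horner_rev ?size_map_poly ?sL //.
by rewrite mulrA -exprMn mulfV // expr1n mul1r.
Qed.

Lemma lead_coef_LL : lead_coef f = lead_coef L *: L.
Proof.
rewrite lead_coefE (size_LL HL) /= coefB coefMC coef_map /= coef1.
by case: (q) sL q_gt0 => // n sn _; rewrite subr0 mul_polyC lead_coefE sn.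
Qed.

(** Reversing [g] in its second variable gives a polynomial that vanishes at (x, y), hence a
    multiple of [f]. Its coefficient of y^N is either zero or divisible by the leading coefficient
    of [f] in y, which is a multiple of L(x) and vanishes at [alpha]; that coefficient is g(X,
    0). *)
Lemma inf_ev0 alpha g : L.[alpha] = 0 ->
  eval2 C x y^-1 g = 0 -> eval2 (idfun : {rmorphism K -> K}) alpha 0 g = 0.
Proof.
move=> La; rewrite (eval2_swap _ y^-1 x) (eval2_swap _ 0 alpha).
move: (swapXY g) => {g} G; pose N := size G; rewrite eval2_map => G0.
have G00 : eval2 idfun 0 alpha G = ((rev_poly N G)`_N).[alpha].
  rewrite eval2_map horner_coef0 coef_map /= coef_poly ltnSn subnn.
  by rewrite /horner_eval map_poly_id.
rewrite G00; have : eval2 C y x (rev_poly N G) = 0.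
  rewrite eval2_map map_rev_poly -[X in _.[X]]invrK horner_rev ?G0 ?mulr0 //.
    by rewrite invr_eq0 ffY_neq0.
  by rewrite (leq_trans (size_poly _ _)).
case/(ff_ker (ffswap F)) => k HE.
have [k0|k0] := eqVneq k 0; first by rewrite HE k0 mul0r coef0 horner0.
have sH : (size (rev_poly N G) <= N.+1)%N by apply: size_poly.
have [sN|sN] := leqP (size (rev_poly N G)) N.
  by rewrite [(rev_poly N G)`_N]nth_default // horner0.
have -> : (rev_poly N G)`_N = lead_coef (rev_poly N G).
  rewrite lead_coefE; congr _`_ _; apply/eqP; rewrite eqn_leq.
  by case: (size (rev_poly N G)) sH sN => // n; rewrite !ltnS /= => -> ->.
by rewrite HE lead_coefM lead_coef_LL hornerM hornerZ La !mulr0.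
Qed.

Lemma rev_conv (R : fieldType) (B : {rmorphism K -> R}) (b : R) (r : {poly K})
  n :
  b != 0 -> (size r <= n.+1)%N ->
  (map_poly B (rev_poly n r)).[b^-1] = b^-1 ^+ n * (map_poly B r).[b].
Proof. by move=> b0 sr; rewrite map_rev_poly horner_rev // size_map_poly. Qed.

(** A sufficiently high power of 1/b clears the powers of b. All higher powers are allowed as well,
    so that two expressions can be brought to the same exponent. *)
Lemma inf_conv (R : fieldType) (B : {rmorphism K -> R}) (a b : R) g :
  b != 0 -> exists N, forall n, exists g',
  eval2 B a b^-1 g' = b^-1 ^+ (N + n) * eval2 B a b g.
Proof.
move=> b0; elim/poly2_ind: g => [c|||g h [N IHg] [M IHh]|g h [N IHg] [M IHh]].
- exists 0%N => n; exists ('X^n * c%:P)%:P.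
  by rewrite polyCM polyC_exp eval2M (rmorphXn (eval2 _ _ _)) /= eval2Y
    !eval2CC add0n.
- exists 0%N => n; exists ('X^n%:P * 'X).
  by rewrite polyC_exp eval2M (rmorphXn (eval2 _ _ _)) /= eval2Y !eval2X add0n.
- exists 1%N => n; exists 'X^n%:P.
  rewrite polyC_exp (rmorphXn (eval2 _ _ _)) /= !eval2Y addSn add0n exprSr.
  by rewrite -mulrA mulVf ?mulr1.
- exists (N + M)%N => n; have [g' gE] := IHg (M + n)%N;
  have [h' hE] := IHh (N + n)%N.
  by exists (g' + h'); rewrite !eval2D gE hE mulrDr !addnA [(M + N)%N]addnC.
- exists (N + M)%N => n; have [g' gE] := IHg 0%N; have [h' hE] := IHh n.
  by exists (g' * h'); rewrite !eval2M gE hE mulrACA -exprD addn0 addnA.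
Qed.

Lemma inf_smooth alpha : L.[alpha] = 0 -> smooth_point C x y^-1 alpha 0.
Proof.
move=> La; have y0 := ffY_neq0; have yV0 : y^-1 != 0 by rewrite invr_eq0.
split.
- by move=> g; apply: inf_ev0.
- move=> z; have [g [h [h0 ->]]] := ff_frac z.
  have [N Ng] := inf_conv C x g y0; have [M Mh] := inf_conv C x h y0.
  have [g' gE] := Ng M; have [h' hE] := Mh N; exists g', h'.
  rewrite gE hE [(M + N)%N]addnC mulf_neq0 ?expf_neq0 //; split=> //.
  by rewrite -mulf_div divff ?mul1r // expf_neq0.
- have [M [M0 LM]] := as_factor.
  (* These witnesses come from revL(1/y) L(x) = y^-q L(y) L(x) = y^-q, where L(x) = L(x - alpha) =
     M(x - alpha) (x - alpha). *)
  exists ('X%:P ^+ q.-1), (revL%:P * (M \Po ('X - alpha%:P))^:P).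
  split.
    rewrite eval2M eval2C eval2P !map_poly_id //.
    by rewrite horner_comp !hornerE subrr M0 mulf_neq0 ?(as_a0 HL) // revL_neq0.
  rewrite eval2M eval2C eval2P (rmorphXn (eval2 _ _ _)) /= eval2Y.
  rewrite map_comp_poly horner_comp map_polyXsubC hornerXsubC -mulrA -LM.
  rewrite LFB horner_map /= La rmorph0 !subr0 -exprS prednK //.
  have revE : revL^F.[y^-1] = y^-1 ^+ q * L^F.[y].
    by rewrite (horner_revL y0) mulrA -exprMn mulVf // expr1n mul1r.
  by rewrite revE -mulrA [_ * L^F.[x]]mulrC ff_eq mulr1.
- move=> g g0; have [N Ng] := inf_conv C x g yV0; have [G] := Ng 0%N.
  rewrite invrK addn0 => GE; have G0 : ev G != 0.
    by rewrite GE mulf_neq0 ?expf_neq0.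
  have [G' [r [r0 rE]]] := ff_elim HL G0.
  have [M MG'] := inf_conv C x G' y0.
  have [g' gE] := MG' (size r); exists g', (rev_poly (N + (M + size r)) r).
  have sz : (size r <= (N + (M + size r)).+1)%N by rewrite leqW // addnA
    leq_addl.
  have main : eval2 C x y^-1 g' * eval2 C x y^-1 g = (rev_poly (N + (M + size
    r)) r)^F.[y^-1].
    rewrite (rev_conv C y0 sz) -rE gE GE.
    rewrite [(N + _)%N]addnC (exprD _ (M + size r) N) -!mulrA; congr (_ * _).
    rewrite [RHS]mulrCA; congr (_ * _).
    by rewrite mulrA -exprMn mulVf // expr1n mul1r.
  split=> //; apply: contraNneq (nonconst_trans (ffY_nonconst HL F) r0) => rev0.
  have := mulf_eq0 (y^-1 ^+ (N + (M + size r))) r^F.[y].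
  rewrite -(rev_conv C y0 sz) rev0 rmorph0 horner0 eqxx.
  by rewrite (negPf (expf_neq0 _ yV0)).
- by rewrite rmorph0 subr0.
Qed.

Lemma inf_place alpha : L.[alpha] = 0 ->
  place C y^-1 (local_ring C x y^-1 alpha 0).
Proof. by move/inf_smooth/local_place; rewrite rmorph0 subr0. Qed.

(** The exponent 2 is the double pole of dy at y = oo: D(1/y) = -y^-2. The other generator satisfies
    D x = -L(x)^2, and L(x) is divisible by y^-q. *)
Lemma inf_deriv D alpha : twisted_derivation C id D ->
  D x = - (L^F.[x] / L^F.[y]) -> D y = 1 -> L.[alpha] = 0 ->
  forall z, local_ring C x y^-1 alpha 0 z ->
    local_ring C x y^-1 alpha 0 (D z / y^-1 ^+ 2).
Proof.
move=> dD Dx Dy La z Oz; have S := inf_smooth La; have P := inf_place La.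
have y0 := ffY_neq0; have [dA dM dC] := dD.
have revU : local_ring C x y^-1 alpha 0 (revL^F.[y^-1])^-1.
  exists 1, revL%:P; rewrite eval2_1 !eval2C map_poly_id // div1r.
  by split=> //; apply: revL_neq0.
apply: (local_deriv S dD _ _ Oz).
  have LyV : L^F.[y]^-1 = L^F.[x].
    by rewrite -[LHS]mul1r -(ff_eq F) mulfK // (ffLY_neq0 F).
  have LxE : L^F.[x] = y^-1 * (y^-1 ^+ q.-1 * (revL^F.[y^-1])^-1).
    by rewrite mulrA -exprS prednK // -LyV (horner_revL y0) invfM exprVn.
  have -> : D x / y^-1 ^+ 2 = - (y^-1 ^+ q.-1 * (revL^F.[y^-1])^-1) ^+ 2.
    rewrite Dx LyV -expr2 LxE [in LHS]exprMn mulNr mulrAC divff ?mul1r //.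
    by rewrite expf_neq0 // invr_eq0.
  apply: (plN P); apply: (plX P); apply: (pl_M P) revU.
  by apply: (plX P); apply: (pl_t P).
have -> : D y^-1 / y^-1 ^+ 2 = - 1.
  have : D (y * y^-1) = 0 by rewrite mulfV // -(rmorph1 C) dC.
  rewrite dM Dy /= mul1r => /eqP; rewrite addrC addr_eq0 => /eqP E.
  have -> : D y^-1 = - (y^-1 ^+ 2) by rewrite expr2 -mulNr -E mulrC mulKf.
  by rewrite mulNr divff // expf_neq0 // invr_eq0.
by apply: (plN P); apply: pl1 P.
Qed.

End Places.

(** * Regularity of the differentials u^i v^j du / L(u) *)

Section Holomorphic.

Variables (K : closedFieldType) (L : {poly K}) (q : nat) (a0 : K) (rs : seq K).
Hypothesis (HL : additive_separable L q a0 rs).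

Let q_gt0 : (0 < q)%N. Proof. by have := as_q HL; case: (q). Qed.
Let sL : size L = q.+1. Proof. exact: as_size HL. Qed.

Variable F : function_field (LL_poly L).
Local Notation C := (ffC F).
Local Notation x := (ffX F).
Local Notation y := (ffY F).
Local Notation "p ^F" := (map_poly C p) (at level 1, format "p ^F") :
  ring_scope.

Lemma deriv_horner D (p : {poly K}) (u : F) : twisted_derivation C id D ->
  D p^F.[u] = (p^`())^F.[u] * D u.
Proof.
case=> dD dM dC; elim/poly_ind: p => [|p c IH].
  by rewrite deriv0 !rmorph0 !horner0 mul0r; have := dC 0; rewrite rmorph0.
rewrite derivD derivM derivX derivC addr0 mulr1 !(rmorphD (map_poly C)).
rewrite !(rmorphM (map_poly C)) /= map_polyX map_polyC !hornerE dD dM dC IH /=.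
by ring.
Qed.

Lemma deriv_V D (u : F) : twisted_derivation C id D -> D u^-1 = - (D u / u ^+
  2).
Proof.
case=> dD dM dC; have [->|u0] := eqVneq u 0.
  by rewrite invr0; have := dC 0; rewrite rmorph0 => ->; rewrite mul0r oppr0.
have : D (u * u^-1) = 0 by rewrite mulfV // -(rmorph1 C) dC.
rewrite dM /= => /eqP; rewrite addrC addr_eq0 => /eqP E.
have -> : D u^-1 = (u * D u^-1) / u by rewrite mulrAC mulfV ?mul1r.
by rewrite E; field.
Qed.

Section Local.

Variables (t : F) (O : F -> Prop) (D : F -> F) (e : F).
Hypotheses (P : place C t O) (dD : twisted_derivation C id D).
Hypothesis De : forall z, O z -> O (D z / e).

(** [rho] is revL(1/u). It is a unit because 1/u lies in the maximal ideal and the constant term of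
    [revL] is the leading coefficient of [L]. *)
Lemma pole_unit u : ~ O u -> exists rho,
  [/\ O (u^-1 / t), O rho^-1, rho != 0 & L^F.[u] = u ^+ q * rho].
Proof.
move=> nOu; have u0 : u != 0.
  by apply/eqP=> u0; apply: nOu; rewrite u0; apply: pl0 P.
have Ow : O u^-1 by case: (pl_val P u).
have Owt : O (u^-1 / t) by apply: (pl_nonunit P) => //; rewrite invrK.
exists (revL L q)^F.[u^-1]; rewrite -(horner_revL HL) //.
have [r [c rE]] : exists r c, revL L q = r * 'X + c%:P.
  by elim/poly_ind: (revL L q) => [|r c _]; [exists 0, 0;
    rewrite mul0r addr0 | exists r, c].
have c0 : c != 0 by have := revL_neq0 HL; rewrite rE !hornerE.
have rhoE : (revL L q)^F.[u^-1] = C c + t * (r^F.[u^-1] * (u^-1 / t)).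
  rewrite rE rmorphD rmorphM /= map_polyX map_polyC hornerMXaddC.
  by move: (r^F.[u^-1]) => z; field; rewrite ?u0 (pl_t_neq0 P).
have rU : O (C c + t * (r^F.[u^-1] * (u^-1 / t)))^-1.
  by apply: (pl_unitC P) c0 _; apply: (pl_M P) Owt; apply: pl_horner P _ _ Ow.
rewrite rhoE; split=> //; apply/eqP => E.
apply: (pl_tV P); rewrite -[t^-1]mul1r.
have -> : 1 = C c^-1 * (- (t * (r^F.[u^-1] * (u^-1 / t)))) :> F.
  by move/eqP: E; rewrite addr_eq0 => /eqP <-; rewrite -rmorphM mulVf ?rmorph1.
rewrite -mulrA; apply: (pl_M P) (pl_C P _) _; rewrite mulNr; apply: (plN P).
rewrite mulrAC mulfV ?(pl_t_neq0 P) // mul1r.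
by apply: (pl_M P) Owt; apply: pl_horner P _ _ Ow.
Qed.

(** At a common pole L(u) L(v) would be a unit times u^q v^q, which has a pole and cannot be 1. *)
Lemma pole_other u v : L^F.[u] * L^F.[v] = 1 -> ~ O u -> O v.
Proof.
move=> uv nOu; have [rho [Ow Or r0 LuE]] := pole_unit nOu.
have [//|nOv] := pl_em P v.
have [rho' [_ Or' r'0 LvE]] := pole_unit nOv.
have v0 : v != 0 by apply/eqP=> v0; apply: nOv; rewrite v0; apply: pl0 P.
case: (pl_tV P); have -> : t^-1 = v^-1 ^+ q.-1 * (v^-1 / t) * v ^+ q.
  rewrite mulrA -exprSr prednK // mulrAC -exprMn mulVf // expr1n mul1r //.
apply: (pl_M P).
  apply: (pl_M P) (pl_nonunit P _ _); last by rewrite invrK.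
    by apply: (plX P); case: (pl_val P v).
  by case: (pl_val P v).
have -> : v ^+ q = L^F.[v] * rho'^-1 by rewrite LvE mulfK.
apply: (pl_M P) Or'; have -> : L^F.[v] = u^-1 ^+ q * rho^-1.
  by rewrite exprVn -invfM -LuE (mulr1_eq uv).
by apply: (pl_M P) Or; apply: (plX P); case: (pl_val P u).
Qed.

(** With w = 1/u, u^i du / L(u) equals -w^(q-2-i) dw divided by the unit [rho]. This is where i <= q
    - 2 is needed; [j] is free because [v] is regular here. *)
Lemma holomorphic_pole u v i j : L^F.[u] * L^F.[v] = 1 -> ~ O u ->
  (i <= q - 2)%N -> O (u ^+ i * v ^+ j * (D u / L^F.[u]) / e).
Proof.
move=> uv nOu iq; have Ov := pole_other uv nOu.
have [rho [Ow Or r0 LuE]] := pole_unit nOu.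
have u0 : u != 0 by apply/eqP=> u0; apply: nOu; rewrite u0; apply: pl0 P.
have OuV : O u^-1 by case: (pl_val P u).
have -> : u ^+ i * v ^+ j * (D u / L^F.[u]) / e
    = - (u^-1 ^+ (q - 2 - i) * v ^+ j * rho^-1 * (D u^-1 / e)).
  have -> : D u = - (u ^+ 2 * D u^-1).
    by rewrite deriv_V // mulrN opprK mulrC divfK // expf_neq0.
  rewrite LuE exprVn; have qE : (q = (q - 2 - i) + i + 2)%N.
    by rewrite subnK // subnK // ltnW // (as_q HL).
  rewrite {1}qE !exprD;
    move: (expf_neq0 i u0) (expf_neq0 (q - 2 - i) u0) (expf_neq0 2 u0).
  move: (u ^+ i) (u ^+ (q - 2 - i)) (u ^+ 2) => a b c a1 b1 c1.
  by move: e^-1 => e'; field; rewrite r0 a1 b1 c1.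
apply: (plN P); apply: (pl_M P) (De OuV); apply: (pl_M P) Or.
by apply: (pl_M P); apply: (plX P).
Qed.

(* The differential u^i v^j du / L(u) is regular at O, that is, lies in O dO. *)
Lemma holomorphic u v i j : L^F.[u] * L^F.[v] = 1 ->
  (i <= q - 2)%N -> (j <= q - 2)%N -> O (u ^+ i * v ^+ j * (D u / L^F.[u]) / e).
Proof.
move=> uv iq jq; have vu : L^F.[v] * L^F.[u] = 1 by rewrite mulrC.
have Ln0 a b : L^F.[a] * L^F.[b] = 1 -> a != 0 /\ L^F.[a] != 0.
  move=> ab; suff La0 : L^F.[a] != 0.
    split=> //; apply: contraNneq La0 => ->.
    by rewrite -(rmorph0 C) horner_map (as_add0 HL).
  by apply: contra_eq_neq ab => ->; rewrite mul0r eq_sym oner_eq0.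
have [u0 Lu0] := Ln0 _ _ uv; have [v0 Lv0] := Ln0 _ _ vu.
(* Differentiating L(u) L(v) = 1 makes the differential symmetric up to sign, so a pole of [v] is
   treated like a pole of [u]. *)
have dLuv : D u / L^F.[u] = - (D v / L^F.[v]).
  have [_ dM dC] := dD; have /eqP : D (L^F.[u] * L^F.[v]) = 0.
    by rewrite uv -(rmorph1 C) dC.
  have dL z : D L^F.[z] = C a0 * D z.
    by rewrite deriv_horner // (as_deriv HL) map_polyC hornerC.
  rewrite dM !dL /=.
  have -> : C a0 * D u * L^F.[v] + L^F.[u] * (C a0 * D v) =
     C a0 * L^F.[u] * L^F.[v] * (D u / L^F.[u] + D v / L^F.[v]).
    by field; rewrite ?Lu0 ?Lv0.
  rewrite !mulf_eq0 fmorph_eq0 (negPf (as_a0 HL)) (negPf Lu0) (negPf Lv0) /=.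
  by rewrite addr_eq0 => /eqP.
have [Ou|nOu] := pl_em P u; last exact: holomorphic_pole.
have [Ov|nOv] := pl_em P v; last first.
  have -> : u ^+ i * v ^+ j * (D u / L^F.[u]) / e
      = - (v ^+ j * u ^+ i * (D v / L^F.[v]) / e).
    by rewrite dLuv mulrN mulNr [u ^+ i * _]mulrC.
  by apply: (plN P); apply: holomorphic_pole.
rewrite (mulr1_eq uv) -!mulrA; apply: (pl_M P); first exact: (plX P).
apply: (pl_M P); first exact: (plX P).
rewrite mulrCA mulrC; apply: (pl_M P); last exact: (pl_horner P).
exact: De.
Qed.

End Local.

End Holomorphic.

(** * Galois translations and traces *)

Lemma seq_choice (A : eqType) (B : Type) (b0 : B) (P : A -> B -> Prop) (s : seq
  A) :
  (forall a, a \in s -> exists b, P a b) ->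
  exists h : A -> B, forall a, a \in s -> P a (h a).
Proof.
elim: s => [|a s IH] Ps; first by exists (fun=> b0).
have [|h hP] := IH; first by move=> c cs; apply: Ps; rewrite in_cons cs orbT.
have [b Pab] := Ps a (mem_head _ _).
exists (fun c => if c == a then b else h c) => c; rewrite in_cons.
by have [->|_] := eqVneq c a; last exact: hP.
Qed.

(* Lagrange interpolation: all the weights Lam'(a) are equal. *)
Lemma sum_roots_const_deriv (R : fieldType) (Lam P : {poly R}) (s : seq R) (c :
  R) :
  Lam^`() = c%:P -> c != 0 -> size Lam = (size s).+1 ->
  all (root Lam) s -> uniq s -> (size P <= size s)%N ->
  lead_coef Lam * \sum_(a <- s) P.[a] = c * P`_(size s).-1.
Proof.
move=> dLam c0 sLam rLam us sP.
have LamE : Lam = lead_coef Lam *: \prod_(a <- s) ('X - a%:P).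
  by apply: all_roots_prod_XsubC; rewrite ?uniq_rootsE.
pose Q a := \prod_(b <- rem a s) ('X - b%:P).
have QE a : a \in s -> \prod_(b <- s) ('X - b%:P) = ('X - a%:P) * Q a.
  by move=> sa; rewrite (perm_big _ (perm_to_rem sa)) big_cons.
have Qa a : a \in s -> lead_coef Lam * (Q a).[a] = c.
  move=> sa; rewrite -[RHS](hornerC c a) -dLam {2}LamE (QE a sa) derivZ derivM.
  by rewrite derivXsubC mul1r !hornerE subrr mul0r addr0.
have Qb a b : a \in s -> b \in s -> a != b -> (Q a).[b] = 0.
  move=> sa sb ab; apply/rootP; rewrite root_prod_XsubC.
  by rewrite mem_rem_uniq // inE eq_sym ab sb.
have sQ a : a \in s -> size (Q a) = size s.
  by move=> sa; rewrite size_prod_XsubC size_rem //; case: (s) sa.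
have Qm a : a \in s -> (Q a)`_(size s).-1 = 1.
  by move=> sa; rewrite -(sQ _ sa) -lead_coefE; apply/eqP/monic_prod_XsubC.
pose M := \sum_(a <- s) P.[a] *: Q a.
have sM : (size M <= size s)%N.
  rewrite /M big_seq; apply: (leq_trans (size_sum _ _ _)).
  apply/bigmax_leqP_seq => a _ sa.
  by rewrite (leq_trans (size_scale_leq _ _)) ?sQ.
(* Both sides have size at most that of [s] and agree at all points of [s]; the claim compares their
   coefficients of degree [(size s).-1]. *)
have ME : lead_coef Lam *: M = c *: P.
  apply/eqP; rewrite -subr_eq0; apply/eqP; set N := _ - _.
  apply: (@roots_geq_poly_eq0 _ _ s); rewrite ?uniq_rootsE //.
    apply/allP=> b sb; apply/rootP; rewrite /N !hornerE /M horner_sum.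
    rewrite (perm_big _ (perm_to_rem sb)) big_cons big_seq big1 => [|a].
      by rewrite /= addr0 hornerZ mulrCA Qa // mulrC subrr.
    rewrite mem_rem_uniq // inE => /andP[ab sa].
    by rewrite hornerZ (Qb a b) ?mulr0.
  rewrite /N (leq_trans (size_polyD _ _)) // size_polyN geq_max.
  by rewrite !(leq_trans (size_scale_leq _ _)).
rewrite -coefZ -ME coefZ /M coef_sum; congr (_ * _).
by rewrite big_seq [RHS]big_seq; apply: eq_bigr => a sa;
  rewrite coefZ Qm ?mulr1.
Qed.

Section Trace.

Variables (K : closedFieldType) (L : {poly K}) (q : nat) (a0 : K) (rs : seq K).
Hypothesis (HL : additive_separable L q a0 rs).

Let sL : size L = q.+1. Proof. exact: as_size HL. Qed.

Lemma rs0 : 0 \in rs. Proof. by rewrite (as_root HL) (as_add0 HL). Qed.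

Lemma rsD a b : a \in rs -> b \in rs -> a + b \in rs.
Proof.
rewrite !(as_root HL) => /eqP La /eqP Lb.
have := as_add HL (idfun : {rmorphism K -> K}) a b.
by rewrite !map_poly_id // La Lb addr0 => ->.
Qed.

Lemma rsB a b : a \in rs -> b \in rs -> a - b \in rs.
Proof.
rewrite !(as_root HL) => /eqP La /eqP Lb.
have := LFB HL (idfun : {rmorphism K -> K}) a b.
by rewrite !map_poly_id // La Lb subr0 => ->.
Qed.

Lemma perm_rsD b : b \in rs -> perm_eq [seq a + b | a <- rs] rs.
Proof.
move=> sb; apply: uniq_perm; rewrite ?map_inj_uniq ?(as_uniq HL) //.
  exact: addIr.
move=> c; apply/mapP/idP => [[a sa ->]|sc]; first exact: rsD.
by exists (c - b); rewrite ?subrK ?rsB.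
Qed.

Variable F : function_field (LL_poly L).
Local Notation C := (ffC F).
Local Notation x := (ffX F).
Local Notation y := (ffY F).
Local Notation ev := (eval2 C x y).
Local Notation f := (LL_poly L).
Local Notation "p ^F" := (map_poly C p) (at level 1, format "p ^F") :
  ring_scope.

Definition translations (tau : K -> {rmorphism F -> F}) := forall a, a \in rs ->
  [/\ forall c, tau a (C c) = C c, tau a x = x + C a & tau a y = y].

Lemma translations_exist : exists tau, translations tau.
Proof.
apply: (@seq_choice K _ (idfun : {rmorphism F -> F}) (fun a t =>
  [/\ forall c, t (C c) = C c, t x = x + C a & t y = y]) rs) => a.
rewrite (as_root HL) => /eqP La.
apply: (ff_lift HL); last exact: (ffY_nonconst HL).
by rewrite (as_addR HL) La rmorph0 addr0 ff_eq.
Qed.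

Definition inKY (z : F) := exists r s : {poly K},
  [/\ coprimep r s, s^F.[y] != 0 & z = r^F.[y] / s^F.[y]].

Lemma inKY_frac r s : s^F.[y] != 0 -> inKY (r^F.[y] / s^F.[y]).
Proof.
move=> sy; have s0 : s != 0.
  by apply: contraNneq sy => ->; rewrite rmorph0 horner0.
have g0 : gcdp r s != 0 by rewrite gcdp_eq0 (negPf s0) andbF.
have rE : r^F.[y] = (r %/ gcdp r s)^F.[y] * (gcdp r s)^F.[y].
  by rewrite -hornerM -rmorphM divpK // dvdp_gcdl.
have sE : s^F.[y] = (s %/ gcdp r s)^F.[y] * (gcdp r s)^F.[y].
  by rewrite -hornerM -rmorphM divpK // dvdp_gcdr.
move: sy; rewrite rE sE mulf_eq0 negb_or.
case/andP=> sy gy; exists (r %/ gcdp r s), (s %/ gcdp r s); split=> //.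
  by rewrite coprimep_div_gcd // s0 orbT.
by rewrite -mulf_div divff ?mulr1.
Qed.

Section Tau.

Variable tau : K -> {rmorphism F -> F}.
Hypothesis tauP : translations tau.

Lemma tauM a b z : a \in rs -> b \in rs -> tau b (tau a z) = tau (a + b) z.
Proof.
move=> sa sb; have [aC ax ay] := tauP sa; have [bC bx by_] := tauP sb.
have [cC cx cy] := tauP (rsD sa sb).
apply: (@ff_ext _ _ _ _ C (tau b \o tau a) (tau (a + b))) => [c|||] /=.
- by rewrite aC bC.
- by [].
- by rewrite ax (rmorphD (tau b)) bC bx cx (rmorphD C) [C a + _]addrC addrA.
- by rewrite ay by_ cy.
Qed.

(** After reduction modulo [f], z is a polynomial in x of degree below q with coefficients in K(y).
    Invariance gives its numerator the same value at the q points x + a, so the numerator is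
    constant in x. *)
Lemma tau_fix_KY z : (forall a, a \in rs -> tau a z = z) -> inKY z.
Proof.
have [g [h [h0 ->]]] := ff_frac z => {z}.
have [h' [r [r0 rE]]] := ff_elim HL h0.
have ry0 : r^F.[y] != 0 := nonconst_trans (ffY_nonconst HL F) r0.
have h'0 : ev h' != 0 by apply: contraNneq ry0 => h'0; rewrite -rE h'0 mul0r.
have -> : ev g / ev h = ev (g * h') / r^F.[y].
  by rewrite -rE eval2M [ev h' * _]mulrC -mulf_div divff ?mulr1.
(* The leading coefficient of [f] is a multiple of L(Y), not a unit of K[Y]; hence a
   pseudo-division, whose multiplier goes into the denominator. *)
have := Pdiv.Idomain.divp_eq (g * h') f; set R := modp _ _; set k := scalp _ _.
have sR : (size R <= q)%N.
  by rewrite -ltnS -(size_LL HL) Pdiv.Idomain.ltn_modp -size_poly_eq0 (size_LL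
    HL).
move=> /(congr1 ev);
  rewrite -mul_polyC eval2D !eval2M eval2_LL ff_eq subrr mulr0 add0r.
rewrite eval2C -eval2M; set m := lead_coef f ^+ k => mE.
have my0 : m^F.[y] != 0.
  apply: nonconst_trans (ffY_nonconst HL F) _.
  by rewrite expf_neq0 // lead_coef_eq0 -size_poly_eq0 (size_LL HL).
have zE : ev (g * h') / r^F.[y] = ev R / (m * r)^F.[y].
  by rewrite -mE (rmorphM (map_poly C)) hornerM -mulf_div divff ?mul1r.
rewrite zE => fixz; have mry0 : (m * r)^F.[y] != 0.
  by rewrite (rmorphM (map_poly C)) hornerM mulf_neq0.
pose P := map_poly (horner_eval y \o map_poly C) R.
have PE a : a \in rs -> P.[x + C a] = P.[x].
  move=> sa; have [aC ax ay] := tauP sa; rewrite -!(eval2_map C _ y).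
  have := fixz a sa; rewrite fmorph_div (eval2_rmorph _ _ _ aC) ax ay.
  have -> : tau a (m * r)^F.[y] = (m * r)^F.[y].
    by rewrite -(eval2C C x) (eval2_rmorph _ _ _ aC) ay !eval2C.
  by move/(mulIf (invr_neq0 mry0)).
have : P - P.[x]%:P = 0.
  apply: (@roots_geq_poly_eq0 _ _ [seq x + C a | a <- rs]).
  - apply/allP=> _ /mapP[a sa ->]; apply/rootP.
    by rewrite !hornerE PE ?subrr.
  - rewrite map_inj_uniq ?(as_uniq HL) // => a b /addrI.
    exact: fmorph_inj.
  rewrite size_map (as_card HL) (leq_trans (size_polyD _ _)) // size_polyN.
  rewrite geq_max (leq_trans (size_poly _ _)) // (leq_trans (size_polyC_leq1
    _)) //.
  by rewrite ltnW // ltnW // (as_q HL).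
move/eqP; rewrite subr_eq0 => /eqP/(congr1 (fun p : {poly F} => p`_0)).
rewrite coefC eqxx coef_map /= => P0.
rewrite (eval2_map C x y) -/P -P0 /horner_eval.
exact: inKY_frac.
Qed.

Definition trace z := \sum_(a <- rs) tau a z.

Lemma trace_KY z : inKY (trace z).
Proof.
apply: tau_fix_KY => b sb; rewrite /trace rmorph_sum /=.
rewrite -[RHS](perm_big _ (perm_rsD sb)) big_map.
by rewrite big_seq [RHS]big_seq; apply: eq_bigr => a sa; rewrite tauM.
Qed.

Lemma traceD z w : trace (z + w) = trace z + trace w.
Proof. by rewrite /trace -big_split; apply: eq_bigr => a _;
  rewrite rmorphD. Qed.

Lemma traceC c z : trace (C c * z) = C c * trace z.
Proof.
rewrite /trace mulr_sumr big_seq [RHS]big_seq; apply: eq_bigr => a sa.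
by have [aC _ _] := tauP sa; rewrite rmorphM aC.
Qed.

(** The conjugates x + a are the roots of L(T - x), whose derivative is the constant [a0], so
    Lagrange interpolation retains only the coefficient of T^(q-1). *)
Lemma trace_X k : (k < q)%N -> trace (x ^+ k) = C (a0 / lead_coef L) * (k ==
  q.-1)%:R.
Proof.
move=> kq; pose Lam := L^F \Po ('X - x%:P).
have sLam : size Lam = q.+1.
  by rewrite size_comp_poly2 ?size_XsubC // size_map_poly sL.
have lLam : lead_coef Lam = C (lead_coef L).
  by rewrite lead_coef_comp ?size_XsubC // lead_coefXsubC expr1n mulr1
    lead_coef_map.
have l0 : C (lead_coef L) != 0.
  by rewrite fmorph_eq0 lead_coef_eq0 -size_poly_eq0 sL.
have := @sum_roots_const_deriv _ Lam 'X^k [seq x + C a | a <- rs] (C a0).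
rewrite size_map (as_card HL) sLam lLam big_map => H.
apply: (mulfI l0); rewrite mulrA -rmorphM mulrCA mulfV ?mulr1; last first.
  by move: l0; rewrite fmorph_eq0.
have -> : (k == q.-1)%:R = 'X^k`_(q.-1) :> F by rewrite coefXn eq_sym.
rewrite -H //.
- congr (_ * _); rewrite /trace big_seq [RHS]big_seq; apply: eq_bigr => a sa.
  by have [_ ax _] := tauP sa; rewrite rmorphXn /= ax hornerXn.
- by rewrite deriv_comp (deriv_LF HL) comp_polyC derivB derivX derivC subr0
  mulr1.
- by rewrite fmorph_eq0 (as_a0 HL).
- apply/allP=> _ /mapP[a sa ->]; apply/rootP; rewrite horner_comp !hornerE.
  rewrite addrC addKr horner_map.
  by move: sa; rewrite (as_root HL) => /eqP ->; rewrite rmorph0.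
- by rewrite map_inj_uniq ?(as_uniq HL) // => a b /addrI; apply: fmorph_inj.
- by rewrite size_polyXn.
Qed.

End Tau.

End Trace.

Lemma poly_splitX (R : nzRingType) (p : {poly R}) :
  exists r, p = r * 'X + (p.[0])%:P.
Proof.
elim/poly_ind: p => [|r c _]; first by exists 0; rewrite horner0 mul0r addr0.
by exists r; rewrite hornerMXaddC mulr0 add0r.
Qed.

(** * Vanishing of the traces of holomorphic differentials *)

Section Vanish.

Variables (K : closedFieldType) (L : {poly K}) (q : nat) (a0 : K) (rs : seq K).
Hypothesis (HL : additive_separable L q a0 rs).

Let q_gt0 : (0 < q)%N. Proof. by have := as_q HL; case: (q). Qed.
Let sL : size L = q.+1. Proof. exact: as_size HL. Qed.

Variable F : function_field (LL_poly L).
Local Notation C := (ffC F).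
Local Notation x := (ffX F).
Local Notation y := (ffY F).
Local Notation "p ^F" := (map_poly C p) (at level 1, format "p ^F") :
  ring_scope.

Variables (tau : K -> {rmorphism F -> F}) (D : F -> F).
Hypothesis tauP : translations rs tau.
Hypotheses (dD : twisted_derivation C id D)
  (Dx : D x = - (L^F.[x] / L^F.[y])) (Dy : D y = 1).

Local Notation trace := (trace rs tau).

Section AtInfinity.

Variable beta : K.
Hypothesis Lb : L.[beta] = 0.

Local Notation O := (local_ring C y x^-1 beta 0).

Let P : place C x^-1 O. Proof. exact: (inf_place HL (ffswap F) Lb). Qed.
Let S : smooth_point C y x^-1 beta 0.
Proof. exact: (inf_smooth HL (ffswap F) Lb). Qed.
Let x0 : x != 0. Proof. exact: (ffY_neq0 HL (ffswap F)). Qed.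

(** With the uniformizer 1/x one has D(1/x) = L(x)^2 / x^2 = x^(2(q-1)) revL(1/x)^2; this is the
    origin of the exponent. *)
Lemma xinf_deriv z : O z -> O (D z / x ^+ (2 * q.-1)).
Proof.
apply: (local_deriv S dD); first by rewrite Dy div1r -exprVn; apply: (plX P);
  apply: (pl_t P).
have -> : D x^-1 / x ^+ (2 * q.-1) = (revL L q)^F.[x^-1] ^+ 2.
  have LyV : L^F.[y]^-1 = L^F.[x] by rewrite -(mulr1_eq (ff_eq F)) invrK.
  rewrite (deriv_V _ dD) Dx LyV !mulNr opprK -expr2 (horner_revL HL) //.
  rewrite [in LHS]exprMn -exprM -mulrA -invfM -exprD.
  have -> : (2 + 2 * q.-1 = q * 2)%N by rewrite -mulnS prednK // mulnC.
  by rewrite mulrAC mulfV ?mul1r // expf_neq0.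
by apply: (plX P); apply: (pl_horner P); apply: (pl_t P).
Qed.

Lemma xinf_y : O ((y - C beta) / x^-1).
Proof.
have := @local_tdiv _ _ _ _ _ _ _ S ('X - beta%:P%:P).
rewrite rmorph0 subr0 !eval2B !eval2X !eval2CC; apply.
exact: subrr.
Qed.

(** Every translation fixes the point x = oo, since 1/(x + a) is 1/x times the unit (1 + a/x)^-1:
    the point is totally ramified over K(y). *)
Lemma xinf_tau a z : a \in rs -> O z -> O (tau a z).
Proof.
move=> sa; have [aC ax ay] := tauP sa; apply: (local_rmorph S) => //.
  by rewrite ay rmorph0 subr0; apply: xinf_y.
rewrite rmorph0 !subr0 fmorphV ax invrK mulrC.
have -> : x / (x + C a) = (C 1 + x^-1 * C a)^-1.
  rewrite rmorph1; have -> : x + C a = x * (1 + x^-1 * C a).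
    by rewrite mulrDr mulr1 mulrA mulfV // mul1r.
  by rewrite invfM mulrA mulfV // mul1r.
by apply: (pl_unitC P); [exact: oner_neq0 | exact: pl_C P _].
Qed.

Lemma xinf_trace0 z : O z -> O (trace z).
Proof. by move=> Oz; apply: (pl_sum P) => a sa; apply: xinf_tau. Qed.

(** Functions with leading term exactly x^k and regular trace. For k < q the power x^k itself has
    constant trace; for larger k the factor x^q is replaced by the normalized invariant L(x). *)
Lemma xinf_trace_lead k : (k <= 2 * q.-1)%N -> exists phi,
  O (trace phi) /\ O ((phi / x ^+ k - 1) * x).
Proof.
move=> kq; have [kq'|qk] := ltnP k q.
  exists (x ^+ k); rewrite divff ?expf_neq0 // subrr mul0r (trace_X HL) //.
  split; last exact: pl0 P.
  rewrite -(rmorph_nat C) -rmorphM; exact: pl_C P _.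
(* The bound on [k] gives r <= q - 2, exactly the range in which x^r has trace 0. *)
pose r := (k - q)%N; have rq : (r < q.-1)%N.
  by rewrite /r ltn_subLR // (leq_ltn_trans kq) // mul2n -addnn ltn_add2r
    prednK.
have lc0 : C (lead_coef L) != 0.
  by rewrite fmorph_eq0 lead_coef_eq0 -size_poly_eq0 sL.
exists (x ^+ r * ((C (lead_coef L))^-1 * L^F.[x])); split.
  have -> : trace (x ^+ r * ((C (lead_coef L))^-1 * L^F.[x]))
      = trace (x ^+ r) * ((C (lead_coef L))^-1 * L^F.[x]).
    rewrite /trace mulr_suml big_seq [RHS]big_seq; apply: eq_bigr => a sa.
    have [aC ax _] := tauP sa; rewrite rmorphM (rmorphM (tau a)) fmorphV aC.
    congr (_ * (_ * _)).
    rewrite -(eval2P C x y) (eval2_rmorph _ _ _ aC) ax eval2P (as_addR HL).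
    by move: sa; rewrite (as_root HL) => /eqP ->; rewrite rmorph0 addr0 eval2P.
  rewrite (trace_X HL) //; last by rewrite (leq_trans rq) // leq_pred.
  by rewrite (ltn_eqF rq) mulr0 mul0r; apply: pl0 P.
have [r' rE] := poly_splitX (revL L q).
have -> : (x ^+ r * ((C (lead_coef L))^-1 * L^F.[x]) / x ^+ k - 1) * x =
   (C (lead_coef L))^-1 * r'^F.[x^-1].
  rewrite (horner_revL HL) // -(subnK qk) -/r exprD rE (revL0 HL).
  rewrite rmorphD rmorphM /= map_polyX map_polyC hornerMXaddC.
  move: (expf_neq0 r x0) (expf_neq0 q x0) (r'^F.[x^-1]).
  move: (x ^+ r) (x ^+ q) => A B A0 B0 z.
  by field; rewrite x0 lc0 A0 B0.
rewrite -fmorphV; apply: (pl_M P) (pl_C P _) _; apply: (pl_horner P);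
  exact: pl_t P.
Qed.

(* The different of F / K(y) at a point x = oo has exponent 2 (q - 1). *)
Lemma xinf_trace k z : (k <= 2 * q.-1)%N -> O (z / x ^+ k) -> O (trace z).
Proof.
elim: k z => [|k IH] z kq; first by rewrite divr1; apply: xinf_trace0.
move=> Oz; have [c] := pl_res P Oz; rewrite invrK => Oc.
have [phi [Op Ol]] := xinf_trace_lead kq.
(* Subtracting the leading term lowers the pole order by one, and the subtracted part has regular
   trace. *)
have -> : z = (z - C c * phi) + C c * phi by rewrite subrK.
rewrite (traceD rs tau) (traceC tauP); apply: (pl_D P); last first.
  by apply: (pl_M P) (pl_C P _) _.
apply: IH; first exact: ltnW.
have -> : (z - C c * phi) / x ^+ k =
    (z / x ^+ k.+1 - C c) * x - C c * ((phi / x ^+ k.+1 - 1) * x).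
  by rewrite exprS; field; rewrite x0 expf_neq0.
by apply: (plB P) => //; apply: (pl_M P) (pl_C P _) _.
Qed.

End AtInfinity.

(** Otherwise the nonzero constant r(d) = (y - d) (T s1(y) - r1(y)) would be divisible by [t]. For
    coprime [r] and [s] this excludes a root of the denominator. *)
Lemma no_pole t O d r s T : place C t O -> O ((y - C d) / t) -> O T ->
  T * s^F.[y] = r^F.[y] -> s.[d] = 0 -> r.[d] = 0.
Proof.
move=> P Oy OT E sd; apply/eqP/negPn/negP => rd; apply: (pl_tV P).
have t0 := pl_t_neq0 P.
have Oy' : O y.
  have -> : y = (y - C d) / t * t + C d by rewrite divfK ?subrK.
  by apply: (pl_D P) (pl_C P _); apply: (pl_M P) Oy (pl_t P).
have /factor_theorem[s1 sE] : root s d by apply/rootP.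
have /factor_theorem[r1 rE] : root (r - (r.[d])%:P) d.
  by apply/rootP; rewrite !hornerE subrr.
have ry : r^F.[y] = r1^F.[y] * (y - C d) + C r.[d].
  have -> : r = r1 * ('X - d%:P) + (r.[d])%:P by rewrite -rE subrK.
  rewrite rmorphD rmorphM /= map_polyXsubC map_polyC !hornerE /= subrr mulr0
    add0r.
  by [].
have sy : s^F.[y] = s1^F.[y] * (y - C d).
  by rewrite sE rmorphM /= map_polyXsubC hornerM hornerXsubC.
have rd0 : C r.[d] != 0 by rewrite fmorph_eq0.
have -> : t^-1 = C r.[d]^-1 * ((y - C d) / t * (T * s1^F.[y] - r1^F.[y])).
  have Er : C r.[d] = (y - C d) * (T * s1^F.[y] - r1^F.[y]).
    transitivity (T * (s1^F.[y] * (y - C d)) - r1^F.[y] * (y - C d));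
      last by ring.
    by rewrite -sy E ry; ring.
  by rewrite mulrAC -Er fmorphV mulrA mulVf ?mul1r.
apply: (pl_M P) (pl_C P _) _; apply: (pl_M P) Oy _; apply: (plB P).
  by apply: (pl_M P) OT _; apply: (pl_horner P).
exact: (pl_horner P).
Qed.

(** The commutator is a twisted derivation killing [x] and [y], because L(x), hence D x, is
    invariant. *)
Lemma tau_D a z : a \in rs -> D (tau a z) = tau a (D z).
Proof.
move=> sa; have [aC ax ay] := tauP sa; have [dA dM dC] := dD.
apply/eqP; rewrite -subr_eq0; apply/eqP.
have tL : tau a L^F.[x] = L^F.[x].
  rewrite -(eval2P C x y) (eval2_rmorph _ _ _ aC) ax ay !eval2P (as_addR HL).
  by move: sa; rewrite (as_root HL) => /eqP ->; rewrite rmorph0 addr0.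
have tLy : tau a L^F.[y] = L^F.[y].
  by rewrite -(eval2C C x y) (eval2_rmorph _ _ _ aC) ay !eval2C.
apply: (@tder_uniq _ _ F (tau a) (fun z => D (tau a z) - tau a (D z))).
- split=> [b c|b c|c].
  + by rewrite rmorphD !dA rmorphD; ring.
  + by rewrite rmorphM dM dM rmorphD !rmorphM /=; ring.
  by rewrite aC dC rmorph0 subrr.
- by rewrite ax dA dC addr0 Dx rmorphN fmorph_div tL tLy subrr.
- by rewrite ay Dy rmorph1 subrr.
Qed.

Lemma trace_holomorphic u v i j : L^F.[u] * L^F.[v] = 1 ->
  (i <= q - 2)%N -> (j <= q - 2)%N ->
  trace (u ^+ i * v ^+ j * (D u / L^F.[u])) = 0.
Proof.
move=> uv iq jq; set w := _ * _; set T := trace w.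
have holo t O e a : a \in rs -> place C t O -> (forall z, O z -> O (D z / e)) ->
    O (tau a w / e).
  move=> sa P De; have [aC ax ay] := tauP sa.
  have tL z : tau a L^F.[z] = L^F.[tau a z].
    by rewrite -(eval2C C x z) (eval2_rmorph _ _ _ aC) !eval2C.
  rewrite /w !(rmorphM (tau a)) !(rmorphXn (tau a)) fmorphV tL -(tau_D _ sa).
  apply: (holomorphic HL P dD De) => //.
  by rewrite -!tL -rmorphM uv rmorph1.
have holoT t O e : place C t O -> (forall z, O z -> O (D z / e)) -> O (T / e).
  move=> P De; rewrite /T /trace mulr_suml; apply: (pl_sum P) => a sa.
  exact: holo P De.
have [r [s [rs_cop sy TE]]] := trace_KY HL tauP w.
have Tsr : T * s^F.[y] = r^F.[y] by rewrite /T TE divfK.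
have s1 : size s == 1%N.
  apply/negPn/negP => /closed_rootP[d /rootP sd].
  suff rd : r.[d] = 0.
    have := coprimep_root rs_cop (introT rootP rd); by rewrite sd eqxx.
  (* Above a root of [L] the trace is examined at the ramified point x = oo, through [xinf_trace].
     Above any other [d] there is an affine point, where all conjugates are regular. *)
  have [Ld|Ld] := eqVneq L.[d] 0.
    apply: (no_pole (inf_place HL (ffswap F) Ld) (xinf_y Ld) _ Tsr sd).
    apply: (xinf_trace Ld (leqnn _)).
    exact: (holomorphic HL (inf_place HL (ffswap F) Ld) dD (xinf_deriv Ld)).
  have [c cd] : exists c, L.[c] * L.[d] = 1.
    have : size (L - (L.[d]^-1)%:P) != 1%N.
      rewrite size_polyDl ?sL ?size_polyN; first by case: (q) q_gt0.
      by rewrite (leq_ltn_trans (size_polyC_leq1 _)).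
    case/closed_rootP=> c /rootP; rewrite !hornerE => /eqP.
    by rewrite subr_eq0 => /eqP Lc; exists c; rewrite Lc mulVf.
  have P := local_place (affine_smooth HL F cd).
  apply: (no_pole P _ _ Tsr sd).
    by rewrite divff ?(sp_t (affine_smooth HL F cd)) //; exact: pl1 P.
  have := holoT _ _ 1 P; rewrite divr1; apply=> z Oz; rewrite divr1.
  exact: (affine_deriv HL dD Dx Dy cd).
have [R TR] : exists R : {poly K}, T = R^F.[y].
  have /size_poly1P[c c0 sE] := s1; exists (c^-1 *: r).
  rewrite map_polyZ hornerZ /= -Tsr sE map_polyC hornerC /= mulrCA -rmorphM.
  by rewrite mulVf // rmorph1 mulr1.
(* The trace is now a polynomial R(y). Regularity of R dy at y = oo means that y^2 R(y) has no pole
   at the point (0, oo), which is impossible for nonzero [R]. *)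
have L0 := as_add0 HL; have P := inf_place HL F L0.
have y0 := ffY_neq0 HL F; have OT := holoT _ _ _ P (inf_deriv HL dD Dx Dy L0).
rewrite TR; have [->|R0] := eqVneq R 0; first by rewrite rmorph0 horner0.
pose n := (size R).-1;
  have nE : size R = n.+1 by rewrite prednK // size_poly_gt0.
have [r' rE] := poly_splitX (rev_poly n R).
have lR : (rev_poly n R).[0] = lead_coef R.
  by rewrite horner_coef0 coef_poly /= subn0 lead_coefE.
have Rt : R^F.[y] = y ^+ n * (C (lead_coef R) + y^-1 * r'^F.[y^-1]).
  have := rev_conv C y0 (_ : (size R <= n.+1)%N); rewrite nE => /(_ (leqnn _)).
  rewrite rE lR rmorphD rmorphM /= map_polyX map_polyC hornerMXaddC addrC.
  rewrite [_ * y^-1]mulrC => ->.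
  by rewrite mulrA -exprMn mulfV // expr1n mul1r.
have OrV : local_ring C x y^-1 0 0 (C (lead_coef R) + y^-1 * r'^F.[y^-1])^-1.
  apply: (pl_unitC P); first by rewrite lead_coef_eq0.
  by apply: (pl_horner P); apply: (pl_t P).
case: (pl_tV P).
have -> : y^-1^-1 = y^-1 ^+ n.+1 *
    (T / y^-1 ^+ 2 * (C (lead_coef R) + y^-1 * r'^F.[y^-1])^-1).
  rewrite TR Rt; have : R^F.[y] != 0 := nonconst_trans (ffY_nonconst HL F) R0.
  rewrite Rt mulf_eq0 negb_or => /andP[yn0]; move: (_ + _) => rho rho0.
  rewrite exprS exprVn; move: yn0; move: (y ^+ n) => Y Y0.
  by field; rewrite y0 Y0 rho0 oner_neq0.
apply: (pl_M P); first by apply: (plX P); apply: (pl_t P).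
exact: (pl_M P).
Qed.

End Vanish.

(** * Separating the conjugates of (s x, s y) *)

Section Points.

Variables (K : closedFieldType) (L : {poly K}) (q : nat) (a0 : K) (rs : seq K).
Hypothesis (HL : additive_separable L q a0 rs).

Variable F : function_field (LL_poly L).
Local Notation C := (ffC F).
Local Notation x := (ffX F).
Local Notation y := (ffY F).
Local Notation "p ^F" := (map_poly C p) (at level 1, format "p ^F") :
  ring_scope.

Lemma aut_LL (s : {rmorphism F -> F}) : (forall c, s (C c) = C c) ->
  L^F.[s x] * L^F.[s y] = 1.
Proof.
move=> sC; rewrite -(rmorph1 s) -(ff_eq F) rmorphM.
by rewrite -(eval2P C x y) -(eval2C C x y) !(eval2_rmorph _ _ _ sC) eval2P
  eval2C.
Qed.

Variable tau : K -> {rmorphism F -> F}.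
Hypothesis tauP : translations rs tau.

Lemma tau0 z : tau 0 z = z.
Proof.
have [aC ax ay] := tauP (rs0 HL).
apply: (@ff_ext _ _ F _ C (tau 0) (idfun : {rmorphism F -> F})) => //.
by rewrite ax rmorph0 addr0.
Qed.

Variable s : {rmorphism F -> F}.
Hypotheses (sC : forall c, s (C c) = C c) (s_surj : forall z, exists z', z = s
  z').

Let uv : L^F.[s x] * L^F.[s y] = 1. Proof. exact: aut_LL. Qed.

(** If D (s x) vanished, so would D (s y) by the equation of the curve; then [D] would vanish on the
    image of [s], which is the whole field and contains [y]. *)
Lemma aut_deriv_neq0 D : twisted_derivation C id D -> D y = 1 ->
  D (s x) / L^F.[s x] != 0.
Proof.
move=> dD Dy; have [dA dM dC] := dD.
have [Lu0 Lv0] : L^F.[s x] != 0 /\ L^F.[s y] != 0.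
  by apply/andP; rewrite -negb_or -mulf_eq0 uv oner_neq0.
rewrite mulf_neq0 ?invr_neq0 //; apply/eqP => Du.
have /eqP : D (L^F.[s x] * L^F.[s y]) = 0 by rewrite uv -(rmorph1 C) dC.
have dL z : D L^F.[z] = C a0 * D z.
  by rewrite (deriv_horner _ _ dD) (as_deriv HL) map_polyC hornerC.
rewrite dM !dL Du mulr0 mul0r add0r !mulf_eq0 fmorph_eq0 (negPf Lu0).
rewrite (negPf (as_a0 HL)) /= => /eqP Dv.
have Ds z : D (s z) = 0.
  apply: (@tder_uniq _ _ F s (fun z => D (s z))) => //.
  by split=> [b c|b c|c]; rewrite ?rmorphD ?dA ?rmorphM ?dM ?sC ?dC.
have [z yE] := s_surj y; have /eqP := Dy; rewrite yE Ds eq_sym.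
by rewrite oner_eq0.
Qed.

Lemma tau_fix_aut a : a \in rs -> tau a (s x) = s x -> tau a (s y) = s y -> a =
  0.
Proof.
move=> sa ux uy; have [aC ax ay] := tauP sa.
have tz z : tau a (s z) = s z.
  apply: (@ff_ext _ _ F _ C (tau a \o s) s) => //= c.
  by rewrite sC aC.
have [z xE] := s_surj x; have := tz z; rewrite -xE ax => /eqP.
by rewrite -subr_eq0 addrC addKr fmorph_eq0 => /eqP.
Qed.

(** The weights are the conjugates of du / L(u) divided by dy, for u = s x. The coefficients of [G]
    and [H] are not conjugated, so the sum is an F-linear combination of vanishing traces and [G],
    [H] may have coefficients in [F]. *)
Lemma points_sum (G H : {poly F}) : (size G <= q.-1)%N -> (size H <= q.-1)%N ->
  exists w : K -> F, w 0 != 0 /\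
    \sum_(a <- rs) w a * (G.[tau a (s x)] * H.[tau a (s y)]) = 0.
Proof.
move=> sG sH; have [D [dD Dx Dy]] := ff_derivation HL F.
exists (fun a => tau a (D (s x) / L^F.[s x])); split.
  by rewrite fmorph_eq0 aut_deriv_neq0.
have q2 : (q.-1 = (q - 2).+1)%N by have := as_q HL; case: (q) => [|[|n]] //;
  rewrite subn2.
have -> : \sum_(a <- rs) tau a (D (s x) / L^F.[s x]) *
     (G.[tau a (s x)] * H.[tau a (s y)]) =
   \sum_(a <- rs) \sum_(i < q.-1) \sum_(j < q.-1) G`_i * H`_j *
      tau a (s x ^+ i * s y ^+ j * (D (s x) / L^F.[s x])).
  apply: eq_bigr => a _;
    rewrite (horner_coef_wide _ sG) (horner_coef_wide _ sH).
  rewrite mulr_suml mulr_sumr; apply: eq_bigr => i _.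
  rewrite mulr_sumr mulr_sumr; apply: eq_bigr => j _.
  rewrite (rmorphM (tau a) (s x ^+ i * s y ^+ j)) (rmorphM (tau a) (s x ^+ i)).
  rewrite !(rmorphXn (tau a)).
  move: (tau a (_ / _)) (tau a (s x) ^+ i) (tau a (s y) ^+ j) => A B B'; ring.
rewrite exchange_big big1 //= => i _; rewrite exchange_big big1 //= => j _.
rewrite -mulr_sumr [X in _ * X](trace_holomorphic HL tauP dD Dx Dy uv) ?mulr0
  //.
  by rewrite -ltnS -q2.
by rewrite -ltnS -q2.
Qed.

Lemma fixed_coordinate :
  (forall a, a \in rs -> tau a (s x) = s x) \/
  (forall a, a \in rs -> tau a (s y) = s y).
Proof.
have [/allP ux|/allPn[a1 sa1 ux1]] := boolP (all (fun a => tau a (s x) == s x)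
  rs).
  by left=> a /ux/eqP.
have [/allP uy|/allPn[a2 sa2 uy2]] := boolP (all (fun a => tau a (s y) == s y)
  rs).
  by right=> a /uy/eqP.
pose V := rem 0 rs.
have VE a : (a \in V) = (a != 0) && (a \in rs).
  by rewrite mem_rem_uniq ?(as_uniq HL) // inE.
have sV : size V = q.-1 by rewrite size_rem ?(as_card HL) // (rs0 HL).
have a1V : a1 \in V by rewrite VE sa1 andbT; apply: contraNneq ux1 => ->;
  rewrite tau0.
have a2V : a2 \in V by rewrite VE sa2 andbT; apply: contraNneq uy2 => ->;
  rewrite tau0.
(* Conjugates in [A] are separated from (s x, s y) by their first coordinate, the others by their
   second. Both classes must be nonempty, so that [G] and [H] have degree at most q - 2. *)
have [A [Ax Ay hA hnA]] : exists A : pred K,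
    [/\ forall a, a \in V -> A a -> tau a (s x) != s x,
        forall a, a \in V -> ~~ A a -> tau a (s y) != s y,
        has A V & has (predC A) V].
  have [/allP Vx|/allPn[a3 Va3 ux3]] := boolP (all (fun a => tau a (s x) != s
    x) V).
    (* First coordinates would separate everything, but [G] would then have degree q - 1. The
       conjugate [a2], which moves s y, is assigned to [H]; something remains for [G] because q >
       2. *)
    exists (predC1 a2); split.
    - by move=> a Va _; apply: Vx.
    - by move=> a Va /negPn/eqP ->.
    - apply/negPn; rewrite -all_predC; apply/allP=> Va.
      have /uniq_leq_size : uniq V by rewrite rem_uniq ?(as_uniq HL).
      move=> /(_ [:: a2]) => H; have /H : {subset V <= [:: a2]}.
        by move=> a /Va; rewrite /= negbK inE.
      by rewrite sV /= leqNgt; have := as_q HL; case: (q) => [|[|[|n]]].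
    - by apply/hasP; exists a2 => //=; rewrite negbK.
  exists (fun a => tau a (s x) != s x); split => //.
  - move=> a; rewrite VE => /andP[an0 sa] /negPn/eqP ux.
    by apply: contraNneq an0 => uy; apply/eqP/tau_fix_aut.
  - by apply/hasP; exists a1.
  - by apply/hasP; exists a3.
pose G := \prod_(a <- [seq tau a (s x) | a <- V & A a]) ('X - a%:P).
pose H := \prod_(a <- [seq tau a (s y) | a <- V & predC A a]) ('X - a%:P).
have cV : (count A V + count (predC A) V = q.-1)%N by rewrite count_predC.
have [||w [w0]] := @points_sum G H.
- by rewrite size_prod_XsubC size_map size_filter -cV -addn1 leq_add2l
  -has_count.
- by rewrite size_prod_XsubC size_map size_filter -cV -add1n leq_add2r
  -has_count.
(* All terms but the one at a = 0 vanish, and that one is a product of nonzero factors. *)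
rewrite (perm_big _ (perm_to_rem (rs0 HL))) big_cons /= -/V big_seq big1 => [|a
  Va].
  rewrite addr0 !tau0 => /eqP; rewrite !mulf_eq0 (negPf w0) /=.
  case/orP=> /eqP/rootP; rewrite root_prod_XsubC => /mapP[a].
    by rewrite mem_filter => /andP[Aa Va] /esym/eqP;
      rewrite (negPf (Ax a Va Aa)).
  by rewrite mem_filter => /andP[Aa Va] /esym/eqP; rewrite (negPf (Ay a Va Aa)).
have [Aa|Aa] := boolP (A a).
  have -> : G.[tau a (s x)] = 0.
    by apply/rootP; rewrite root_prod_XsubC; apply/mapP; exists a;
      rewrite // mem_filter Aa.
  by rewrite mul0r mulr0.
have -> : H.[tau a (s y)] = 0.
  by apply/rootP; rewrite root_prod_XsubC; apply/mapP; exists a;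
    rewrite // mem_filter /= Aa.
by rewrite !mulr0.
Qed.

Lemma aut_inKY : inKY (s x) \/ inKY (s y).
Proof. by have [fx|fy] := fixed_coordinate; [left|right];
  apply: (tau_fix_KY HL tauP). Qed.

End Points.

(** * Moebius transformations *)

Section RationalInverse.

Variable K : fieldType.

(** The homogenization l^d g(k/l) of [g] in formal degree [d]. *)
Definition homog (d : nat) (g k l : {poly K}) :=
  \sum_(i < d.+1) g`_i *: (k ^+ i * l ^+ (d - i)).

Lemma homog_modl d g k l : l %| homog d g k l - g`_d *: k ^+ d.
Proof.
rewrite /homog big_ord_recr /= subnn expr0 mulr1 addrK.
apply: (big_ind (fun u => l %| u)) => [|u v|i _].
- exact: dvdp0.
- exact: dvdp_add.
have -> : (d - i = (d - i).-1.+1)%N by rewrite prednK // subn_gt0.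
by rewrite -mul_polyC exprS mulrA dvdp_mull // dvdp_mulr.
Qed.

Lemma homog_modk d g k l : k %| homog d g k l - g`_0 *: l ^+ d.
Proof.
rewrite /homog big_ord_recl /= expr0 mul1r subn0 addrC addKr.
apply: (big_ind (fun u => k %| u)) => [|u v|i _].
- exact: dvdp0.
- exact: dvdp_add.
by rewrite -mul_polyC /bump /= exprS -mulrA dvdp_mull // dvdp_mulr.
Qed.

Lemma horner_homog (F : fieldType) (C : {rmorphism K -> F}) d
    (g k l : {poly K}) (z : F) :
  (size g <= d.+1)%N -> (map_poly C l).[z] != 0 ->
  (map_poly C (homog d g k l)).[z] = (map_poly C l).[z] ^+ d *
     (map_poly C g).[(map_poly C k).[z] / (map_poly C l).[z]].
Proof.
move=> sg lz;
  rewrite [(map_poly C g).[_] in RHS](@horner_coef_wide _ d.+1) ?size_map_poly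
    // mulr_sumr.
rewrite /homog rmorph_sum horner_sum; apply: eq_bigr => i _ /=.
rewrite map_polyZ rmorphM !rmorphXn /= hornerZ hornerM !horner_exp coef_map /=.
have -> : (map_poly C l).[z] ^+ d =
    (map_poly C l).[z] ^+ (d - i) * (map_poly C l).[z] ^+ i.
  by rewrite -exprD subnK // -ltnS.
rewrite exprMn exprVn; have := expf_neq0 i lz.
by move: (_.[z] ^+ i) (_ ^+ (d - i)) => u w u0; field.
Qed.

(* The rational root theorem for the root k / l of g - 'X h over K['X]. *)
Lemma homog_eq_size d (g h k l : {poly K}) :
  coprimep g h -> coprimep k l -> maxn (size g) (size h) = d.+1 ->
  homog d g k l = 'X * homog d h k l -> (size k <= 2)%N /\ (size l <= 2)%N.
Proof.
move=> gh kl dE E.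
have size_lin (a b : K) (m : {poly K}) : (a != 0) || (b != 0) ->
    m %| a%:P - 'X * b%:P -> (size m <= 2)%N.
  move=> ab ma; apply: leq_trans (dvdp_leq _ ma) _.
    apply: contraTneq ab => /polyP ab0; have := ab0 0%N; have := ab0 1%N.
    rewrite !coefB !coefC coefXM coefC coefXM coefC /= sub0r subr0.
    by move/eqP; rewrite oppr_eq0 => /eqP -> ->; rewrite eqxx.
  rewrite (leq_trans (size_polyD _ _)) // size_polyN geq_max.
  rewrite (leq_trans (size_polyC_leq1 _)) // mulrC (leq_trans (size_polyMleq _
    _)) //.
  by rewrite size_polyX addn2 /= ltnS size_polyC_leq1.
have main (m n : {poly K}) e a b : coprimep n m ->
    m %| homog d g k l - a *: n ^+ e -> m %| homog d h k l - b *: n ^+ e ->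
    m %| a%:P - 'X * b%:P.
  move=> nm ma mb; rewrite -(Gauss_dvdpl _ (_ : coprimep m (n ^+ e)));
    last first.
    by rewrite coprimep_sym coprimep_expl.
  have -> : (a%:P - 'X * b%:P) * n ^+ e = 'X * (homog d h k l - b *: n ^+ e)
     - (homog d g k l - a *: n ^+ e).
    by rewrite E -!mul_polyC; ring.
  by rewrite dvdp_sub // dvdp_mull.
(* Modulo [l] only the terms in k^d survive, and [l] is prime to [k], so it divides the linear
   polynomial g_d - X h_d, nonzero because [g] or [h] has degree d. For [k] the constant
   coefficients are used; they are not both zero as [g] and [h] are coprime. *)
split; last first.
  apply: (size_lin g`_d h`_d); last by apply: main kl _ _; apply: homog_modl.
  have : (size g == d.+1) || (size h == d.+1).
    by rewrite -dE /maxn; case: ifP; rewrite eqxx ?orbT.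
  case/orP=> /eqP sE; apply/orP; [left|right].
    by rewrite -[d]/(d.+1.-1) -sE -lead_coefE lead_coef_eq0 -size_poly_eq0 sE.
  by rewrite -[d]/(d.+1.-1) -sE -lead_coefE lead_coef_eq0 -size_poly_eq0 sE.
apply: (size_lin g`_0 h`_0).
  rewrite -negb_and; apply/negP => /andP[/eqP g0 /eqP h0].
  have := coprimep_root gh (_ : root g 0); rewrite !rootE !horner_coef0 g0 h0.
  by rewrite eqxx => /(_ isT).
by apply: (main _ l d); rewrite 1?coprimep_sym //; apply: homog_modk.
Qed.

End RationalInverse.

Lemma size2_poly (R : nzRingType) (p : {poly R}) :
  (size p <= 2)%N -> p = p`_1 *: 'X + (p`_0)%:P.
Proof.
move=> sp; apply/polyP=> i; rewrite coefD coefZ coefX coefC.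
case: i => [|[|i]] /=; rewrite ?mulr0 ?mulr1 ?add0r ?addr0 //.
by rewrite nth_default // (leq_trans sp).
Qed.

Section Affine.

Variables (K : closedFieldType) (L : {poly K}) (q : nat) (a0 : K) (rs : seq K).
Hypothesis (HL : additive_separable L q a0 rs).

Variable F : function_field (LL_poly L).
Local Notation C := (ffC F).
Local Notation x := (ffX F).
Local Notation y := (ffY F).
Local Notation "p ^F" := (map_poly C p) (at level 1, format "p ^F") :
  ring_scope.

Lemma inKY_tau tau z a : translations rs tau -> a \in rs -> inKY z ->
  tau a z = z :> F.
Proof.
move=> tauP sa [r [s [_ _ ->]]]; have [aC _ ay] := tauP a sa.
by rewrite fmorph_div -!(eval2C C x y) !(eval2_rmorph _ _ _ aC) ay !eval2C.
Qed.

Lemma rs_neq0 : exists2 a, a \in rs & a != 0.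
Proof.
have /hasP[a sa an0] : has (predC1 0) rs; last by exists a.
apply/negPn; rewrite -all_predC; apply/negP => /allP r0.
have /uniq_leq_size := as_uniq HL => /(_ [:: 0]) H.
have : (size rs <= 1)%N by apply: H => a /r0; rewrite /= negbK inE.
by rewrite (as_card HL) leqNgt ltnW ?(as_q HL).
Qed.

Lemma const_root (p : {poly K}) (z : F) : p != 0 -> p^F.[z] = 0 ->
  exists c, z = C c.
Proof.
move=> p0; have [r ->] := closed_field_poly_normal p.
rewrite map_polyZ rmorph_prod /= hornerZ => /eqP.
rewrite mulf_eq0 fmorph_eq0 lead_coef_eq0 (negPf p0) /= horner_prod.
rewrite prodf_seq_eq0 => /hasP[c _] /=.
by rewrite map_polyXsubC hornerXsubC subr_eq0 => /eqP ->; exists c.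
Qed.

Lemma rmorph_horner (s : {rmorphism F -> F}) (p : {poly K}) z :
  (forall c, s (C c) = C c) -> s p^F.[z] = p^F.[s z].
Proof. by move=> sC;
  rewrite -(eval2C C x z) (eval2_rmorph _ _ _ sC) eval2C. Qed.

Variables (s t : {rmorphism F -> F}).
Hypotheses (sC : forall c, s (C c) = C c) (tC : forall c, t (C c) = C c).
Hypotheses (stK : forall z, s (t z) = z) (tsK : forall z, t (s z) = z).

Lemma ffs_nonconst c : s y != C c.
Proof. by rewrite -sC (inj_eq (fmorph_inj s)) (ffY_nonconst HL). Qed.

Lemma inKY_inv z : inKY (t z) ->
  exists k l, [/\ coprimep k l, l^F.[s y] != 0 & z = k^F.[s y] / l^F.[s y]].
Proof.
case=> k [l [kl ly tzE]]; exists k, l; split=> //.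
  apply: (nonconst_trans ffs_nonconst).
  by apply: contraNneq ly => ->; rewrite rmorph0 horner0.
by rewrite -[LHS]stK tzE fmorph_div -!(eval2C C x y) !(eval2_rmorph _ _ _ sC)
  !eval2C.
Qed.

(** The alternative, t x in K(y), would give x in K(s y), inside K(y), whereas translations move
    [x]. *)
Lemma inKY_aut_inv : inKY (s y) -> inKY (t y).
Proof.
move=> sy; have [tau tauP] := translations_exist HL F.
have [tx|//] := aut_inKY HL tauP tC (fun z => ex_intro _ (s z) (esym (tsK z))).
have [k [l [_ _ xE]]] := inKY_inv tx; have [a sa a0'] := rs_neq0.
have [aC ax ay] := tauP a sa.
have : tau a x = x.
  rewrite {1}xE fmorph_div -!(eval2C C x (s y)) !(eval2_rmorph _ _ _ aC).
  by rewrite (inKY_tau tauP sa sy) !eval2C -xE.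
by move/eqP; rewrite ax -subr_eq0 addrC addKr fmorph_eq0 (negPf a0').
Qed.

(** With z = s y, both z = g(y)/h(y) and y = k(z)/l(z) hold. As z is transcendental, substitution is
    a polynomial identity, so k and l have degree at most 1 by [homog_eq_size]; the relation is then
    solved for z. *)
Lemma moebius : inKY (s y) -> exists a b c d : K,
  C c * y + C d != 0 /\ s y * (C c * y + C d) = C a * y + C b.
Proof.
move=> sy; have [k [l [kl ly yE]]] := inKY_inv (inKY_aut_inv sy).
have [g [h [gh hy zE]]] := sy; set z := s y in zE ly yE.
pose d := (maxn (size g) (size h)).-1.
have h0 : h != 0 by apply: contraNneq hy => ->; rewrite rmorph0 horner0.
have dE : maxn (size g) (size h) = d.+1.
  by rewrite prednK // (leq_trans _ (leq_maxr _ _)) // size_poly_gt0.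
have sg : (size g <= d.+1)%N by rewrite -dE leq_maxl.
have sh : (size h <= d.+1)%N by rewrite -dE leq_maxr.
have [|sk sl] := homog_eq_size gh kl dE.
  apply/eqP; rewrite -subr_eq0;
    apply: contraTT isT => /(nonconst_trans ffs_nonconst).
  rewrite -/z rmorphB rmorphM /= map_polyX hornerD hornerN hornerM hornerX.
  by rewrite !horner_homog // -yE zE mulrCA divfK // subrr eqxx.
have lin (p : {poly K}) w : (size p <= 2)%N -> p^F.[w] = C p`_1 * w + C p`_0.
  move=> /size2_poly ->; rewrite rmorphD /= map_polyZ /= map_polyX map_polyC.
  rewrite hornerD hornerZ hornerX hornerC !coefD !coefZ !coefX !coefC /=.
  by rewrite mulr1 addr0 mulr0 add0r.
exists (- l`_0), k`_0, l`_1, (- k`_1); move: yE ly.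
rewrite !lin // => yE ly; split.
  (* A vanishing denominator forces l_1 = k_1 = 0, which would make y = k_0 / l_0 constant. *)
  apply/eqP; rewrite rmorphN => E;
    have := nonconst_trans (ffY_nonconst HL F) (_ : l`_1 *: 'X - (k`_1)%:P !=
      0).
  rewrite rmorphB /= map_polyZ map_polyX map_polyC hornerD hornerN hornerZ
    hornerX.
  rewrite hornerC E eqxx => H; have : ~~ (l`_1 *: 'X - (k`_1)%:P != 0).
    by apply/negP=> /H.
  rewrite negbK => /eqP/polyP lk0; have := lk0 0%N; have := lk0 1%N.
  rewrite !coefB !coefZ !coefX !coefC /= mulr1 subr0 mulr0 sub0r => l1.
  move/eqP; rewrite oppr_eq0 => /eqP k1.
  move: yE; rewrite l1 k1 !rmorph0 !mul0r !add0r -fmorph_div => /eqP.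
  by rewrite (negPf (ffY_nonconst HL F _)).
move/(congr1 (fun u => u * (C l`_1 * z + C l`_0))): yE; rewrite divfK // => E.
rewrite !rmorphN; apply/eqP; rewrite -subr_eq0; apply/eqP.
transitivity (y * (C l`_1 * z + C l`_0) - (C k`_1 * z + C k`_0)); first by ring.
by rewrite E subrr.
Qed.

(* The function s y moves under the translations of y only by constants, which
   excludes a finite pole. *)
Lemma affine sigma : translations (F := ffswap F) rs sigma ->
  (forall a, a \in rs -> sigma a (s x) = s x) -> inKY (s y) ->
  exists a b : K, a != 0 /\ s y = C a * y + C b.
Proof.
move=> sP fx sy; have [a [b [c [d [cd0 vE]]]]] := moebius sy.
have [e se e0] := rs_neq0; have [eC ey ex] := sP e se.
rewrite /= in eC ey ex; set v := s y in vE.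
(* As s x is fixed, so is L(v) = 1/L(s x); the difference is thus a root of [L], hence a
   constant. *)
have [g gE] : exists g, sigma e v = v + C g.
  have L0 : L != 0 by rewrite -size_poly_eq0 (as_size HL).
  have [|g gE] := @const_root L (sigma e v - v) L0; last first.
    by exists g; rewrite -gE addrC subrK.
  have uv := aut_LL sC; rewrite (LFB HL) -rmorph_horner //.
  rewrite -(mulr1_eq uv) fmorphV rmorph_horner // fx // subrr //.
have [c0|c0] := eqVneq c 0.
  have d0 : C d != 0 by move: cd0; rewrite c0 rmorph0 mul0r add0r.
  have vE' : v = C (a / d) * y + C (b / d).
    move: vE; rewrite c0 rmorph0 mul0r add0r => vE.
    by rewrite -[LHS](mulfK d0) vE !fmorph_div; field.
  exists (a / d), (b / d); split=> //; apply/eqP => ad0.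
  by have /eqP := ffs_nonconst (b / d); rewrite -/v vE' ad0 rmorph0 mul0r add0r.
have E := congr1 (sigma e) vE.
rewrite !(rmorphM (sigma e)) !(rmorphD (sigma e)) !(rmorphM (sigma e)) !eC ey
  gE in E.
(* The Moebius relation is compared with its translate and [v] eliminated; what remains is a
   polynomial identity in the transcendental [y]. *)
have E2 : C g * (C c * y + C c * C e + C d) * (C c * y + C d)
    + C e * (C b * C c - C a * C d) = 0.
  transitivity ((C c * y + C d) * ((v + C g) * (C c * (y + C e) + C d)
        - (C a * (y + C e) + C b))
      - (v * (C c * y + C d) - (C a * y + C b)) * (C c * y + C c * C e + C d)).
    by ring.
  by rewrite E vE !subrr mulr0 mul0r subrr.
pose p := g%:P * (c *: 'X + (c * e + d)%:P) * (c *: 'X + d%:P)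
  + (e * (b * c - a * d))%:P.
have p0 : p = 0.
  apply: (ff_transY HL (F := F)); rewrite -[RHS]E2 /p.
  rewrite rmorphD !(rmorphM (map_poly C)) !(rmorphD (map_poly C)) /=.
  rewrite !map_polyZ /= !map_polyX !map_polyC !hornerE /=.
  rewrite !rmorphM !rmorphB !rmorphD !rmorphM /=.
  by ring.
(* Evaluating at the pole y = -d/c leaves e (b c - a d) = 0. The transformation is then degenerate
   and s y would be constant. *)
have bc : b * c = a * d.
  have pE : p.[- d / c] = e * (b * c - a * d) by rewrite /p !hornerE /=; field.
  move/eqP: pE; rewrite p0 horner0 eq_sym.
  by rewrite mulf_eq0 (negPf e0) subr_eq0 => /eqP.
case/negP: (ffs_nonconst (a / c)); rewrite -/v fmorph_div -(inj_eq (mulIf cd0)).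
rewrite -(inj_eq (@mulfI _ (C c) _)) ?fmorph_eq0 // vE; apply/eqP.
transitivity (C a * (C c * y) + C (b * c)); first by rewrite rmorphM; ring.
by rewrite bc rmorphM; field; rewrite fmorph_eq0.
Qed.

End Affine.

Lemma comp_poly_scaleX (R : comNzRingType) (p : {poly R}) (c : R) :
  p \Po (c *: 'X) = \poly_(i < size p) (p`_i * c ^+ i).
Proof.
by rewrite comp_polyE poly_def; apply: eq_bigr => i _; rewrite exprZn scalerA.
Qed.

Lemma curve_aut_inv (K : fieldType) (f : {poly {poly K}}) (F : function_field f)
    (s : {rmorphism F -> F}) : curve_aut s ->
  exists t : {rmorphism F -> F}, [/\ curve_aut t, cancel t s & cancel s t].
Proof.
case=> [[t0 tsK stK]] sC.
have tB : zmod_morphism t0.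
  by move=> a b; apply: (can_inj tsK); rewrite rmorphB /= !stK.
have tM : monoid_morphism t0.
  by split=> [|a b]; apply: (can_inj tsK); rewrite ?rmorph1 ?rmorphM /= !stK.
pose t : {rmorphism F -> F} := HB.pack t0
  (GRing.isZmodMorphism.Build F F t0 tB) (GRing.isMonoidMorphism.Build F F t0
    tM).
exists t; split=> //; split; first by exists s.
by move=> c; apply: (can_inj tsK); rewrite /= stK sC.
Qed.

(** * Classification of the automorphisms *)

Section Classification.

Variables (K : closedFieldType) (L : {poly K}) (q : nat) (a0 : K) (rs : seq K).
Hypothesis (HL : additive_separable L q a0 rs).

Let sL : size L = q.+1. Proof. exact: as_size HL. Qed.

Definition scaling (A : K) := A != 0 /\ L \Po (A *: 'X) = A *: L.

(** L(A T) and L(T) have the same degree and the same q simple roots, so they are proportional; the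
    derivatives at 0 identify the factor as [A]. *)
Lemma scaling_root A : A != 0 -> (forall b, b \in rs -> L.[A * b] = 0) ->
  scaling A.
Proof.
move=> A0 rA; split=> //; set M := L \Po _.
have sAX : size (A *: 'X : {poly K}) = 2%N by rewrite size_scale ?size_polyX.
have sM : size M = q.+1 by rewrite size_comp_poly2.
have fact (p : {poly K}) : size p = q.+1 -> (forall b, b \in rs -> p.[b] = 0) ->
    p = lead_coef p *: \prod_(b <- rs) ('X - b%:P).
  move=> sp rp; apply: all_roots_prod_XsubC; rewrite ?sp ?(as_card HL) //.
    by apply/allP=> b /rp/rootP.
  by rewrite uniq_rootsE (as_uniq HL).
have [e ME] : exists e, M = e *: L.
  exists (lead_coef M / lead_coef L).
  rewrite [LHS]fact // => [|b rb]; last by rewrite horner_comp !hornerE rA.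
  rewrite [X in _ = _ *: X]fact // => [|b];
    last by rewrite (as_root HL) => /eqP.
  by rewrite scalerA divfK // lead_coef_eq0 -size_poly_eq0 sL.
rewrite ME; congr (_ *: _); apply: (mulIf (as_a0 HL)).
have := congr1 (fun p : {poly K} => p^`().[0]) ME.
rewrite /M deriv_comp !derivZ derivX (as_deriv HL) comp_polyC.
by rewrite !hornerE /= => <-; ring.
Qed.

Variable F : function_field (LL_poly L).
Local Notation C := (ffC F).
Local Notation x := (ffX F).
Local Notation y := (ffY F).
Local Notation "p ^F" := (map_poly C p) (at level 1, format "p ^F") :
  ring_scope.

Lemma scaling_horner A z : scaling A -> L^F.[C A * z] = C A * L^F.[z].
Proof.
case=> _ /(congr1 (fun p => p^F.[z])); rewrite map_comp_poly horner_comp.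
by rewrite !map_polyZ /= map_polyX !hornerZ hornerX.
Qed.

Lemma swap_exists : exists xi : {rmorphism F -> F},
  [/\ forall c, xi (C c) = C c, xi x = y & xi y = x].
Proof.
apply: (ff_lift HL); first by rewrite mulrC ff_eq.
exact: (ffY_nonconst HL (ffswap F)).
Qed.

Section Straight.

Variables (s t : {rmorphism F -> F}).
Hypotheses (sC : forall c, s (C c) = C c) (tC : forall c, t (C c) = C c).
Hypotheses (stK : forall z, s (t z) = z) (tsK : forall z, t (s z) = z).
Hypothesis sy : inKY (s y).

(** Otherwise s y would lie in K(x) too and be fixed by the translations of [y]; a Moebius function
    of [y] with this invariance is constant. *)
Lemma straight_x : @inKY K L (ffswap F) (s x).
Proof.
have [sigma sP] := translations_exist HL (ffswap F).
have [|//] := aut_inKY HL sP sC (fun z => ex_intro _ (t z) (esym (stK z))).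
move=> vx; have [a [b [c [d [cd0 vE]]]]] := moebius HL sC tC stK tsK sy.
have [e se e0] := rs_neq0 HL; have [eC ey ex] := sP e se.
have fv : sigma e (s y) = s y := inKY_tau sP se vx.
rewrite /= in eC ey ex; set v := s y in vE fv.
have vc : v * C c = C a.
  have E := congr1 (sigma e) vE.
  rewrite !(rmorphM (sigma e)) !(rmorphD (sigma e)) !(rmorphM (sigma e)) !eC ey
    fv in E.
  have Ce0 : C e != 0 by rewrite fmorph_eq0.
  apply: (mulIf Ce0).
  transitivity (v * (C c * (y + C e) + C d) - v * (C c * y + C d));
    first by ring.
  by rewrite E vE; ring.
have [c0|c0] := eqVneq c 0.
  have a_0 : C a = 0 by rewrite -vc c0 rmorph0 mulr0.
  move: cd0 vE; rewrite a_0 c0 rmorph0 !mul0r !add0r => d0 vE.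
  case/negP: (ffs_nonconst HL sC (b / d)).
  by rewrite -/v fmorph_div -vE mulfK.
case/negP: (ffs_nonconst HL sC (a / c)).
by rewrite -/v fmorph_div -vc mulfK ?fmorph_eq0.
Qed.

End Straight.

Lemma straight_aut (s t : {rmorphism F -> F}) :
  (forall c, s (C c) = C c) -> (forall c, t (C c) = C c) ->
  (forall z, s (t z) = z) -> (forall z, t (s z) = z) -> inKY (s y) ->
  exists A a b, [/\ scaling A, L.[a] = 0, L.[b] = 0, s x = C A * x + C a
    & s y = C A^-1 * y + C b].
Proof.
move=> sC tC stK tsK sy; have sx := straight_x sC tC stK tsK sy.
have ty := inKY_aut_inv HL sC tC stK tsK sy.
have [tau tauP] := translations_exist HL F.
have [sigma sP] := translations_exist HL (ffswap F).
have fx a : a \in rs -> sigma a (s x) = s x.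
  by move=> sa; apply: (inKY_tau sP sa sx).
have fy a : a \in rs -> tau a (s y) = s y.
  by move=> sa; apply: (inKY_tau tauP sa sy).
have [A' [b [A'0 vE]]] := affine HL sC tC stK tsK sP fx sy.
have [A [a [A0 uE]]] := @affine _ _ _ _ _ HL (ffswap F) s t sC tC stK tsK tau
  tauP fy sx.
rewrite /= in uE; have uv := aut_LL sC.
(* A translation fixing u and adding B e to v turns L(u) L(v) = 1 into L(u) L(B e) = 0. It is
   applied once in each coordinate. *)
have scale (G : function_field (LL_poly L)) (r : K -> {rmorphism G -> G}) B (c
  : K) u v :
    (forall e, e \in rs -> r e u = u) ->
    (forall e, e \in rs -> (forall c, r e (ffC G c) = ffC G c)) ->
    (forall e, e \in rs -> r e v = v + ffC G (B * e)) ->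
    (map_poly (ffC G) L).[u] * (map_poly (ffC G) L).[v] = 1 ->
    forall e, e \in rs -> L.[B * e] = 0.
  move=> ru rC rv uv' e se; have E := congr1 (r e) uv'.
  move: E; rewrite (rmorphM (r e)) (rmorph1 (r e)) !rmorph_horner;
    try exact: rC.
  rewrite ru // rv // (as_addR HL) mulrDr uv' => /eqP.
  rewrite -subr_eq0 addrC addKr mulf_eq0 fmorph_eq0 => /orP[/eqP Lu|/eqP //].
  by move/eqP: uv'; rewrite Lu mul0r eq_sym oner_eq0.
have scA' : scaling A'.
  apply: scaling_root A'0 _;
    apply: (@scale F sigma A' 0 (s x) (s y)) => // e se.
    by have [] := sP e se.
  have [eC ey _] := sP e se; rewrite /= in eC ey.
  by rewrite vE rmorphD (rmorphM (sigma e)) !eC ey rmorphM; ring.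
have scA : scaling A.
  apply: scaling_root A0 _;
    apply: (@scale F tau A 0 (s y) (s x)) => // [e se|e se|].
  - by have [] := tauP e se.
  - have [eC ex _] := tauP e se.
    by rewrite uE rmorphD (rmorphM (tau e)) !eC ex rmorphM; ring.
  by rewrite mulrC.
have Z0 c : L^F.[x] != C c.
  apply/eqP=> xc; have := @ff_transY _ _ _ _ _ HL (ffswap F) (L - c%:P).
  rewrite /= rmorphB /= map_polyC hornerD hornerN hornerC xc subrr => /(_
    erefl) /eqP.
  rewrite subr_eq0 => /eqP Lc; have := sL; rewrite Lc => sc.
  have := size_polyC_leq1 c; rewrite sc; have := as_q HL; by case: (q).
(* With Z = L(x) and L(y) = 1/Z, this is Z times the equation L(s x) L(s y) - 1 = 0. Since Z is not
   constant, every coefficient vanishes. *)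
pose p := (A * L.[b]) *: 'X^2 + (A * A' + L.[a] * L.[b] - 1) *: 'X + (L.[a] *
  A')%:P.
have p0 : p = 0.
  apply/eqP/negPn/negP=> /(nonconst_trans Z0)/eqP; apply.
  move: uv; rewrite uE vE !(as_addR HL) !scaling_horner // => uv.
  have : L^F.[x] * ((C A * L^F.[x] + C L.[a]) * (C A' * L^F.[y] + C L.[b]) - 1)
    = 0.
    by rewrite uv subrr mulr0.
  rewrite -(mulr1_eq (ff_eq F)) => <-; rewrite /p.
  rewrite !(rmorphD (map_poly C)) /= !map_polyZ /= map_polyXn map_polyX
    map_polyC.
  rewrite !hornerE /= !rmorphD rmorphN rmorph1 !rmorphM /=.
  have := Z0 0; rewrite rmorph0; move: (L^F.[x]) => Z Zn0; by field.
have coefp i : p`_i = 0 by rewrite p0 coef0.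
have := coefp 0%N; have := coefp 1%N; have := coefp 2%N.
rewrite /p !coefD !coefZ !coefXn !coefX !coefC /= !(mulr0, mulr1, addr0, add0r).
move/eqP; rewrite mulf_eq0 (negPf A0) /= => /eqP Lb.
rewrite Lb mulr0 addr0 => /eqP; rewrite subr_eq0 => /eqP AA' /eqP.
rewrite mulf_eq0 (negPf A'0) orbF => /eqP La.
by exists A, a, b; split=> //; rewrite (mulr1_eq AA').
Qed.

Lemma aut_classification (s : {rmorphism F -> F}) : curve_aut s ->
  exists A a b, [/\ scaling A, L.[a] = 0, L.[b] = 0
    & s x = C A * x + C a /\ s y = C A^-1 * y + C b \/
      s x = C A^-1 * y + C b /\ s y = C A * x + C a].
Proof.
move=> sA; have [t [[_ tC] stK tsK]] := curve_aut_inv sA; have [_ sC] := sA.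
have [tau tauP] := translations_exist HL F.
have [sx|sy] := aut_inKY HL tauP sC (fun z => ex_intro _ (t z) (esym (stK z)));
  last first.
  have [A [a [b [scA La Lb sxE syE]]]] := straight_aut sC tC stK tsK sy.
  by exists A, a, b; split=> //; left.
have [xi [xC xx xy]] := swap_exists.
have xiK z : xi (xi z) = z.
  apply: (@ff_ext _ _ F _ C (xi \o xi) (idfun : {rmorphism F -> F})) => //=
    [c||].
  - by rewrite !xC.
  - by rewrite xx xy.
  - by rewrite xy xx.
pose s' : {rmorphism F -> F} := s \o xi;
  pose t' : {rmorphism F -> F} := xi \o t.
have s'C c : s' (C c) = C c by rewrite /= xC sC.
have t'C c : t' (C c) = C c by exact: etrans (congr1 xi (tC c)) (xC c).
have s'K z : s' (t' z) = z by exact: etrans (congr1 s (xiK (t z))) (stK z).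
have t'K z : t' (s' z) = z by exact: etrans (congr1 xi (tsK (xi z))) (xiK z).
have s'y : inKY (s' y) by rewrite /= xy.
have [A [a [b [scA La Lb]]]] := straight_aut s'C t'C s'K t'K s'y.
rewrite /= xx xy => sxE syE.
by exists A, a, b; split=> //; right.
Qed.

End Classification.

(** * Linearized polynomials *)

Section Linearized.

Variables (p n m : nat) (Q q : nat).
Hypotheses (p_prime : prime p) (p_odd : odd p) (n_gt0 : (1 <= n)%N)
  (m_gt0 : (1 <= m)%N) (QE : Q = (p ^ n)%N) (qE : q = (Q ^ m)%N).
Variables (K : closedFieldType) (pK : p \in [pchar K]) (L : {poly K}).
Hypotheses (L_sep : separable_poly L) (L_lin : linearized Q L)
  (L_deg : size L = q.+1).

Lemma Q_gt2 : (2 < Q)%N.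
Proof.
have p3 : (2 < p)%N by have := odd_prime_gt2 p_odd p_prime.
by rewrite QE -(prednK n_gt0) expnS (leq_trans p3) // leq_pmulr // expn_gt0
  prime_gt0.
Qed.

Lemma linearized_coef k : L`_k != 0 -> exists j, k = (Q ^ j)%N.
Proof.
have [d [a ->]] := L_lin; rewrite coef_sum => /eqP nz.
have [/existsP[i /eqP]|/existsPn h] := boolP [exists i : 'I_d, k == (Q ^ i)%N].
  by exists i.
case: nz; apply: big1 => i _; rewrite coefZ coefXn.
by have := h i; case: eqP => //; rewrite mulr0.
Qed.

Lemma expQD (R : comNzRingType) (B : {rmorphism K -> R}) (u v : R) i :
  (u + v) ^+ (Q ^ i) = u ^+ (Q ^ i) + v ^+ (Q ^ i).
Proof.
apply: exprDn_pchar; rewrite QE !pnatX pnatE //.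
by rewrite (rmorph_pchar B pK).
Qed.

(** Powers by Q^i are additive in characteristic p, and Q^i is divisible by p for i > 0, so L' is
    the coefficient of T; separability makes it nonzero. *)
Lemma additive_separable_linearized : exists rs,
  additive_separable L q L`_1 rs.
Proof.
have L0 : L != 0 by rewrite -size_poly_eq0 L_deg.
have [r LE] := closed_field_poly_normal L.
have sr : size r = q.
  by move: L_deg;
    rewrite LE size_scale ?lead_coef_eq0 // size_prod_XsubC => -[].
have dL : L^`() = (L`_1)%:P.
  apply/polyP=> i; rewrite coef_deriv coefC; case: i => [|i] //=.
  have [->|Li] := eqVneq L`_(i.+2) 0; first by rewrite mul0rn.
  have [[|j] iE] := linearized_coef Li; first by case: iE.
  rewrite -mulr_natr; have /dvdnP[e ->] : (p %| i.+2)%N.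
    by rewrite iE QE expnS dvdn_mulr // dvdn_exp.
  by rewrite natrM (pcharf0 pK) !mulr0.
exists r; split=> //.
- move=> R B u v; have [d [a ->]] := L_lin.
  rewrite !rmorph_sum /= !horner_sum -big_split; apply: eq_bigr => i _ /=.
  rewrite map_polyZ map_polyXn !hornerZ !hornerXn (expQD B); exact: mulrDr.
- apply: contraTneq L_sep => L1; rewrite unlock dL L1 polyC0 coprimep0.
  rewrite -size_poly_eq1 L_deg eqSS; have := Q_gt2; case: (Q) qE => // k -> _.
  by rewrite -lt0n expn_gt0.
- rewrite qE (leq_trans Q_gt2) // -[X in (X <= _)%N]expn1 leq_exp2l ?(ltn_trans
  _ Q_gt2) //.
- have := L_sep; rewrite LE -separable_prod_XsubC => /(dvdp_separable _); apply.
  by rewrite dvdpZr ?lead_coef_eq0.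
- move=> c; rewrite [in RHS]LE hornerZ mulf_eq0 lead_coef_eq0 (negPf L0) /=.
  by rewrite -/(root _ c) root_prod_XsubC.
Qed.

Hypothesis L_nlin : forall k : nat, (2 <= k)%N -> ~ linearized (Q ^ k)%N L.

Lemma scaling_coef A : L \Po (A *: 'X) = A *: L <->
  forall k, L`_k != 0 -> A ^+ k = A.
Proof.
have cE k : (L \Po (A *: 'X))`_k = L`_k * A ^+ k.
  rewrite comp_poly_scaleX coef_poly; case: ltnP => // sk.
  by rewrite [L`_k]nth_default // mul0r.
split=> [E k Lk|E].
  by have := cE k; rewrite E coefZ mulrC => /(mulfI Lk).
apply/polyP=> k; rewrite cE coefZ mulrC.
by have [->|/E ->] := eqVneq L`_k 0; rewrite ?mulr0.
Qed.

(** A scaling satisfies A^(Q^j) = A for every exponent Q^j occurring in [L]. The least positive k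
    with A^(Q^k) = A divides all these j, so [L] is Q^k-linearized and k = 1. *)
Lemma scaling_root_unity A : scaling L A <-> A ^+ Q.-1 = 1.
Proof.
have Qp : Q.-1.+1 = Q by rewrite prednK // (leq_trans _ Q_gt2).
split=> [[A0 /scaling_coef E]|A1]; last first.
  split.
    apply: contra_eq_neq A1 => ->; rewrite expr0n eq_sym.
    have := Q_gt2; case: (Q) => [|[|k]] // _; exact: oner_neq0.
  apply/scaling_coef=> k Lk; have [j ->] := linearized_coef Lk.
  elim: j => [|j IH]; first exact: expr1.
  by rewrite expnSr exprM IH -Qp exprS A1 mulr1.
(* The leading exponent q = Q^m supplies such a k, namely m. *)
have ex : exists k, (0 < k)%N && (A ^+ (Q ^ k) == A).
  exists m; rewrite m_gt0 -qE; apply/eqP/E.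
  rewrite -[q]/(q.+1.-1) -L_deg -lead_coefE.
  by rewrite lead_coef_eq0 -size_poly_eq0 L_deg.
case: (ex_minnP ex) => k /andP[k0 /eqP Ak] kmin.
have Ake e : A ^+ (Q ^ (k * e)) = A.
  elim: e => [|e IH]; first by rewrite muln0.
  by rewrite mulnS expnD exprM Ak.
have supp j : L`_(Q ^ j) != 0 -> (k %| j)%N.
  move/E; rewrite {1}(divn_eq j k) mulnC expnD exprM Ake => Aj.
  apply/negPn/negP; rewrite /dvdn -lt0n => j0.
  have := kmin (j %% k)%N; rewrite j0 Aj eqxx => /(_ isT).
  by rewrite leqNgt ltn_pmod.
have k1 : k = 1%N.
  have [k2|] := leqP 2 k; last by case: k k0 {Ak kmin Ake supp} => [|[|]].
  case: (L_nlin k2); exists m.+1, (fun i => L`_(Q ^ (k * i))).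
  apply/polyP=> i; rewrite coef_sum.
  have term (e : 'I_m.+1) : (L`_(Q ^ (k * e)) *: 'X^((Q ^ k) ^ e))`_i
      = if i == (Q ^ (k * e))%N then L`_i else 0.
    by rewrite coefZ coefXn -expnM; case: eqP => [->|_]; rewrite ?mulr1 ?mulr0.
  have [Li|Li] := eqVneq L`_i 0.
    by rewrite Li big1 // => e _; rewrite term Li; case: ifP.
  have [j iE] := linearized_coef Li; rewrite iE in Li *.
  have /dvdnP[e je] := supp j Li.
  have jm : (j <= m)%N.
    rewrite -(leq_exp2l _ _ (ltnW Q_gt2)) -qE -ltnS -L_deg ltnNge.
    by apply: contra Li => sj; rewrite nth_default.
  have em : (e < m.+1)%N by rewrite ltnS (leq_trans _ jm) // je leq_pmulr.
  rewrite (bigD1 (Ordinal em)) //= big1 => [|e' e'e]; last first.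
    rewrite coefZ coefXn -expnM eqn_exp2l ?(ltnW Q_gt2) // je [(e * k)%N]mulnC.
    rewrite eqn_pmul2l // eq_sym.
    by move: e'e; rewrite -val_eqE /= => /negPf ->; rewrite mulr0.
  by rewrite addr0 coefZ coefXn -expnM je mulnC eqxx mulr1.
apply: (mulfI A0); rewrite -exprS Qp mulr1.
by rewrite -{2}Ak k1 expn1.
Qed.

End Linearized.

(** * The automorphism group *)

Section AutGroup.

Variables (K : closedFieldType) (f : {poly {poly K}}) (F : function_field f).
Local Notation C := (ffC F).
Local Notation x := (ffX F).
Local Notation y := (ffY F).

Lemma curve_aut_gen (s : {rmorphism F -> F}) : (forall c, s (C c) = C c) ->
  (exists z, s z = x) -> (exists z, s z = y) -> curve_aut s.
Proof.
move=> sC [zx sx] [zy sy]; split=> //.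
have surj z : exists z', s z' == z.
  have [g [h [_ ->]]] := ff_frac z.
  exists (eval2 C zx zy g / eval2 C zx zy h); apply/eqP.
  by rewrite fmorph_div !(eval2_rmorph _ _ _ sC) sx sy.
have tK : cancel (fun z => xchoose (surj z)) s.
  by move=> z; apply/eqP/(xchooseP (surj z)).
by exists (fun z => xchoose (surj z)) => // z; apply: (fmorph_inj s); apply: tK.
Qed.

Lemma curve_aut_comp (s t : {rmorphism F -> F}) :
  curve_aut s -> curve_aut t -> curve_aut (s \o t).
Proof.
move=> [sb sC] [tb tC]; split; first exact: bij_comp.
by move=> c /=; rewrite tC sC.
Qed.

(** Composition is transported to the indices. The index of an automorphism can be computed because
    the images of [x] and [y] determine it and are compared by a Boolean test. *)
Lemma ord_aut_group n (phi : 'I_n -> {rmorphism F -> F}) :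
  (forall g, curve_aut (phi g)) -> (forall g h, phi g =1 phi h -> g = h) ->
  (forall s, curve_aut s -> exists g, phi g =1 s) ->
  exists (gT : finGroupType) (psi : gT -> {rmorphism F -> F}), full_aut_group
    psi.
Proof.
move=> phiA inj surj.
have code (s : {rmorphism F -> F}) : curve_aut s -> {g | phi g =1 s}.
  move=> sA; have ex : exists g, (phi g x == s x) && (phi g y == s y).
    by have [g gs] := surj s sA; exists g; rewrite !gs !eqxx.
  have [g /andP[/eqP gx /eqP gy]] := sigW ex; exists g.
  by apply: (ff_ext (B := C)) => //; [case: (phiA g) | case: sA].
have idA : curve_aut (idfun : {rmorphism F -> F}) by split=> //; exists id.
pose mul g h := sval (code _ (curve_aut_comp (phiA g) (phiA h))).
have mulE g h z : phi (mul g h) z = phi g (phi h z).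
  exact: (svalP (code _ (curve_aut_comp (phiA g) (phiA h)))).
pose one := sval (code _ idA).
have oneE z : phi one z = z by apply: (svalP (code _ idA)).
have exV g : exists h, mul h g == one.
  have [t [tA tK _]] := curve_aut_inv (phiA g); have [h ht] := surj t tA.
  exists h; apply/eqP/inj => z; rewrite mulE oneE ht.
  by apply: (fmorph_inj (phi g)); rewrite tK.
pose inv g := xchoose (exV g).
have mulA : associative mul by move=> g h k; apply: inj => z; rewrite !mulE.
have mul1 : left_id one mul by move=> g; apply: inj => z; rewrite mulE oneE.
have mulV : left_inverse one inv mul by move=> g; apply/eqP/(xchooseP (exV g)).
pose mix := Finite_isGroup.Build 'I_n mulA mul1 mulV.
pose gT : finGroupType := HB.pack 'I_n mix.
by exists gT, phi; split.
Qed.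

Lemma finite_aut_group (T : finType) (phi : T -> {rmorphism F -> F}) :
  (forall g, curve_aut (phi g)) -> (forall g h, phi g =1 phi h -> g = h) ->
  (forall s, curve_aut s -> exists g, phi g =1 s) ->
  exists (gT : finGroupType) (psi : gT -> {rmorphism F -> F}), full_aut_group
    psi.
Proof.
move=> phiA inj surj;
  apply: (@ord_aut_group #|T| (fun i => phi (enum_val i))) => //.
  by move=> i j /inj; apply: enum_val_inj.
by move=> s /surj[g gs]; exists (enum_rank g) => z; rewrite enum_rankK.
Qed.

Section Structure.

Variables (gT : finGroupType) (phi : gT -> {rmorphism F -> F}).
Hypothesis phiP : full_aut_group phi.

Let phiA g : curve_aut (phi g). Proof. by case: phiP. Qed.
Let phiC g c : phi g (C c) = C c. Proof. by case: (phiA g). Qed.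
Let phiM g h z : phi (g * h)%g z = phi g (phi h z).
Proof. by case: phiP => _ M _ _; apply: M. Qed.

Lemma phi_inj g h : phi g x = phi h x -> phi g y = phi h y -> g = h.
Proof.
move=> gx gy; case: phiP => _ _ I _; apply: I.
by apply: (ff_ext (B := C)) => // c; rewrite phiC.
Qed.

Lemma phi1 z : phi 1%g z = z.
Proof. by apply: (fmorph_inj (phi 1%g)); rewrite -phiM mulg1. Qed.

Lemma phiV g z : phi g^-1%g (phi g z) = z.
Proof. by rewrite -phiM mulVg phi1. Qed.

Definition aut_code (u v : F) : gT :=
  odflt 1%g [pick g | (phi g x == u) && (phi g y == v)].

Lemma aut_codeP (s : {rmorphism F -> F}) u v : curve_aut s -> s x = u -> s y =
  v ->
  phi (aut_code u v) x = u /\ phi (aut_code u v) y = v.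
Proof.
move=> sA sx sy; rewrite /aut_code;
  case: pickP => [g /andP[/eqP -> /eqP ->] //|no].
have [g gs] : exists g, phi g =1 s by case: phiP => _ _ _; apply.
by have := no g; rewrite !gs sx sy !eqxx.
Qed.

End Structure.

End AutGroup.

(** * Existence of the full automorphism group as a finite group *)

Section FullGroup.

Variables (K : closedFieldType) (L : {poly K}) (q : nat) (a0 : K) (rs : seq K).
Hypothesis (HL : additive_separable L q a0 rs).
Variables (N : nat) (lambda : K).
Hypotheses (N_gt1 : (1 < N)%N) (lambda_prim : N.-primitive_root lambda).
Hypothesis scalingE : forall A, scaling L A <-> A ^+ N = 1.

Let q_gt0 : (0 < q)%N. Proof. by have := as_q HL; case: (q). Qed.

Variable F : function_field (LL_poly L).
Local Notation C := (ffC F).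
Local Notation x := (ffX F).
Local Notation y := (ffY F).
Local Notation "p ^F" := (map_poly C p) (at level 1, format "p ^F") :
  ring_scope.

Lemma scalingV A : scaling L A -> scaling L A^-1.
Proof. by move/scalingE => A1; apply/scalingE; rewrite exprVn A1 invr1. Qed.

Lemma scaling_lambda k : scaling L (lambda ^+ k).
Proof. by apply/scalingE;
  rewrite exprAC (prim_expr_order lambda_prim) expr1n. Qed.

Lemma scaling_mem A a : scaling L A -> L.[a] = 0 -> L.[A * a] = 0.
Proof.
case=> _ /(congr1 (fun p => p.[a]));
  rewrite horner_comp !hornerZ hornerX => -> ->.
exact: mulr0.
Qed.

Lemma curve_aut_straight A a b : scaling L A -> L.[a] = 0 -> L.[b] = 0 ->
  exists s : {rmorphism F -> F},
    [/\ curve_aut s, s x = C A * x + C a & s y = C A^-1 * y + C b].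
Proof.
move=> scA La Lb; have [A0 _] := scA; have CA0 : C A != 0 by rewrite fmorph_eq0.
have [||s [sC sx sy]] := @ff_lift _ _ _ _ _ HL F (C A * x + C a) (C A^-1 * y +
  C b).
- rewrite !(as_addR HL) !(scaling_horner _ _) //; last exact: scalingV.
  rewrite La Lb rmorph0 !addr0 mulrACA ff_eq mulr1 -rmorphM mulfV //.
  exact: rmorph1.
- move=> c; apply: contraNneq (ffY_nonconst HL F (A * (c - b))) => yE.
  by rewrite rmorphM rmorphB -yE addrK fmorphV mulVKf.
exists s; split=> //; apply: curve_aut_gen => //.
  exists (C A^-1 * (x - C a)).
  by rewrite rmorphM rmorphB !sC sx addrK fmorphV mulKf.
exists (C A * (y - C b)).
by rewrite rmorphM rmorphB !sC sy addrK fmorphV mulVKf.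
Qed.

Lemma curve_aut_swapped A a b : scaling L A -> L.[a] = 0 -> L.[b] = 0 ->
  exists s : {rmorphism F -> F},
    [/\ curve_aut s, s x = C A^-1 * y + C b & s y = C A * x + C a].
Proof.
move=> scA La Lb; have [s [sA sx sy]] := curve_aut_straight scA La Lb.
have [xi [xC xx xy]] := swap_exists HL F.
have xiA : curve_aut xi by apply: curve_aut_gen => //; [exists y | exists x].
exists (s \o xi); split; first exact: curve_aut_comp.
  by rewrite /= xx sy.
by rewrite /= xy sx.
Qed.

Lemma lin_inj (G : function_field (LL_poly L)) A a B b :
  ffC G A * ffY G + ffC G a = ffC G B * ffY G + ffC G b -> A = B /\ a = b.
Proof.
move=> E; have : ((A - B) *: 'X + (a - b)%:P : {poly K}) = 0.
  apply: (ff_transY HL (F := G)).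
  rewrite rmorphD /= map_polyZ map_polyX map_polyC hornerD hornerZ hornerX
    hornerC /=.
  rewrite !rmorphB.
  transitivity ((ffC G A * ffY G + ffC G a) - (ffC G B * ffY G + ffC G b));
    first by ring.
  by rewrite E subrr.
move=> /polyP p0; have := p0 0%N; have := p0 1%N.
rewrite !coefD !coefZ !coefX !coefC /= mulr0 mulr1 add0r addr0.
by move=> /eqP; rewrite subr_eq0 => /eqP -> /eqP; rewrite subr_eq0 => /eqP ->.
Qed.

Lemma lin_injX A a B b : C A * x + C a = C B * x + C b -> A = B /\ a = b.
Proof. exact: (@lin_inj (ffswap F)). Qed.

(** A translation of [x] by a nonzero root e moves the left side by A e and fixes the right side. *)
Lemma lin_mixed A a B b : A != 0 -> C A * x + C a <> C B * y + C b.
Proof.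
move=> A0 E; have [tau tauP] := translations_exist HL F.
have [e se e0] := rs_neq0 HL; have [tC tx ty] := tauP e se.
have := congr1 (tau e) E;
  rewrite !(rmorphD (tau e)) !(rmorphM (tau e)) !tC tx ty.
rewrite -E => /eqP; rewrite -subr_eq0.
have -> : C A * (x + C e) + C a - (C A * x + C a) = C A * C e by ring.
by rewrite mulf_eq0 !fmorph_eq0 (negPf A0) (negPf e0).
Qed.

Lemma rs_nth (i : 'I_q) : L.[rs`_i] = 0.
Proof. by apply/eqP; rewrite -(as_root HL) mem_nth // (as_card HL). Qed.

Lemma rs_nthP a : L.[a] = 0 -> exists i : 'I_q, a = rs`_i.
Proof.
move/eqP; rewrite -(as_root HL) => sa.
have ia : (index a rs < q)%N by rewrite -(as_card HL) index_mem.
by exists (Ordinal ia); rewrite nth_index.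
Qed.

Lemma rs_nth_inj (i j : 'I_q) : rs`_i = rs`_j -> i = j.
Proof.
move/eqP; rewrite nth_uniq ?(as_card HL) ?(as_uniq HL) // => /eqP.
exact: val_inj.
Qed.

Lemma lambda_inj (i j : 'I_N) : lambda ^+ i = lambda ^+ j -> i = j.
Proof.
move/eqP; rewrite (eq_prim_root_expr lambda_prim) !modn_small // => /eqP.
exact: val_inj.
Qed.

Lemma full_aut_group_exists : exists (gT : finGroupType)
  (phi : gT -> {rmorphism F -> F}), full_aut_group phi.
Proof.
(* The entries are positions of the two roots in [rs], the exponent of [lambda], and whether the
   coordinates are swapped. *)
pose T : finType := ('I_q * 'I_q * 'I_N * bool)%type.
pose str (c : T) (s : {rmorphism F -> F}) :=
  let: (i, j, k, e) := c in
  let u := C (lambda ^+ k) * x + C rs`_i in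
  let v := C (lambda ^+ k)^-1 * y + C rs`_j in
  [/\ curve_aut s, s x = if e then v else u & s y = if e then u else v].
have [phi phiP] : exists phi : T -> {rmorphism F -> F}, forall c, str c (phi c).
  have [|phi phiP] := @seq_choice T _ (idfun : {rmorphism F -> F}) str (enum T).
    move=> [[[i j] k] []] _.
      exact: (curve_aut_swapped (scaling_lambda k) (rs_nth i) (rs_nth j)).
    exact: (curve_aut_straight (scaling_lambda k) (rs_nth i) (rs_nth j)).
  by exists phi => c; apply: phiP; rewrite mem_enum.
have lk0 (k : nat) : lambda ^+ k != 0 by have [] := scaling_lambda k.
apply: (@finite_aut_group _ _ _ T phi).
- by move=> [[[i j] k] e]; have [] := phiP (i, j, k, e).
- move=> [[[i j] k] e] [[[i' j'] k'] e'] E.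
  have [_ px py] := phiP (i, j, k, e);
    have [_ px' py'] := phiP (i', j', k', e').
  move: (E x) (E y); rewrite px px' py py'; case: (e) (e') => [] [].
  + move=> /(@lin_inj F)[_ /rs_nth_inj ->] /lin_injX[/lambda_inj -> /rs_nth_inj
    ->] //.
  + by move=> /esym/(lin_mixed (lk0 _)).
  + by move=> /(lin_mixed (lk0 _)).
  + move=> /lin_injX[/lambda_inj -> /rs_nth_inj ->] /(@lin_inj F)[_ /rs_nth_inj
    ->] //.
move=> s sA;
  have [A [a [b [/scalingE A1 La Lb sE]]]] := aut_classification HL sA.
have [k AE] := prim_rootP lambda_prim A1.
have [i aE] := rs_nthP La; have [j bE] := rs_nthP Lb.
have [_ sC] := sA; rewrite AE aE bE in sE.
case: sE => [] [sx sy]; [exists (i, j, k, false) | exists (i, j, k, true)].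
  have [[_ pC] px py] := phiP (i, j, k, false).
  by apply: (ff_ext (B := C)) => //; rewrite ?sx ?sy.
have [[_ pC] px py] := phiP (i, j, k, true).
by apply: (ff_ext (B := C)) => //; rewrite ?sx ?sy.
Qed.

End FullGroup.

(** * The semidirect product structure *)

Section GroupStructure.

Variables (K : closedFieldType) (L : {poly K}) (q : nat) (a0 : K) (rs : seq K).
Hypothesis (HL : additive_separable L q a0 rs).
Variables (N : nat) (lambda : K).
Hypotheses (N_gt1 : (1 < N)%N) (lambda_prim : N.-primitive_root lambda).
Hypothesis scalingE : forall A, scaling L A <-> A ^+ N = 1.

Variable F : function_field (LL_poly L).
Local Notation C := (ffC F).
Local Notation x := (ffX F).
Local Notation y := (ffY F).

Variables (gT : finGroupType) (phi : gT -> {rmorphism F -> F}).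
Hypothesis phiP : full_aut_group phi.

Let phiA g : curve_aut (phi g). Proof. by case: phiP. Qed.
Let phiC g c : phi g (C c) = C c. Proof. by case: (phiA g). Qed.
Let phiM g h z : phi (g * h)%g z = phi g (phi h z).
Proof. by case: phiP => _ M _ _; apply: M. Qed.

Let scL k : scaling L (lambda ^+ k).
Proof. exact: scaling_lambda lambda_prim scalingE k. Qed.

Definition tau_elt a b := aut_code phi (x + C a) (y + C b).
Definition theta_elt := aut_code phi (C lambda * x) (C lambda^-1 * y).
Definition xi_elt := aut_code phi y x.

Local Notation tau := tau_elt.
Local Notation theta := theta_elt.
Local Notation xi := xi_elt.

Lemma tau_eltP a b : L.[a] = 0 -> L.[b] = 0 ->
  phi (tau a b) x = x + C a /\ phi (tau a b) y = y + C b.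
Proof.
move=> La Lb; have := curve_aut_straight HL scalingE F (scL 0) La Lb.
rewrite expr0 invr1 rmorph1 !mul1r => -[s [sA sx sy]].
exact: (aut_codeP phiP sA sx sy).
Qed.

Lemma theta_eltX k : phi (theta ^+ k)%g x = C (lambda ^+ k) * x /\
  phi (theta ^+ k)%g y = C (lambda ^+ k)^-1 * y.
Proof.
have L0 := as_add0 HL; have := curve_aut_straight HL scalingE F (scL 1) L0 L0.
rewrite expr1 rmorph0 !addr0 => -[s [sA sx sy]].
have [tx ty] := aut_codeP phiP sA sx sy; rewrite -/theta in tx ty.
elim: k => [|k [IHx IHy]].
  by rewrite expg0 !(phi1 phiP) expr0 invr1 rmorph1 !mul1r.
rewrite expgSr !phiM tx ty !(rmorphM (phi _)) !phiC IHx IHy !mulrA -!(rmorphM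
  C).
by rewrite exprS invfM.
Qed.

Lemma theta_eltP : phi theta x = C lambda * x /\ phi theta y = C lambda^-1 * y.
Proof. exact: theta_eltX 1%N. Qed.

Lemma xi_eltP : phi xi x = y /\ phi xi y = x.
Proof.
have L0 := as_add0 HL; have := curve_aut_swapped HL scalingE F (scL 0) L0 L0.
rewrite expr0 invr1 rmorph1 !mul1r rmorph0 !addr0 => -[s [sA sx sy]].
exact: (aut_codeP phiP sA sx sy).
Qed.

Lemma tau_eltD a b c d : L.[a] = 0 -> L.[b] = 0 -> L.[c] = 0 -> L.[d] = 0 ->
  [/\ L.[a + c] = 0, L.[b + d] = 0 & (tau a b * tau c d)%g = tau (a + c) (b +
    d)].
Proof.
have rootD u v : L.[u] = 0 -> L.[v] = 0 -> L.[u + v] = 0.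
  by move=> /eqP; rewrite -(as_root HL) => su /eqP; rewrite -(as_root HL) => sv;
     apply/eqP; rewrite -(as_root HL) (rsD HL).
move=> La Lb Lc Ld; have Lac := rootD _ _ La Lc; have Lbd := rootD _ _ Lb Ld.
have [ab_x ab_y] := tau_eltP La Lb; have [cd_x cd_y] := tau_eltP Lc Ld.
have [e_x e_y] := tau_eltP Lac Lbd; split=> //; apply: (phi_inj phiP).
  by rewrite phiM cd_x e_x rmorphD phiC ab_x (rmorphD C) addrA.
by rewrite phiM cd_y e_y rmorphD phiC ab_y (rmorphD C) addrA.
Qed.

Lemma tau_elt0 : tau 0 0 = 1%g.
Proof.
have L0 := as_add0 HL; have [tx ty] := tau_eltP L0 L0.
by apply: (phi_inj phiP); rewrite (phi1 phiP) ?tx ?ty rmorph0 addr0.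
Qed.

Lemma tau_elt_inj a b c d : L.[a] = 0 -> L.[b] = 0 -> L.[c] = 0 -> L.[d] = 0 ->
  tau a b = tau c d -> a = c /\ b = d.
Proof.
move=> La Lb Lc Ld E; have [ab_x ab_y] := tau_eltP La Lb.
have := tau_eltP Lc Ld;
  rewrite -E ab_x ab_y => -[/addrI/fmorph_inj + /addrI/fmorph_inj].
by [].
Qed.

Definition translation_set : {set gT} :=
  (fun ij : 'I_q * 'I_q => tau rs`_(ij.1) rs`_(ij.2)) @: [set: 'I_q * 'I_q].

Lemma translation_setP g : reflect
  (exists a b, [/\ L.[a] = 0, L.[b] = 0 & g = tau a b]) (g \in translation_set).
Proof.
apply: (iffP imsetP) => [[[i j] _ ->]|[a [b [La Lb ->]]]].
  by exists rs`_i, rs`_j; rewrite !(rs_nth HL).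
have [i ->] := rs_nthP HL La; have [j ->] := rs_nthP HL Lb.
by exists (i, j).
Qed.

Lemma card_translation_set : #|translation_set| = (q ^ 2)%N.
Proof.
rewrite card_imset; first by rewrite cardsT card_prod card_ord.
move=> [i j] [i' j'] /=; case/tau_elt_inj; rewrite ?(rs_nth HL) //.
by move=> /(rs_nth_inj HL) -> /(rs_nth_inj HL) ->.
Qed.

Lemma translation_group_set : group_set translation_set.
Proof.
apply/group_setP; split.
  by apply/translation_setP; exists 0, 0; rewrite tau_elt0 (as_add0 HL).
move=> _ _ /translation_setP[a [b [La Lb ->]]] /translation_setP[c [d [Lc Ld
  ->]]].
have [Lac Lbd ->] := tau_eltD La Lb Lc Ld.
by apply/translation_setP; exists (a + c), (b + d).
Qed.

Definition Sigma : {group gT} := Group translation_group_set.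
Definition Delta : {group gT} := <<[set theta; xi]>>%G.

Lemma xi_order : #[xi]%g = 2%N.
Proof.
have [xx xy] := xi_eltP; apply: nt_prime_order => //.
  by apply: (phi_inj phiP); rewrite expgS expg1 phiM (phi1 phiP) ?xx ?xy ?xx.
apply/eqP=> xi1; have := xx; rewrite xi1 (phi1 phiP) => E.
apply: (lin_mixed HL (F := F) (A := 1) (a := 0) (B := 1) (b := 0)).
  exact: oner_neq0.
by rewrite rmorph1 rmorph0 !mul1r !addr0.
Qed.

Lemma xi_notin_theta k : (theta ^+ k)%g != xi.
Proof.
apply/eqP => E; have [xx _] := xi_eltP; have [tx _] := theta_eltX k.
move: tx; rewrite E xx => yE.
apply: (lin_mixed HL (F := F) (A := lambda ^+ k) (a := 0) (B := 1) (b := 0)).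
  by have [] := scL k.
by rewrite rmorph1 rmorph0 !mul1r !addr0.
Qed.

Lemma theta_order : #[theta]%g = N.
Proof.
have thetaX1 k : (theta ^+ k == 1)%g = (lambda ^+ k == 1).
  have [tx ty] := theta_eltX k; apply/eqP/eqP => [t1|l1]; last first.
    by apply: (phi_inj phiP);
      rewrite (phi1 phiP) ?tx ?ty l1 ?invr1 rmorph1 mul1r.
  move: tx; rewrite t1 (phi1 phiP) => E.
  have [] := @lin_injX _ _ _ _ _ HL F (lambda ^+ k) 0 1 0; last by [].
  by rewrite rmorph1 rmorph0 mul1r !addr0 -E.
apply/eqP; rewrite eqn_dvd order_dvdn thetaX1 (prim_expr_order lambda_prim)
  eqxx /=.
by rewrite (prim_order_dvd lambda_prim) -thetaX1 expg_order.
Qed.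

Lemma theta_conj_xi : (theta ^ xi = theta^-1)%g.
Proof.
have [xx xy] := xi_eltP; have [tx ty] := theta_eltP.
have l0 : lambda != 0 by have [] := scL 1.
(* The relation becomes theta xi theta = xi, which is checked on [x] and [y]. *)
apply: (mulgI xi); rewrite -conjgC; apply: (mulIg theta).
rewrite mulgKV; apply: (phi_inj phiP); rewrite !phiM.
  by rewrite tx (rmorphM (phi xi)) phiC xx (rmorphM (phi theta)) phiC ty
    fmorphV mulVKf ?fmorph_eq0.
by rewrite ty (rmorphM (phi xi)) phiC xy (rmorphM (phi theta)) phiC tx fmorphV
  mulKf ?fmorph_eq0.
Qed.

Lemma DeltaE : Delta = (<[theta]> * <[xi]>)%g :> {set gT}.
Proof.
rewrite -norm_joinEr; first by rewrite /= joing_idl joing_idr.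
by rewrite cycle_subG inE -cycleJ theta_conj_xi cycleV.
Qed.

Lemma Delta_mem g : g \in Delta -> exists k, g = (theta ^+ k)%g \/ g = (theta
  ^+ k * xi)%g.
Proof.
rewrite -[g \in _]/(g \in (Delta : {set gT})) DeltaE => /mulsgP[_ h /cycleP[k
  ->]].
rewrite (cycle2g xi_order) !inE => /pred2P[] -> ->; exists k; last by right.
by left; rewrite mulg1.
Qed.

Lemma card_Delta : #|Delta| = (2 * N)%N.
Proof.
transitivity (#[theta]%g * #[xi]%g)%N;
  last by rewrite theta_order xi_order mulnC.
rewrite DeltaE; apply: TI_cardMg.
apply/trivgP/subsetP=> g; rewrite inE => /andP[/cycleP[k ->]].
by rewrite /= (cycle2g xi_order) !inE (negPf (xi_notin_theta k)) orbF.
Qed.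

(** A group generated by two distinct involutions is dihedral; here they are [xi] and [theta * xi],
    distinct because theta has order N > 1. *)
Lemma Delta_dihedral : (Delta \isog 'D_(2 * N))%g.
Proof.
have [xx xy] := xi_eltP; have [tx ty] := theta_eltP.
have l0 : lambda != 0 by have [] := scL 1.
have DE : Delta = <<[set xi; theta * xi]>>%g :> {set gT}.
  apply/eqP; rewrite eqEsubset !gen_subG !subUset !sub1set.
  have xg : xi \in <<[set xi; theta * xi]>>%g by rewrite mem_gen ?set21.
  have xd : xi \in Delta by rewrite mem_gen ?set22.
  have td : theta \in Delta by rewrite mem_gen ?set21.
  have tg : theta \in <<[set xi; theta * xi]>>%g.
    by rewrite -[X in X \in _](mulgK xi) groupM ?groupV // mem_gen ?set22.
  by rewrite xg xd tg groupM.
have txn1 : (theta * xi != 1)%g.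
  apply: contra_neq (xi_notin_theta N.-1) => E.
  apply: (mulgI theta); rewrite E -expgS prednK ?(ltnW N_gt1) //.
  by rewrite -theta_order expg_order.
have o2 : #[theta * xi]%g = 2%N.
  apply: nt_prime_order => //.
  by rewrite expgS expg1 {1}(conjgC theta xi) theta_conj_xi -mulgA mulKg -[X in
    (X * _)%g]expg1 -expgSr -xi_order expg_order.
have ne : (xi != theta * xi)%g.
  rewrite -[X in X != _]mul1g (inj_eq (mulIg xi)) eq_sym -order_gt1 theta_order.
  exact: N_gt1.
by have := involutions_gen_dihedral xi_order o2 ne; rewrite /= -DE card_Delta.
Qed.

Lemma Delta_norm : Delta \subset 'N(Sigma)%g.
Proof.
have [xx xy] := xi_eltP; have [tx ty] := theta_eltP.
have sc1 := scL 1; rewrite expr1 in sc1.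
rewrite gen_subG subUset !sub1set !inE; apply/andP; split;
  apply/subsetP=> _ /imsetP[_ /translation_setP[a [b [La Lb ->]]] ->];
    apply/translation_setP.
  have [ab_x ab_y] := tau_eltP La Lb.
  have Lla := scaling_mem sc1 La;
    have Llb := scaling_mem (scalingV scalingE sc1) Lb.
  (* Conjugation by theta scales the two translation parts inversely, and both stay roots of [L]
     because lambda is a scaling; conjugation by xi exchanges them. *)
  exists (lambda * a), (lambda^-1 * b); split=> //.
  have [c_x c_y] := tau_eltP Lla Llb.
  apply: (phi_inj phiP); rewrite ?c_x ?c_y conjgE !phiM.
    rewrite tx (rmorphM (phi (tau a b))) phiC ab_x mulrDr -tx -rmorphM.
    by rewrite rmorphD (phiV phiP) phiC.
  rewrite ty (rmorphM (phi (tau a b))) phiC ab_y mulrDr -ty -rmorphM.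
  by rewrite rmorphD (phiV phiP) phiC.
have [ab_x ab_y] := tau_eltP La Lb; have [c_x c_y] := tau_eltP Lb La.
exists b, a; split=> //.
apply: (phi_inj phiP); rewrite ?c_x ?c_y conjgE !phiM.
  by rewrite xx ab_y -xx rmorphD (phiV phiP) phiC.
by rewrite xy ab_x -xy rmorphD (phiV phiP) phiC.
Qed.

Lemma Sigma_Delta_TI : (Sigma :&: Delta = 1)%g.
Proof.
apply/trivgP/subsetP=> g;
  rewrite inE => /andP[/translation_setP[a [b [La Lb gE]]]].
have [ab_x ab_y] := tau_eltP La Lb; have [xx xy] := xi_eltP.
case/Delta_mem=> k []; rewrite gE => E; move: ab_x ab_y; rewrite E.
  have [tx ty] := theta_eltX k; rewrite tx ty => Ex Ey.
  have [_ a_0] : 1 = lambda ^+ k /\ a = 0.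
    by apply: (lin_injX HL (F := F)); rewrite rmorph1 rmorph0 mul1r addr0.
  have [_ b_0] : 1 = (lambda ^+ k)^-1 /\ b = 0.
    by apply: (lin_inj HL (G := F)); rewrite rmorph1 rmorph0 mul1r addr0.
  by rewrite -E a_0 b_0 tau_elt0 inE.
have [tx ty] := theta_eltX k; rewrite !phiM xx ty => Ex _.
have /(_ _)[] := lin_mixed HL (F := F) (A := 1) (a := a) (B := (lambda ^+
  k)^-1) (b := 0).
  exact: oner_neq0.
by rewrite rmorph1 rmorph0 mul1r addr0.
Qed.

Lemma Sigma_Delta_sdprod : (Sigma ><| Delta)%g = [set: gT]%g.
Proof.
(* The product is written with [Delta] on the left: [phi] composes, so in theta^k tau the outer
   theta^k fixes the constants added by tau, and those of the classification can be used
   unchanged. *)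
rewrite (sdprodE Delta_norm Sigma_Delta_TI) -(normC Delta_norm).
apply/setP=> g; rewrite inE; apply/mulsgP.
have [A [a [b [scA La Lb gE]]]] := aut_classification HL (phiA g).
have /(prim_rootP lambda_prim)[k AE] := iffLR (scalingE A) scA.
rewrite {}AE {scA} in gE.
have [tx ty] := theta_eltX k; have [xx xy] := xi_eltP.
have tD : (theta ^+ k)%g \in Delta by rewrite groupX // mem_gen ?set21.
have xD : xi \in Delta by rewrite mem_gen ?set22.
case: gE => [] [gx gy].
  have [ab_x ab_y] := tau_eltP La Lb.
  exists (theta ^+ k)%g (tau a b) => //.
    by apply/translation_setP; exists a, b.
  apply: (phi_inj phiP); rewrite phiM ?gx ?gy ?ab_x ?ab_y rmorphD phiC.
    by rewrite tx.
  by rewrite ty.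
have [ab_x ab_y] := tau_eltP Lb La.
exists (theta ^+ k * xi)%g (tau b a); first exact: groupM.
  by apply/translation_setP; exists b, a.
apply: (phi_inj phiP); rewrite !phiM ?gx ?gy ?ab_x ?ab_y !(rmorphD, phiC).
  by rewrite xx ty.
by rewrite xy tx.
Qed.

Lemma Sigma_abelem p : prime p -> p \in [pchar K] -> (p.-abelem Sigma)%g.
Proof.
move=> p_pr pK; apply/abelemP => //; split.
  apply/centsP=> _ /translation_setP[a [b [La Lb ->]]] _ /translation_setP[c [d
    [Lc Ld ->]]].
  have [_ _ E] := tau_eltD La Lb Lc Ld; have [_ _ E'] := tau_eltD Lc Ld La Lb.
  by rewrite /commute E E' [a + c]addrC [b + d]addrC.
move=> _ /translation_setP[a [b [La Lb ->]]];
  have [ab_x ab_y] := tau_eltP La Lb.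
have tX k : phi (tau a b ^+ k)%g x = x + C (a *+ k) /\
            phi (tau a b ^+ k)%g y = y + C (b *+ k).
  elim: k => [|k [IHx IHy]].
    by rewrite !(phi1 phiP) !mulr0n rmorph0 !addr0.
  rewrite expgS !phiM IHx IHy !rmorphD !phiC ab_x ab_y !mulrS !(rmorphD C).
  by rewrite !addrA.
have [px py] := tX p; rewrite !(mulrn_pchar pK) rmorph0 !addr0 in px py.
by apply: (phi_inj phiP); rewrite (phi1 phiP).
Qed.

End GroupStructure.

Theorem theorem1p1
  (p n m : nat) (qbar q : nat)
  (p_prime : prime p) (p_odd : odd p) (n_gt0 : (1 <= n)%N) (m_gt0 : (1 <= m)%N)
  (qbarE : qbar = (p ^ n)%N) (qE : q = (qbar ^ m)%N)
  (K : closedFieldType) (FptoK : {rmorphism 'F_p -> K})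
  (K_alg : integralRange FptoK)
  (L : {poly K}) (L_sep : separable_poly L) (L_lin : linearized qbar L)
  (L_deg : size L = q.+1)
  (L_nlin : forall k : nat, (2 <= k)%N -> ~ linearized (qbar ^ k)%N L)
  (F : function_field (LL_poly L))
  (lambda : K) (lambda_prim : (qbar - 1)%N.-primitive_root lambda) :
  exists (gT : finGroupType) (phi : gT -> {rmorphism F -> F})
         (Sigma Delta : {group gT}) (tau : K -> K -> gT) (theta xi : gT),
  [/\ full_aut_group phi,
      (Sigma ><| Delta)%g = [set: gT]%g,
      [/\ forall alpha beta, L.[alpha] = 0 -> L.[beta] = 0 ->
            induced_by (phi (tau alpha beta))
                       (ffX F + ffC F alpha) (ffY F + ffC F beta),
          forall g, g \in Sigma <->
            exists alpha beta,
              [/\ L.[alpha] = 0, L.[beta] = 0 & g = tau alpha beta],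
          (p.-abelem Sigma)%g
        & #|Sigma| = (q ^ 2)%N]
    & [/\ induced_by (phi theta)
            (ffC F lambda * ffX F) (ffC F lambda^-1 * ffY F),
          induced_by (phi xi) (ffY F) (ffX F),
          Delta = <<[set theta; xi]>>%g :> {set gT},
          (Delta \isog 'D_(2 * (qbar - 1)))%g
        & #|Delta| = (2 * (qbar - 1))%N]].
Proof.
have pK : p \in [pchar K] := rmorph_pchar FptoK (pchar_Fp p_prime).
have [rs HL] := additive_separable_linearized p_prime p_odd n_gt0 m_gt0 qbarE qE
  pK L_sep L_lin L_deg.
have qbar_gt2 := Q_gt2 p_prime p_odd n_gt0 qbarE.
(* An odd prime gives qbar > 2, so theta is nontrivial. *)
have N_gt1 : (1 < qbar - 1)%N by rewrite ltn_subRL.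
have scE A : scaling L A <-> A ^+ (qbar - 1) = 1.
  rewrite subn1.
  exact: (scaling_root_unity p_prime p_odd n_gt0 m_gt0 qbarE qE L_lin L_deg L_nlin).
have [gT [phi phiP]] := full_aut_group_exists HL lambda_prim scE F.
exists gT, phi, (Sigma HL lambda_prim scE phiP), (Delta lambda phi).
exists (tau_elt phi), (theta_elt lambda phi), (xi_elt phi).
have thetaP := theta_eltP HL lambda_prim scE phiP.
have xiP := xi_eltP HL lambda_prim scE phiP.
split=> //; first exact: Sigma_Delta_sdprod.
  split=> [a b La Lb|g||].
  - exact: (tau_eltP HL lambda_prim scE phiP La Lb).
  - by split=> /(translation_setP HL phi).
  - exact: Sigma_abelem.
  - exact: (card_translation_set HL lambda_prim scE phiP).
split=> //; first exact: (Delta_dihedral HL N_gt1 lambda_prim scE phiP).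
exact: (card_Delta HL lambda_prim scE phiP).
Qed.
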